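(* Let $0<\alpha_0\le\alpha<2$, $c_l,c_U,c_H>0$, let $\Omega\subset\mathbb{R}^d$ be bounded and open, and assume that $k$ satisfies condition (E$_\ge$) with constant $c_l$ and condition (U1) with constant $c_U$, and that the Green function $G$ on $\Omega$ satisfies condition (H) with constant $c_H$. Then $$G(x,y)\ge C|x-y|^{\alpha-d}\quad\text{for all }x,y\in\Omega\text{ with }0<|x-y|\le\operatorname{dist}(y,\partial\Omega)/2,$$ for some constant $C>0$ depending only on $d$, $c_l$, $c_U$, $c_H$ and $\alpha_0$ (and not on $\alpha$ or $\Omega$).
   Context: Throughout, $d\ge 3$ and $k:(\mathbb{R}^d\times\mathbb{R}^d)\setminus\{x=y\}\to[0,\infty)$ is a measurable function with $k(x,y)=k(y,x)$ and $\sup_{x\in\mathbb{R}^d}\int_{\mathbb{R}^d}(1\wedge|y-x|^2)k(x,y)\,dy<\infty$. For an open set $U\subset\mathbb{R}^d$ and measurable $u,v$, $\mathcal{E}_U(u,v)=\int_U\int_U(u(y)-u(x))(v(y)-v(x))k(x,y)\,dy\,dx$ (when finite), and $\mathcal{E}=\mathcal{E}_{\mathbb{R}^d}$. For $0<\alpha<2$ let $k^{(\alpha)}(x,y)=\frac{2^\alpha\Gamma((d+\alpha)/2)}{\pi^{d/2}|\Gamma(-\alpha/2)|}|y-x|^{-d-\alpha}$ and let $\mathcal{E}^\alpha_U$, $\mathcal{E}^\alpha$ denote the same forms with $k$ replaced by $k^{(\alpha)}$. $H(\mathbb{R}^d;k)=\{u\in L^2(\mathbb{R}^d):\mathcal{E}(u,u)<\infty\}$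 and, for open $\Omega$, $H_\Omega(\mathbb{R}^d;k)=\{u\in H(\mathbb{R}^d;k): u=0\text{ a.e. on }\mathbb{R}^d\setminus\Omega\}$; $\langle f,g\rangle=\int fg\,dx$. Condition (E$_\ge$) with constant $c_l>0$: for every ball $B=B_r(x_0)\subset\mathbb{R}^d$ and every $u\in L^2(B)$, $\mathcal{E}_B(u,u)\ge c_l\,\mathcal{E}^\alpha_B(u,u)$. Condition (U1) with constant $c_U>0$: for all $r>0$, $\sup_{x\in\mathbb{R}^d}\int_{\mathbb{R}^d}(r^2\wedge|y-x|^2)k(x,y)\,dy\le c_U r^{2-\alpha}$. Green function: for a bounded open $\Omega\subset\mathbb{R}^d$, a measurable $G:\mathbb{R}^d\times\mathbb{R}^d\to[0,\infty]$ is a Green function on $\Omega$ if $G(\cdot,y)\in L^1(\Omega)$ for each $y\in\Omega$, $G=0$ a.e. on $(\mathbb{R}^d\times\mathbb{R}^d)\setminus(\Omega\times\Omega)$, and $\int_{\mathbb{R}^d}G(x,y)\psi(x)\,dx=\varphi(y)$ for every $y\in\Omega$, every $\varphi\in H_\Omega(\mathbb{R}^d;k)\cap C(\Omega)$ and every $\psi\in L^\infty(\Omega)$ such that $\mathcal{E}(\varphi,v)=\langle\psi,v\rangle$ for all $v\in H_\Omega(\mathbb{R}^d;k)$. Under (E$_\ge$) and (U1) it exists and is unique. Condition (H) (annulus Harnack inequality) with constant $c_H>0$: for every $y\in\Omega$ and every ball $B_{2r}(y)\Subset\Omega$, $\sup_{B_{2r}(y)\setminus B_r(y)}G(\cdot,y)\le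 c_H\inf_{B_{2r}(y)\setminus B_r(y)}G(\cdot,y)$. *)

(* Defs.v *)
(* Points of R^d are d.-tuples of reals, carrying the
   library's product (= Borel) sigma-algebra; Lebesgue integrals on R^d are
   defined as iterated one-dimensional Lebesgue integrals (Tonelli). *)
From HB Require Import structures.
From mathcomp Require Import all_boot all_order all_algebra.
From mathcomp Require Import all_classical all_reals all_analysis measurable_realfun.
Set Implicit Arguments. Unset Strict Implicit. Unset Printing Implicit Defensive.
Import Order.TTheory GRing.Theory Num.Theory.
Import numFieldNormedType.Exports.
Local Open Scope classical_set_scope.
Local Open Scope ring_scope.

Section Defs.
Variable R : realType.

Definition pt (d : nat) := d.-tuple (measurableTypeR R).

Definition eucl d (x y : pt d) : R :=
  Num.sqrt (\sum_(i < d) (tnth x i - tnth y i) ^+ 2).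

(* Lebesgue integral over R^d of a [0,+oo]-valued function, as iterated integral *)
Fixpoint iint (n : nat) : (pt n -> \bar R) -> \bar R :=
  match n as m return (pt m -> \bar R) -> \bar R with
  | 0 => fun f => f [tuple]
  | n'.+1 => fun f =>
      (\int[@lebesgue_measure R]_x iint (fun t : pt n' => f (cons_tuple x t)))%E
  end.

Definition sint d (f : pt d -> \bar R) : \bar R :=
  (iint (fun x => maxe (f x) 0) - iint (fun x => maxe (- f x) 0))%E.

Definition iint2 d (F : pt d -> pt d -> \bar R) : \bar R :=
  iint (fun x => iint (fun y => F x y)).

Definition sint2 d (F : pt d -> pt d -> \bar R) : \bar R :=
  (iint2 (fun x y => maxe (F x y) 0) - iint2 (fun x y => maxe (- F x y) 0))%E.

Definition null d (A : set (pt d)) : Prop := iint (fun x => (\1_A x)%:E) = 0%E.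
Definition null2 d (A : set (pt d * pt d)) : Prop :=
  iint2 (fun x y => (\1_A (x, y))%:E) = 0%E.

Definition oball d (x0 : pt d) (r : R) : set (pt d) := [set x | eucl x0 x < r].
Definition cball d (x0 : pt d) (r : R) : set (pt d) := [set x | eucl x0 x <= r].
Definition is_open d (O : set (pt d)) : Prop :=
  forall x, O x -> exists2 e : R, 0 < e & oball x e `<=` O.
Definition is_bounded d (O : set (pt d)) : Prop :=
  exists M : R, forall x, O x -> eucl x (nseq_tuple d 0) <= M.
Definition boundary d (O : set (pt d)) : set (pt d) :=
  [set z | forall e : R, 0 < e -> exists2 w, O w & eucl z w < e] `\` O.
Definition dist_bdry d (O : set (pt d)) (y : pt d) : R :=
  inf [set eucl y z | z in boundary O].
Definition continuous_on d (O : set (pt d)) (f : pt d -> R) : Prop :=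
  forall x, O x -> forall e : R, 0 < e -> exists2 dl : R, 0 < dl &
    forall z, O z -> eucl z x < dl -> `|f z - f x| < e.

Definition Eform d (k : pt d -> pt d -> R) (U : set (pt d)) (u v : pt d -> R)
  : \bar R :=
  sint2 (fun x y => (\1_U x * \1_U y *
                     ((u y - u x) * (v y - v x) * k x y))%:E).

(* Gamma function: Euler integral for s > 0, and Gamma(s) = Gamma(s+1)/s
   (its analytic continuation) for -1 < s <= 0 (only s in (-1,0) is used) *)
Definition Gamma_pos (s : R) : R :=
  fine (\int[@lebesgue_measure R]_(t in `]0%R, +oo[%classic)
          ((t `^ (s - 1)) * expR (- t))%:E)%E.
Definition Gamma (s : R) : R :=
  if 0 < s then Gamma_pos s else Gamma_pos (s + 1) / s.

Definition kalpha (d : nat) (alpha : R) (x y : pt d) : R :=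
  (2 `^ alpha * Gamma ((d%:R + alpha) / 2))
    / (pi `^ (d%:R / 2) * `|Gamma (- (alpha / 2))|)
    * (eucl y x) `^ (- (d%:R + alpha)).

Definition admissible_kernel d (k : pt d -> pt d -> R) : Prop :=
  [/\ measurable_fun setT (fun p : pt d * pt d => k p.1 p.2),
      (forall x y, 0 <= k x y),
      (forall x y, k x y = k y x) &
      exists M : R, forall x,
        (iint (fun y => (Num.min 1 (eucl y x ^+ 2) * k x y)%:E) <= M%:E)%E].

Definition L2on d (A : set (pt d)) (u : pt d -> R) : Prop :=
  measurable_fun setT u /\ (iint (fun x => (\1_A x * u x ^+ 2)%:E) < +oo)%E.

Definition E_ge d (alpha : R) (k : pt d -> pt d -> R) (c_l : R) : Prop :=
  forall (x0 : pt d) (r : R), 0 < r -> forall u, L2on (oball x0 r) u ->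
    (Eform k (oball x0 r) u u >= c_l%:E * Eform (@kalpha d alpha) (oball x0 r) u u)%E.

Definition U1 d (alpha : R) (k : pt d -> pt d -> R) (c_U : R) : Prop :=
  forall r : R, 0 < r -> forall x : pt d,
    (iint (fun y => (Num.min (r ^+ 2) (eucl y x ^+ 2) * k x y)%:E)
       <= (c_U * r `^ (2 - alpha))%:E)%E.

Definition Hk d (k : pt d -> pt d -> R) (u : pt d -> R) : Prop :=
  L2on setT u /\ (Eform k setT u u < +oo)%E.
Definition HkOmega d (k : pt d -> pt d -> R) (O : set (pt d)) (u : pt d -> R)
  : Prop := Hk k u /\ null [set x | ~ O x /\ u x <> 0].

Definition pairing d (f g : pt d -> R) : \bar R := sint (fun x => (f x * g x)%:E).

Definition Linfty_on d (O : set (pt d)) (psi : pt d -> R) : Prop :=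
  measurable_fun setT psi /\
  exists M : R, null [set x | O x /\ M < `|psi x|].

Definition green_function d (k : pt d -> pt d -> R) (O : set (pt d))
    (G : pt d -> pt d -> \bar R) : Prop :=
  [/\ measurable_fun setT (fun p : pt d * pt d => G p.1 p.2),
      (forall x y, (0 <= G x y)%E),
      (forall y, O y -> iint (fun x => (\1_O x)%:E * G x y) < +oo)%E,
      null2 [set p | ~ (O p.1 /\ O p.2) /\ G p.1 p.2 <> 0%E] &
      forall y, O y -> forall phi psi : pt d -> R,
        HkOmega k O phi -> continuous_on O phi -> Linfty_on O psi ->
        (forall v, HkOmega k O v ->
           Eform k setT phi v = pairing (fun x => \1_O x * psi x) v) ->
        sint (fun x => (G x y * (\1_O x * psi x)%:E)%E) = (phi y)%:E].

Definition harnack_H d (O : set (pt d)) (G : pt d -> pt d -> \bar R) (c_H : R)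
  : Prop :=
  forall (y : pt d) (r : R), O y -> 0 < r -> cball y (2 * r) `<=` O ->
    (ereal_sup [set G z y | z in oball y (2 * r) `\` oball y r]
     <= c_H%:E * ereal_inf [set G z y | z in oball y (2 * r) `\` oball y r])%E.

End Defs.

(* Main.v *)
Require Import Defs.
From HB Require Import structures.
From mathcomp Require Import all_boot all_order all_algebra.
From mathcomp Require Import all_classical all_reals all_analysis measurable_realfun.
From mathcomp Require Import ring lra.
Set Implicit Arguments. Unset Strict Implicit. Unset Printing Implicit Defensive.
Import Order.TTheory GRing.Theory Num.Theory.
Import numFieldNormedType.Exports.
Local Open Scope classical_set_scope.
Local Open Scope ring_scope.

(* Let [phi_s] be the weak solution in H_Omega with right-hand side the indicator
   of the ball B_s(y). Once [phi_s] is known to be continuous, the definition of G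
   gives that [phi_s y] is the integral of G(., y) over B_s(y). With r = |x - y|,
   [phi_r y >= c r^alpha] whereas [phi_(eps r) y <= C (eps r)^alpha], so for eps
   small the integral of G(., y) over B_r minus B_(eps r) is at least
   [c r^alpha / 2]; by (H), iterated along finitely many annuli, G(., y) is there
   at most a constant times G(x, y), and the bound follows.
   Both estimates of [phi_s] are De Giorgi iterations resting on a Faber-Krahn
   inequality for E whose constant is uniform in alpha >= alpha0, because the
   normalizing constant of k^(alpha) is comparable to 2 - alpha. Continuity is only
   needed qualitatively: a logarithmic estimate shows that the essential upper and
   lower limits of a bounded solution coincide at every point of Omega. *)

(** * Lebesgue measure on R^d *)

(** Neither hypothesis bounds [k] pointwise: [E_ge] is a lower bound for the form on balls, [U1] an
    upper bound for integrals of [k] against truncated squares. Coercivity therefore enters only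
    through forms, and upper bounds only through integrals of cutoffs. The definition of G tests
    with continuous solutions and evaluates them at y, which forces a continuous representative of a
    solution constructed up to null sets. The constant behind continuity may degenerate as alpha
    tends to 2; those of the two bounds may not. These are kept uniform by lowering the exponent
    alpha to alpha0 or raising it to 2, according to the direction of the inequality. The hypothesis
    d >= 3 acts through d - alpha >= 1: the natural levels of the potential of a small ball at least
    double when the distance is halved. Nonlocality is tamed by asking that supersolutions be
    nonnegative on the whole space. Where this fails, the negative part far away acts as a bounded
    source, which is negligible on small balls by scaling. *)

Lemma sigma_finite_prod d1 d2 (T1 : measurableType d1) (T2 : measurableType d2) (R : realType)
    (m1 : {sigma_finite_measure set T1 -> \bar R})
    (m2 : {sigma_finite_measure set T2 -> \bar R}) :
  sigma_finite setT (m1 \x m2)%E.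
Proof.
have /sigma_finiteP[A [TA ndA Afin]] := sigma_finiteT m1.
have /sigma_finiteP[B [TB ndB Bfin]] := sigma_finiteT m2.
exists (fun n => A n `*` B n) => [|n].
  apply/seteqP; split => // -[x y] _.
  have [i _ Aix] : (\bigcup_i A i) x by rewrite -TA.
  have [j _ Bjy] : (\bigcup_i B i) y by rewrite -TB.
  exists (maxn i j) => //; split => /=.
    by move: x Aix; exact/subsetPset/ndA/leq_maxl.
  by move: y Bjy; exact/subsetPset/ndB/leq_maxr.
have [mA A_lty] := Afin n; have [mB B_lty] := Bfin n.
split; first exact: measurableX.
by rewrite product_measure1E// lte_mul_pinfty// ge0_fin_numE.
Qed.

Section LebesgueRn.
Context {R : realType}.
Local Notation leb := (@lebesgue_measure R).

Lemma cons_pair_measurable n :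
  measurable_fun setT (fun p : measurableTypeR R * pt R n => cons_tuple p.1 p.2 : pt R n.+1).
Proof. exact: measurable_cons. Qed.

(** [iint] is a bare iterated integral with no measure behind it; realizing it as integration
    against a sigma-finite measure opens the way to Tonelli, Fatou and almost-everywhere arguments.
    The measure in dimension n+1 is the image of a product under [cons_tuple]; its measurable left
    inverse [psi] carries an exhaustion over, whence sigma-finiteness. *)
Lemma exists_lebn n : exists mu : {sigma_finite_measure set (pt R n) -> \bar R},
  forall f : pt R n -> \bar R, measurable_fun setT f -> (forall x, 0 <= f x)%E ->
  iint f = (\int[mu]_x f x)%E.
Proof.
elim: n => [|n [mu muE]].
  exists (\d_([tuple] : pt R 0))%R => f mf f0 /=.
  by rewrite integral_dirac// diracT mul1e.
pose phi (p : measurableTypeR R * pt R n) : pt R n.+1 := cons_tuple p.1 p.2.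
have mphi : measurable_fun setT phi := @cons_pair_measurable n.
pose psi (t : pt R n.+1) : measurableTypeR R * pt R n := (thead t, [tuple of behead t]).
have mpsi : measurable_fun setT psi.
  apply/measurable_fun_pairP; split; first exact: measurable_tnth.
  exact: measurable_behead.
have phiK p : psi (phi p) = p.
  by case: p => a t; rewrite /psi /phi/= theadE; congr pair; exact/val_inj.
pose m : {measure set (pt R n.+1) -> \bar R} :=
  @measure_function_pushforward__canonical__measure_function_Measure _ _ _ _ _
     (leb \x mu)%E phi mphi.
have sm : sigma_finite setT m.
  have [F FT Ffin] := sigma_finite_prod leb mu.
  exists (fun i => psi @^-1` F i).
    by rewrite -preimage_bigcup -FT preimage_setT.
  move=> i; have [mF Fi] := Ffin i; split.
    by rewrite -[X in measurable X]setTI; exact: mpsi.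
  rewrite /m/= /pushforward -comp_preimage [X in X @^-1` _](_ : _ = id) ?preimage_id//.
  exact/funext.
pose m' : {sigma_finite_measure set (pt R n.+1) -> \bar R} :=
  HB.pack (m : set _ -> \bar R) m (@Measure_isSigmaFinite.Build _ _ _ m sm).
exists m' => f mf f0 /=.
have mfphi : measurable_fun setT (fun p => f (phi p)) by exact: measurableT_comp.
rewrite (@ge0_integral_pushforward _ _ _ _ _ _ mphi) ?preimage_setT//.
rewrite fubini_tonelli1//; last by move=> x /=.
apply: eq_integral => x _; rewrite muE// /fubini_F/=.
apply: (measurableT_comp mf).
exact: (measurableT_comp mphi (pair1_measurable _)).
Qed.

Definition lebn n : {sigma_finite_measure set (pt R n) -> \bar R} :=
  projT1 (cid (exists_lebn n)).

Lemma iintE n (f : pt R n -> \bar R) : measurable_fun setT f ->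
  (forall x, 0 <= f x)%E -> iint f = (\int[lebn n]_x f x)%E.
Proof. by rewrite /lebn; case: cid => mu /= h; exact: h. Qed.

Lemma measurable_iint d (T : measurableType d) n (F : T -> pt R n -> \bar R) :
  measurable_fun setT (fun p : T * pt R n => F p.1 p.2) ->
  (forall x t, 0 <= F x t)%E ->
  measurable_fun setT (fun x => iint (F x)).
Proof.
move=> mF F0.
have -> : (fun x => iint (F x)) = fubini_F (lebn n) (fun p => F p.1 p.2).
  apply/funext => x; rewrite /fubini_F/= iintE//.
  exact: (measurableT_comp mF (pair1_measurable _)).
exact: measurable_fun_fubini_tonelli_F.
Qed.

(** Lebesgue measure is determined by its values on the intervals ]x, y], and c times its image
    under the affine map has the same values there. *)
Lemma lebesgue_measure_affine (c a : R) (A : set (measurableTypeR R)) : 0 < c -> measurable A ->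
  leb A = (c%:E * leb ((fun x => c * x + a)%R @^-1` A))%E.
Proof.
move=> c0 mA.
have mT : measurable_fun setT (fun x : measurableTypeR R => c * x + a : measurableTypeR R).
  exact: measurable_funD.
pose m : {measure set (measurableTypeR R) -> \bar R} :=
  mscale (NngNum (ltW c0)) (@measure_function_pushforward__canonical__measure_function_Measure _ _ _ _ _
     leb _ mT).
rewrite -[RHS]/(m A).
apply: lebesgue_measure_unique => //= _ [[x y]] _ <-.
rewrite /m/= /mscale/= /pushforward.
have -> : (fun z => c * z + a) @^-1` `]x, y]%classic = `](x - a) / c, (y - a) / c]%classic.
  apply/seteqP; split=> z/=; rewrite !in_itv/= ltr_pdivrMr// ler_pdivlMr// [z * c]mulrC.
    by rewrite ltrBlDr lerBrDr.
  by rewrite ltrBlDr lerBrDr.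
rewrite !lebesgue_measure_itv/= !lte_fin ltr_pM2r ?invr_gt0// ltrD2r.
case: ifPn; last by rewrite mule0.
move=> _; rewrite -!EFinB -EFinM; congr EFin.
by field; rewrite gt_eqF.
Qed.

Lemma integral_affine (c a : R) (f : measurableTypeR R -> \bar R) : 0 < c ->
  measurable_fun setT f -> (forall x, 0 <= f x)%E ->
  (\int[leb]_x f x = c%:E * \int[leb]_x f (c * x + a)%R)%E.
Proof.
move=> c0 mf f0.
have mT : measurable_fun setT (fun x : measurableTypeR R => c * x + a : measurableTypeR R).
  exact: measurable_funD.
pose m : {measure set (measurableTypeR R) -> \bar R} :=
  (@measure_function_pushforward__canonical__measure_function_Measure _ _ _ _ _
     leb _ mT).
rewrite (eq_measure_integral (mscale (NngNum (ltW c0)) m)); last first.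
  by move=> A mA _; exact: (lebesgue_measure_affine a c0 mA).
rewrite ge0_integral_mscale//=; congr (_ * _)%E.
by rewrite (@ge0_integral_pushforward _ _ _ _ _ _ mT) ?preimage_setT//; move=> y _.
Qed.

(** [affine 1 h] serves as translation by [h] and [affine c origin] as dilation, so that one change
    of variables covers both. *)
Definition affine n (c : R) (a t : pt R n) : pt R n := [tuple c * tnth t i + tnth a i | i < n].

Lemma tnth_affine n c (a t : pt R n) i : tnth (affine c a t) i = c * tnth t i + tnth a i.
Proof. by rewrite tnth_mktuple. Qed.

Lemma measurable_affine n c (d : measure_display) (T : measurableType d) (f g : T -> pt R n) :
  measurable_fun setT f -> measurable_fun setT g ->
  measurable_fun setT (fun x => affine c (f x) (g x)).
Proof.
move=> mf mg; apply/measurable_fun_tnthP => i.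
rewrite [X in measurable_fun _ X](_ : _ = fun x => c * tnth (g x) i + tnth (f x) i); last first.
  by apply/funext => x /=; rewrite tnth_affine.
move/measurable_fun_tnthP : mf => /(_ i) mf.
move/measurable_fun_tnthP : mg => /(_ i) mg.
by apply: measurable_funD => //; exact: measurable_funM.
Qed.

Lemma tnth_cons_lift n (x : R) (t : pt R n) j : tnth (cons_tuple x t) (lift ord0 j) = tnth t j.
Proof. by rewrite !(tnth_nth x). Qed.

Lemma affine_cons n c (a0 x : R) (a t : pt R n) :
  affine c (cons_tuple a0 a) (cons_tuple x t) =
  cons_tuple (c * x + a0) (affine c a t) :> pt R n.+1.
Proof.
apply: eq_from_tnth => i; rewrite tnth_affine.
case: (unliftP ord0 i) => [j ->|->]; last by rewrite !(tnth_nth 0).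
by rewrite !tnth_cons_lift tnth_affine.
Qed.

Lemma iint_affine n (c : R) (a : pt R n) (f : pt R n -> \bar R) : 0 < c ->
  measurable_fun setT f -> (forall x, 0 <= f x)%E ->
  (iint f = (c ^+ n)%:E * iint (fun t => f (affine c a t)))%E.
Proof.
move=> c0; elim: n a f => [|n IH] a f mf f0 /=.
  by rewrite mul1e; congr f; apply: eq_from_tnth => -[].
have mcons : measurable_fun setT (fun p : measurableTypeR R * pt R n => f (cons_tuple p.1 p.2)).
  by apply: measurableT_comp => //; exact: cons_pair_measurable.
rewrite (@integral_affine c (thead a))//; last 2 first.
- exact: (measurable_iint mcons).
- move=> x; rewrite iintE//; first exact: integral_ge0.
  exact: (measurableT_comp mcons (pair1_measurable _)).
have ea x (t : pt R n) : affine c a (cons_tuple x t) = cons_tuple (c * x + thead a) (affine c [tuple of behead a] t) :> pt R n.+1.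
  by rewrite -affine_cons; congr (affine c _ _); rewrite {1}(tuple_eta a); exact/val_inj.
have m2 : measurable_fun setT (fun p : measurableTypeR R * pt R n => f (affine c a (cons_tuple p.1 p.2))).
  apply: measurableT_comp => //; apply: measurable_affine => //.
  exact: cons_pair_measurable.
rewrite exprS EFinM -muleA; congr (_ * _)%E.
rewrite -ge0_integralZl//; last 3 first.
- exact: (measurable_iint m2).
- move=> x _; rewrite iintE//; first exact: integral_ge0.
  exact: (measurableT_comp m2 (pair1_measurable _)).
- by rewrite lee_fin exprn_ge0 ?ltW.
apply: eq_integral => x _.
rewrite (IH [tuple of behead a])//; last first.
  exact: (measurableT_comp mcons (pair1_measurable _)).
by congr (_ * _)%E; congr iint; apply/funext => t; rewrite ea.
Qed.

Lemma integral_lebn_affine n (c : R) (a : pt R n) (f : pt R n -> \bar R) : 0 < c ->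
  measurable_fun setT f -> (forall x, 0 <= f x)%E ->
  (\int[lebn n]_x f x = (c ^+ n)%:E * \int[lebn n]_x f (affine c a x))%E.
Proof.
move=> c0 mf f0; rewrite -!iintE//; first exact: iint_affine.
by apply: measurableT_comp => //; exact: measurable_affine.
Qed.

End LebesgueRn.

(** * Euclidean distance and balls *)

Section Eucl.
Context {R : realType} {d : nat}.
Local Notation T := (pt R d).
Implicit Types x y z h : T.

Definition origin : T := nseq_tuple d 0.

Lemma tnth_origin i : tnth origin i = 0.
Proof. by rewrite tnth_nseq. Qed.

Lemma eucl_ge0 x y : 0 <= eucl x y. Proof. exact: sqrtr_ge0. Qed.

Lemma eucl_sqr x y : eucl x y ^+ 2 = \sum_(i < d) (tnth x i - tnth y i) ^+ 2.
Proof. by rewrite sqr_sqrtr// sumr_ge0// => i _; exact: sqr_ge0. Qed.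

Lemma eucl_sym x y : eucl x y = eucl y x.
Proof. by congr Num.sqrt; apply: eq_bigr => i _; rewrite -sqrrN opprB. Qed.

Lemma eucl_xx x : eucl x x = 0.
Proof. by rewrite /eucl big1 ?sqrtr0// => i _; rewrite subrr expr0n. Qed.

Lemma cauchy_schwarz_sum (a b : 'I_d -> R) :
  \sum_i a i * b i <= Num.sqrt (\sum_i a i ^+ 2) * Num.sqrt (\sum_i b i ^+ 2).
Proof.
set A := \sum_i a i ^+ 2; set B := \sum_i b i ^+ 2; set S := \sum_i a i * b i.
have A0 : 0 <= A by apply: sumr_ge0 => i _; exact: sqr_ge0.
have B0 : 0 <= B by apply: sumr_ge0 => i _; exact: sqr_ge0.
have z (c : 'I_d -> R) : \sum_i c i ^+ 2 = 0 -> forall i, c i = 0.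
  move=> /eqP; rewrite psumr_eq0; last by move=> i _; exact: sqr_ge0.
  by move=> /allP h i; apply/eqP; rewrite -sqrf_eq0; apply: h; rewrite mem_index_enum.
have [A00|An0] := eqVneq A 0.
  by rewrite A00 sqrtr0 mul0r /S big1// => i _; rewrite (z a A00) mul0r.
have [B00|Bn0] := eqVneq B 0.
  by rewrite B00 sqrtr0 mulr0 /S big1// => i _; rewrite (z b B00) mulr0.
have e0 : 0 < Num.sqrt A by rewrite sqrtr_gt0 lt_neqAle eq_sym An0.
have f0 : 0 < Num.sqrt B by rewrite sqrtr_gt0 lt_neqAle eq_sym Bn0.
set e := Num.sqrt A in e0 *; set f := Num.sqrt B in f0 *.
have : 0 <= \sum_i (f * a i - e * b i) ^+ 2 by apply: sumr_ge0 => i _; exact: sqr_ge0.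
have -> : \sum_i (f * a i - e * b i) ^+ 2 = f ^+ 2 * A + e ^+ 2 * B - 2 * (e * f) * S.
  rewrite /A /B /S !mulr_sumr -big_split/= -sumrB; apply: eq_bigr => i _; ring.
have -> : A = e ^+ 2 by rewrite /e sqr_sqrtr.
have -> : B = f ^+ 2 by rewrite /f sqr_sqrtr.
have ef0 : 0 < e * f by rewrite mulr_gt0.
rewrite (_ : _ - _ = 2 * (e * f) * (e * f - S)); last by ring.
by rewrite pmulr_rge0 ?subr_ge0// mulr_gt0.
Qed.

Lemma eucl_triangle y x z : eucl x z <= eucl x y + eucl y z.
Proof.
rewrite -ler_sqr ?nnegrE ?addr_ge0 ?eucl_ge0// eucl_sqr.
have := cauchy_schwarz_sum (fun i => tnth x i - tnth y i) (fun i => tnth y i - tnth z i).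
rewrite -/(eucl x y) -/(eucl y z) => cs.
rewrite sqrrD !eucl_sqr -[_ *+ 2]mulr_natl.
have -> : \sum_(i < d) (tnth x i - tnth z i) ^+ 2 =
  \sum_(i < d) (tnth x i - tnth y i) ^+ 2 + 2 * (\sum_i (tnth x i - tnth y i) * (tnth y i - tnth z i))
  + \sum_(i < d) (tnth y i - tnth z i) ^+ 2.
  rewrite mulr_sumr -!big_split/=; apply: eq_bigr => i _; ring.
by rewrite lerD2r lerD2l ler_pM2l.
Qed.

Lemma coord_le_eucl x y i : `|tnth x i - tnth y i| <= eucl x y.
Proof.
rewrite -ler_sqr ?nnegrE ?eucl_ge0// eucl_sqr real_normK ?num_real//.
by rewrite (bigD1 i)//= lerDl sumr_ge0// => j _; exact: sqr_ge0.
Qed.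

Lemma eucl_affine c (a : T) x y : 0 <= c -> eucl (affine c a x) (affine c a y) = c * eucl x y.
Proof.
move=> c0; rewrite /eucl -[in RHS](ger0_norm c0) -[in RHS]sqrtr_sqr -sqrtrM ?sqr_ge0//.
congr Num.sqrt; rewrite mulr_sumr; apply: eq_bigr => i _; rewrite !tnth_affine; ring.
Qed.

Lemma affine_origin c (a : T) : affine c a origin = a.
Proof. by apply: eq_from_tnth => i; rewrite tnth_affine tnth_origin mulr0 add0r. Qed.

Lemma affine1C x h : affine 1 x h = affine 1 h x :> T.
Proof. by apply: eq_from_tnth => i; rewrite !tnth_affine !mul1r addrC. Qed.

Lemma eucl_shift x h : eucl (affine 1 x h) x = eucl h origin.
Proof. by rewrite -{2}(affine_origin 1 x) eucl_affine ?mul1r. Qed.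

Lemma measurable_eucl dd (X : measurableType dd) (f g : X -> T) :
  measurable_fun setT f -> measurable_fun setT g ->
  measurable_fun setT (fun p => eucl (f p) (g p)).
Proof.
move=> /measurable_fun_tnthP mf /measurable_fun_tnthP mg.
have -> : (fun p => eucl (f p) (g p)) =
  (fun p => (\sum_(i < d) (tnth (f p) i - tnth (g p) i) ^+ 2) `^ 2^-1).
  apply/funext => p; rewrite powR12_sqrt// sumr_ge0// => i _; exact: sqr_ge0.
apply: (measurableT_comp (measurable_powR _)).
apply: measurable_sum => i; apply: measurable_funX.
by apply: measurable_funB; [exact: mf|exact: mg].
Qed.

Lemma measurable_oball x r : measurable (oball x r : set T).
Proof.
rewrite /oball -[X in measurable X]setTI.
apply: measurable_fun_ltr => //; apply: measurable_eucl => //.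
Qed.

Lemma oball_center x r : 0 < r -> oball x r x.
Proof. by rewrite /oball/= eucl_xx. Qed.

Lemma oball_sub x y r s : eucl x y + s <= r -> oball y s `<=` oball x r.
Proof.
move=> h z; rewrite /oball/= => zs; apply: (le_lt_trans (eucl_triangle y _ _)).
by apply: lt_le_trans h; rewrite ltrD2l.
Qed.

Lemma oball_subr x r s : s <= r -> oball x s `<=` (oball x r : set T).
Proof. by move=> sr; apply: oball_sub; rewrite eucl_xx add0r. Qed.

Lemma is_open_oball x r : is_open (oball x r : set T).
Proof.
move=> y xy; exists (r - eucl x y); first by rewrite subr_gt0.
by apply: oball_sub; rewrite subrKC.
Qed.

End Eucl.
Arguments origin {R d}.

(** * Volume of balls and a countable base of the topology *)

Section Volume.
Context {R : realType}.

Definition cubeind n (c : R) (t : pt R n) : R :=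
  \prod_(i < n) \1_(`[(- c), c]%classic : set R) (tnth t i).

Lemma cubeind_ge0 n c (t : pt R n) : 0 <= cubeind c t.
Proof. by apply: prodr_ge0 => i _; rewrite indicE ler0n. Qed.

Lemma measurable_cubeind n c :
  measurable_fun setT (fun t : pt R n => (cubeind c t)%:E : \bar R).
Proof.
apply/measurable_EFinP; apply: measurable_prod => i _.
exact: measurableT_comp (measurable_tnth i).
Qed.

Lemma iint_cube n (c : R) : 0 <= c ->
  iint (fun t : pt R n => (cubeind c t)%:E)
  = ((2 * c) ^+ n)%:E.
Proof.
move=> c0; elim: n => [|n IH] /=; first by rewrite /cubeind big_ord0.
have mp := @measurable_cubeind n c.
have p0 (t : pt R n) : (0 <= (cubeind c t)%:E)%E by rewrite lee_fin cubeind_ge0.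
transitivity (\int[@lebesgue_measure R]_x ((\1_(`[(- c), c]%classic : set R) x)%:E * ((2 * c) ^+ n)%:E))%E.
  apply: eq_integral => x _; rewrite -IH.
  have e t : (cubeind c (cons_tuple x t : pt R n.+1))%:E =
    ((\1_(`[(- c), c]%classic : set R) x)%:E * (cubeind c t)%:E)%E.
    rewrite /cubeind big_ord_recl EFinM; congr (_ %:E * _%:E)%E.
    by apply: eq_bigr => i _; rewrite tnth_cons_lift.
  rewrite (_ : (fun t => _) = (fun t => ((\1_(`[(- c), c]%classic : set R) x)%:E * (cubeind c t)%:E)%E)); last first.
    by apply/funext => t; rewrite e.
  rewrite !iintE//; last 2 first.
  - exact: measurable_funeM.
  - by move=> t; rewrite mule_ge0// lee_fin.
  by rewrite ge0_integralZl//= lee_fin.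
rewrite ge0_integralZr//; last 2 first.
- exact/measurable_EFinP/measurable_indic.
- by rewrite lee_fin exprn_ge0// mulr_ge0.
rewrite integral_indic//= setIT lebesgue_measure_itv/= lte_fin.
case: ltP => cc; first by rewrite -EFinB -EFinM exprS; congr EFin; ring.
have -> : c = 0 by lra.
by rewrite mul0e mulr0 expr0n.
Qed.

Lemma lebn_iint n (A : set (pt R n)) : measurable A -> lebn n A = iint (fun x => (\1_A x)%:E).
Proof.
move=> mA; rewrite iintE//; last exact/measurable_EFinP/measurable_indic.
by rewrite integral_indic// setIT.
Qed.

Context {d : nat}.

Definition vol1 : R := fine (lebn d (oball origin 1)).

(** The unit ball lies between two cubes, whose volumes are computed coordinate by coordinate. *)
Lemma lebn_ball1_bound : (0 < lebn d (oball (origin : pt R d) 1%R) < +oo)%E.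
Proof.
have mb : measurable_fun setT (fun t : pt R d => (\1_(oball (origin : pt R d) 1%R) t)%:E : \bar R).
  by apply/measurable_EFinP; apply: measurable_indic; exact: measurable_oball.
have mp := @measurable_cubeind d.
have p0 c (t : pt R d) : (0 <= (cubeind c t)%:E)%E by rewrite lee_fin cubeind_ge0.
rewrite lebn_iint; last exact: measurable_oball.
apply/andP; split; last first.
  apply: (@le_lt_trans _ _ ((2 * 1) ^+ d)%:E); last by rewrite ltry.
  rewrite -iint_cube// !iintE//.
  apply: ge0_le_integral => //.
  move=> x _; rewrite lee_fin indicE.
  have [/set_mem xb|_] := boolP (x \in _); last exact: cubeind_ge0.
  rewrite /cubeind big1// => i _; rewrite indicE mem_set//= in_itv/= -ler_norml.
  have := coord_le_eucl x origin i; rewrite tnth_origin subr0 => /le_trans; apply.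
  by rewrite eucl_sym ltW.
(* With d + 1 in place of d the strict inequality d c^2 < 1 holds, so the closed cube of half-side
   [c] lies in the open ball, even for d = 0. *)
pose c : R := d.+1%:R^-1.
have c0 : 0 < c by rewrite invr_gt0 ltr0n.
apply: (@lt_le_trans _ _ ((2 * c) ^+ d)%:E).
  by rewrite lte_fin exprn_gt0// mulr_gt0.
rewrite -iint_cube ?(ltW c0)// !iintE//.
apply: ge0_le_integral => //.
move=> x _; rewrite lee_fin.
have [/forallP h|/existsP[i hi]] := boolP [forall i, `|tnth x i| <= c]; last first.
  rewrite /cubeind (bigD1 i)//= indicE memNset ?mul0r//=.
  by rewrite in_itv/= -ler_norml; apply/negP.
rewrite [X in _ <= X]indicE mem_set; last first.
  rewrite /oball/= -ltr_sqr ?nnegrE ?eucl_ge0// eucl_sqr expr1n.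
  apply: (@le_lt_trans _ _ (\sum_(i < d) c ^+ 2)).
    apply: ler_sum => i _; rewrite tnth_origin sub0r sqrrN -real_normK ?num_real//.
    by rewrite ler_sqr ?nnegrE// ltW.
  rewrite sumr_const card_ord -mulr_natl /c expr2 mulrA.
  apply: (@le_lt_trans _ _ (d%:R * c * 1)).
    by rewrite ler_wpM2l ?mulr_ge0 ?(ltW c0)// invf_le1 ?ltr0n// ler1n.
  by rewrite mulr1 ltr_pdivrMr ?ltr0n// mul1r ltr_nat.
by rewrite /cubeind prodr_ile1// => i _; rewrite indicE; case: (_ \in _); rewrite ?lexx ?ler01.
Qed.

Lemma vol1_gt0 : 0 < vol1.
Proof. by rewrite fine_gt0// lebn_ball1_bound. Qed.

Lemma lebn_ball (x : pt R d) r : 0 < r -> lebn d (oball x r) = (r ^+ d * vol1)%:E.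
Proof.
move=> r0; have mb y s := @measurable_oball R d y s.
have mi y s : measurable_fun setT (fun t : pt R d => (\1_(oball y s) t)%:E : \bar R).
  exact/measurable_EFinP/measurable_indic.
transitivity (\int[lebn d]_t (\1_(oball x r) t)%:E)%E.
  by rewrite integral_indic// setIT.
rewrite (@integral_lebn_affine _ _ r x)//.
rewrite EFinM; congr (_ * _)%E.
rewrite /vol1 fineK; last first.
  by have /andP[h0 h1] := lebn_ball1_bound; rewrite ge0_fin_numE ?ltW.
rewrite -[oball origin 1]setIT -integral_indic//; apply: eq_integral => t _; congr EFin.
rewrite !indicE; congr (_%:R); congr (nat_of_bool _).
apply/idP/idP => /set_mem; rewrite /oball/= => h; apply/mem_set; rewrite /oball/=.
  move: h; rewrite -{1}(affine_origin r x) eucl_affine ?ltW//.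
  by rewrite -ltr_pdivlMl// mulVf ?gt_eqF.
by rewrite -{1}(affine_origin r x) eucl_affine ?ltW// -ltr_pdivlMl// mulVf ?gt_eqF.
Qed.

Lemma lebn_ball_lty (x : pt R d) r : (lebn d (oball x r) < +oo)%E.
Proof.
have [r0|r0] := ltP 0 r; first by rewrite lebn_ball// ltry.
rewrite (_ : oball x r = set0) ?measure0// -subset0 => y; rewrite /oball/= => h.
by have := eucl_ge0 x y; lra.
Qed.

Lemma integral_shift (a : pt R d) (f : pt R d -> \bar R) :
  measurable_fun setT f -> (forall x, 0 <= f x)%E ->
  (\int[lebn d]_x f x = \int[lebn d]_x f (affine 1 a x))%E.
Proof. by move=> mf f0; rewrite (@integral_lebn_affine _ _ 1 a)// expr1n mul1e. Qed.

Definition rat_pt (q : d.-tuple rat) : pt R d := [tuple ratr (tnth q i) | i < d].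

Lemma rat_pt_dense (x : pt R d) e : 0 < e -> exists q, eucl x (rat_pt q) < e.
Proof.
move=> e0; pose c : R := e / d.+1%:R.
have c0 : 0 < c by rewrite divr_gt0// ltr0n.
have /choice[q hq] : forall i : 'I_d, exists q : rat, ratr q \in `](tnth x i - c), (tnth x i + c)[.
  by move=> i; have := @rat_in_itvoo R (tnth x i - c) (tnth x i + c); case=> [|q]; [lra|exists q].
exists [tuple q i | i < d].
rewrite -ltr_sqr ?nnegrE ?eucl_ge0 ?(ltW e0)// eucl_sqr.
apply: (@le_lt_trans _ _ (\sum_(i < d) c ^+ 2)).
  apply: ler_sum => i _; rewrite !tnth_mktuple -real_normK ?num_real// ler_sqr ?nnegrE ?(ltW c0)//.
  by have := hq i; rewrite in_itv/= ler_norml => /andP[? ?]; apply/andP; split; lra.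
rewrite sumr_const card_ord -mulr_natl /c expr_div_n mulrA ltr_pdivrMr ?exprn_gt0 ?ltr0n//.
rewrite mulrC ltr_pM2l ?exprn_gt0//.
by rewrite expr2 -natrM ltr_nat leq_pmulr.
Qed.

(** Countably many balls generate the topology. This gives measurability of open sets for the
    product sigma-algebra and, in [esslimsup_ae], a countable union of null sets. *)
Lemma open_set_cover (O : set (pt R d)) : is_open O ->
  forall x, O x -> exists q n, oball (rat_pt q) n.+1%:R^-1 x /\ oball (rat_pt q) n.+1%:R^-1 `<=` O.
Proof.
move=> oO x Ox; have [e e0 eO] := oO x Ox.
have [n ne] : exists n : nat, (n.+1%:R : R)^-1 < e / 2.
  have e20 : 0 < e / 2 by rewrite divr_gt0.
  exists (Num.Def.trunc (e / 2)^-1).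
  by rewrite invf_plt ?posrE ?ltr0n// truncnS_gt.
have n0 : 0 < (n.+1%:R : R)^-1 by rewrite invr_gt0 ltr0n.
have [q xq] := rat_pt_dense x n0.
exists q, n; split; first by rewrite /oball/= eucl_sym.
apply: subset_trans eO; apply: oball_sub; apply: ltW.
apply: (lt_trans (y := e / 2 + n.+1%:R^-1)); first by rewrite ltrD2r (lt_trans xq).
by rewrite [ltRHS](splitr e) ltrD2l.
Qed.

Lemma is_open_measurable (O : set (pt R d)) : is_open O -> measurable O.
Proof.
move=> oO.
pose F (p : d.-tuple rat * nat) : set (pt R d) :=
  if pselect (oball (rat_pt p.1) p.2.+1%:R^-1 `<=` O) then oball (rat_pt p.1) p.2.+1%:R^-1 else set0.
have -> : O = \bigcup_p F p.
  apply/seteqP; split => [x Ox|x [[q n] _]]; last by rewrite /F; case: pselect => //= h; exact: h.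
  have [q [n [h1 h2]]] := open_set_cover oO Ox.
  by exists (q, n) => //; rewrite /F; case: pselect.
apply: countable_bigcupT_measurable => [|p]; first exact: countableP.
by rewrite /F; case: pselect => h; [exact: measurable_oball|exact: measurable0].
Qed.

End Volume.

(** * Energy forms *)

Section RealIntegrals.
Context {R : realType} {dd : measure_display} {T : measurableType dd}.
Variable mu : {measure set T -> \bar R}.
Implicit Types f g : T -> R.

Definition rintegrable f := mu.-integrable setT (EFin \o f).

Lemma rintegrable_measurable f : rintegrable f -> measurable_fun setT f.
Proof. by move=> /measurable_int /measurable_EFinP. Qed.

Lemma rintegrable_le g f : measurable_fun setT f -> rintegrable g ->
  (forall x, `|f x| <= g x) -> rintegrable f.
Proof.
move=> mf ig fg; apply: le_integrable ig => //; first exact/measurable_EFinP.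
by move=> x _; rewrite /= lee_fin (le_trans (fg x))// ler_norm.
Qed.

Lemma rintegrableD f g : rintegrable f -> rintegrable g -> rintegrable (fun x => f x + g x).
Proof. by move=> If Ig; exact: (integrableD _ If Ig). Qed.

Lemma rintegrableZ c f : rintegrable f -> rintegrable (fun x => c * f x).
Proof. by move=> If; exact: (integrableZl _ c If). Qed.

Lemma rintegrable_ge0P f : measurable_fun setT f -> (forall x, 0 <= f x) ->
  rintegrable f <-> (\int[mu]_x (f x)%:E < +oo)%E.
Proof.
move=> mf f0; split=> [/integrableP[_]|fi].
  by under eq_integral do rewrite /= ger0_norm//.
apply/integrableP; split; first exact/measurable_EFinP.
by under eq_integral do rewrite /= ger0_norm//.
Qed.

Lemma EFin_Rintegral f : rintegrable f -> (\int[mu]_x f x)%:E = (\int[mu]_x (f x)%:E)%E.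
Proof. by move=> If; rewrite /Rintegral fineK//; exact: integrable_fin_num If. Qed.

Lemma Rintegral_lin a b f g : rintegrable f -> rintegrable g ->
  \int[mu]_x (a * f x + b * g x) = a * \int[mu]_x f x + b * \int[mu]_x g x.
Proof.
move=> If Ig; rewrite RintegralD//; last 2 first.
- exact: rintegrableZ.
- exact: rintegrableZ.
by rewrite !RintegralZl.
Qed.

Lemma Rintegral_le f g : rintegrable f -> rintegrable g ->
  (forall x, f x <= g x) -> \int[mu]_x f x <= \int[mu]_x g x.
Proof. by move=> If Ig fg; apply: le_Rintegral. Qed.

Lemma Rintegral_le_fin f (c : R) : measurable_fun setT f -> (forall x, 0 <= f x) ->
  (\int[mu]_x (f x)%:E <= c%:E)%E -> rintegrable f /\ \int[mu]_x f x <= c.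
Proof.
move=> mf f0 h; have If : rintegrable f.
  by apply/rintegrable_ge0P => //; exact: le_lt_trans h (ltry _).
by split=> //; rewrite -lee_fin EFin_Rintegral.
Qed.

Lemma rintegrable_indic (A : set T) : measurable A -> (mu A < +oo)%E -> rintegrable (\1_A : T -> R).
Proof.
move=> mA Ay; apply/rintegrable_ge0P => //.
by rewrite integral_indic// setIT.
Qed.

Lemma Rintegral_indic (A : set T) : measurable A ->
  \int[mu]_x (\1_A x : R) = fine (mu A).
Proof. by move=> mA; rewrite /Rintegral integral_indic// setIT. Qed.

Lemma Rintegral_ae f g : measurable_fun setT f -> measurable_fun setT g ->
  {ae mu, forall x, f x = g x} -> \int[mu]_x f x = \int[mu]_x g x.
Proof.
move=> mf mg fg; congr fine; apply: ae_eq_integral => //.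
- exact/measurable_EFinP.
- exact/measurable_EFinP.
- by apply: filterS fg => x /= -> _.
Qed.

Lemma Rintegral_eq0 f : measurable_fun setT f -> (forall x, 0 <= f x) -> rintegrable f ->
  \int[mu]_x f x <= 0 -> {ae mu, forall x, f x = 0}.
Proof.
move=> mf f0 If h.
have h0 : (\int[mu]_x (f x)%:E = 0)%E.
  apply/eqP; rewrite eq_le integral_ge0 ?andbT; last by move=> x _; rewrite lee_fin.
  by rewrite -EFin_Rintegral// lee_fin.
have : (\int[mu]_x `|(f x)%:E| = 0)%E by under eq_integral do rewrite /= ger0_norm//.
move=> /(ae_eq_integral_abs mu measurableT); rewrite measurable_EFinP => /(_ mf).
by apply: filterS => x /= /(_ I) [].
Qed.

End RealIntegrals.

Section FullIntegrals.
Context {R : realType} {dd : measure_display} {T : measurableType dd}.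
Variable mu : {measure set T -> \bar R}.
Implicit Types f g : T -> \bar R.

Lemma le_integralT f g : (forall x, 0 <= f x)%E -> measurable_fun setT f ->
  measurable_fun setT g -> (forall x, f x <= g x)%E ->
  (\int[mu]_x f x <= \int[mu]_x g x)%E.
Proof. by move=> f0 mf mg fg; apply: ge0_le_integral => // x _; exact: f0. Qed.

Lemma integralZT (c : R) f : 0 <= c -> (forall x, 0 <= f x)%E -> measurable_fun setT f ->
  (\int[mu]_x (c%:E * f x) = c%:E * \int[mu]_x f x)%E.
Proof. by move=> c0 f0 mf; rewrite ge0_integralZl// => x _; exact: f0. Qed.

Lemma integralDT f g : (forall x, 0 <= f x)%E -> measurable_fun setT f ->
  (forall x, 0 <= g x)%E -> measurable_fun setT g ->
  (\int[mu]_x (f x + g x) = \int[mu]_x f x + \int[mu]_x g x)%E.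
Proof. by move=> f0 mf g0 mg; rewrite ge0_integralD. Qed.

End FullIntegrals.

Section Form.
Context {R : realType} {dd : measure_display} {T : measurableType dd}.
Variable mu : {sigma_finite_measure set T -> \bar R}.
Variable k : T -> T -> R.
Hypothesis mk : measurable_fun setT (fun p : T * T => k p.1 p.2).
Hypothesis k0 : forall x y, 0 <= k x y.
Hypothesis ksym : forall x y, k x y = k y x.

Let P : {measure set (T * T) -> \bar R} := (mu \x mu)%E.
Implicit Types u v w : T -> R.

(* On functions of finite energy, [B] is the form E of the paper as a real number. *)
Definition Q u v (p : T * T) : R := (u p.1 - u p.2) * (v p.1 - v p.2) * k p.1 p.2.

Definition finE u := measurable_fun setT u /\ rintegrable P (Q u u).

Definition B u v : R := \int[P]_p Q u v p.

Lemma Quu_ge0 u p : 0 <= Q u u p.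
Proof. by rewrite /Q mulr_ge0// -expr2 sqr_ge0. Qed.

Lemma measurable_fst_comp u : measurable_fun setT u -> measurable_fun setT (fun p : T * T => u p.1).
Proof. by move=> mu_; exact: measurableT_comp. Qed.

Lemma measurable_snd_comp u : measurable_fun setT u -> measurable_fun setT (fun p : T * T => u p.2).
Proof. by move=> mu_; exact: measurableT_comp. Qed.

Lemma measurable_Q u v : measurable_fun setT u -> measurable_fun setT v ->
  measurable_fun setT (Q u v).
Proof.
move=> mu_ mv; apply: measurable_funM => //; apply: measurable_funM; apply: measurable_funB;
  by [exact: measurable_fst_comp|exact: measurable_snd_comp].
Qed.

Lemma rintegrable_Q u v : finE u -> finE v -> rintegrable P (Q u v).
Proof.
move=> [mu_ Iu] [mv Iv].
apply: (@rintegrable_le _ _ _ _ (fun p => Q u u p + Q v v p)).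
- exact: measurable_Q.
- exact: rintegrableD.
- move=> p; rewrite /Q normrM (ger0_norm (k0 _ _)) -mulrDl ler_wpM2r//.
  set a := u _ - _; set b := v _ - _.
  have := sqr_ge0 (a + b); have := sqr_ge0 (a - b).
  by rewrite ler_norml => ? ?; apply/andP; split; nra.
Qed.

(** Squaring the increment bound costs a factor 2 and dominates the energy density of [f] by those
    of [u] and [v]. Linear combinations, bounded products, truncations, logarithms and inverses all
    get finite energy from this. *)
Lemma finE_dom (L M : R) u v (f : T -> R) : finE u -> finE v -> measurable_fun setT f ->
  (forall x y, `|f x - f y| <= L * `|u x - u y| + M * `|v x - v y|) -> finE f.
Proof.
move=> [mu_ Iu] [mv Iv] mf h; split => //.
apply: (@rintegrable_le _ _ _ _ (fun p => 2 * L ^+ 2 * Q u u p + 2 * M ^+ 2 * Q v v p)).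
- exact: measurable_Q.
- by apply: rintegrableD; exact: rintegrableZ.
- move=> p; rewrite ger0_norm ?Quu_ge0//.
  suff H : (f p.1 - f p.2) ^+ 2 <=
      2 * L ^+ 2 * (u p.1 - u p.2) ^+ 2 + 2 * M ^+ 2 * (v p.1 - v p.2) ^+ 2.
    by have := ler_wpM2r (k0 p.1 p.2) H; rewrite /Q; lra.
  have := h p.1 p.2.
  rewrite -(real_normK (num_real (f _ - f _))) -(real_normK (num_real (u _ - u _))).
  rewrite -(real_normK (num_real (v _ - v _))).
  have := normr_ge0 (f p.1 - f p.2).
  set a := `|u _ - u _|; set b := `|v _ - v _|; set c := `|f _ - f _| => c0 hc.
  apply: (@le_trans _ _ ((L * a + M * b) ^+ 2)).
    by rewrite ler_sqr ?nnegrE//; exact: le_trans hc.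
  by have := sqr_ge0 (L * a - M * b); nra.
Qed.

Lemma finE_dom1 (L : R) u (f : T -> R) : finE u -> measurable_fun setT f ->
  (forall x y, `|f x - f y| <= L * `|u x - u y|) -> finE f.
Proof.
move=> Eu mf h; apply: (@finE_dom L 0 u u) => // x y.
by rewrite mul0r addr0.
Qed.

Lemma finE_lin a b u v : finE u -> finE v -> finE (fun x => a * u x + b * v x).
Proof.
move=> Eu Ev; apply: (@finE_dom `|a| `|b| u v) => //.
  by apply: measurable_funD; apply: measurable_funM => //; [case: Eu|case: Ev].
move=> x y; rewrite -!normrM; apply: le_trans (ler_normD _ _).
rewrite le_eqVlt; apply/orP; left; apply/eqP; congr `|_|; ring.
Qed.

Lemma finE_mul M u v : (forall x, `|u x| <= M) -> (forall x, `|v x| <= M) ->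
  finE u -> finE v -> finE (fun x => u x * v x).
Proof.
move=> uM vM Eu Ev; apply: (@finE_dom M M u v) => //.
  by apply: measurable_funM; [case: Eu|case: Ev].
move=> x y; rewrite (_ : _ - _ = v x * (u x - u y) + u y * (v x - v y)); last by ring.
by apply: le_trans (ler_normD _ _) _; rewrite !normrM lerD// ler_wpM2r.
Qed.

Lemma finE_cst c : finE (fun _ => c).
Proof.
split; first exact: measurable_cst.
rewrite (_ : Q _ _ = cst 0); first exact: integrable0.
by apply/funext => p; rewrite /Q subrr !mul0r.
Qed.

Lemma Bsym u v : B u v = B v u.
Proof. by apply: eq_Rintegral => p _; rewrite /Q; ring. Qed.

Lemma B_linl a b u v w : finE u -> finE v -> finE w ->
  B (fun x => a * u x + b * v x) w = a * B u w + b * B v w.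
Proof.
move=> Eu Ev Ew; rewrite /B -Rintegral_lin; [|exact: rintegrable_Q..].
by apply: eq_Rintegral => p _; rewrite /Q; ring.
Qed.

Lemma B_linr a b u v w : finE u -> finE v -> finE w ->
  B w (fun x => a * u x + b * v x) = a * B w u + b * B w v.
Proof. by move=> Eu Ev Ew; rewrite Bsym B_linl// !(Bsym w). Qed.

Lemma B_quad a b u v : finE u -> finE v ->
  B (fun x => a * u x + b * v x) (fun x => a * u x + b * v x) =
  a ^+ 2 * B u u + 2 * a * b * B u v + b ^+ 2 * B v v.
Proof.
move=> Eu Ev; have Euv := finE_lin a b Eu Ev.
by rewrite B_linl// !B_linr// (Bsym v u); ring.
Qed.

Lemma Buu_ge0 u : 0 <= B u u.
Proof. by apply: Rintegral_ge0 => p _; exact: Quu_ge0. Qed.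

Lemma B_shiftl c u v : B (fun x => u x + c) v = B u v.
Proof. by apply: eq_Rintegral => p _; rewrite /Q; ring. Qed.

Lemma finE_shift c u : finE u -> finE (fun x => u x + c).
Proof.
move=> Eu; apply: (@finE_dom1 1 u) => //; first by apply: measurable_funD => //; case: Eu.
by move=> x y; rewrite mul1r opprD addrACA subrr addr0.
Qed.

Lemma B_le u v F : finE u -> finE v -> rintegrable P F -> (forall p, Q u v p <= F p) ->
  B u v <= \int[P]_p F p.
Proof. by move=> Eu Ev IF h; apply: Rintegral_le => //; exact: rintegrable_Q. Qed.

Lemma prod_swap (F : T * T -> \bar R) : measurable_fun setT F -> (forall p, 0 <= F p)%E ->
  (\int[P]_p F p = \int[P]_p F (p.2, p.1))%E.
Proof.
move=> mF F0.
have mF' : measurable_fun setT (fun p => F (p.2, p.1)).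
  by apply: measurableT_comp mF _; apply: measurable_fun_pair.
by rewrite (@fubini_tonelli1 _ _ _ _ _ mu mu)//= (@fubini_tonelli2 _ _ _ _ _ mu mu).
Qed.

(** Changing a function on a null set of points changes its increments only on a null set of pairs,
    namely those with a coordinate in that set; hence the form ignores null sets. *)
Lemma prod_ae (A : set T) : measurable A -> mu A = 0%E ->
  {ae P, forall p, ~ A p.1 /\ ~ A p.2}.
Proof.
move=> mA A0.
have m1 : measurable ((A `*` setT) : set (T * T)) by exact: measurableX.
have m2 : measurable ((setT `*` A) : set (T * T)) by exact: measurableX.
exists ((A `*` setT) `|` (setT `*` A)); split; first exact: measurableU.
  apply/eqP; rewrite eq_le measure_ge0 andbT.
  apply: le_trans (measureU2 _ _ _) _ => //.
  rewrite /P/= !product_measure1E//=; rewrite A0 mul0e mule0 add0e//.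
move=> p /= /not_andP[|] /contrapT Ap; [left|right]; by split.
Qed.

Lemma B_ae u u' v : measurable_fun setT u -> measurable_fun setT u' -> measurable_fun setT v ->
  (exists2 A, measurable A & mu A = 0%E /\ forall x, ~ A x -> u x = u' x) -> B u v = B u' v.
Proof.
move=> mu_ mu' mv [A mA [A0 h]]; apply: Rintegral_ae; [exact: measurable_Q..|].
by apply: filterS (prod_ae mA A0) => p [h1 h2]; rewrite /Q !h.
Qed.

Lemma finE_ae u u' : finE u -> measurable_fun setT u' ->
  (exists2 A, measurable A & mu A = 0%E /\ forall x, ~ A x -> u x = u' x) -> finE u'.
Proof.
move=> [mu_ Iu] mu' [A mA [A0 h]]; split => //.
apply/rintegrable_ge0P; [exact: measurable_Q|exact: Quu_ge0|].
move/rintegrable_ge0P : Iu => /(_ (measurable_Q mu_ mu_) (Quu_ge0 u)).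
apply: le_lt_trans; rewrite le_eqVlt; apply/orP; left; apply/eqP.
apply: ge0_ae_eq_integral => //.
- by apply/measurable_EFinP; exact: measurable_Q.
- by apply/measurable_EFinP; exact: measurable_Q.
- by move=> p _; rewrite lee_fin Quu_ge0.
- by move=> p _; rewrite lee_fin Quu_ge0.
- by apply: filterS (prod_ae mA A0) => p [h1 h2] _; rewrite /Q !h.
Qed.

End Form.

(** * Passage to the limit *)

Section Convergence.
Context {R : realType} {dd : measure_display} {T : measurableType dd}.
Variable mu : {measure set T -> \bar R}.

Lemma fatou_bound (f_ : nat -> T -> R) (f : T -> R) (C : R) :
  (forall n, measurable_fun setT (f_ n)) -> (forall n x, 0 <= f_ n x) ->
  (forall x, f_ ^~ x @ \oo --> f x) ->
  (forall n, (\int[mu]_x (f_ n x)%:E <= C%:E)%E) ->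
  (\int[mu]_x (f x)%:E <= C%:E)%E.
Proof.
move=> mf f0 cf fC.
have -> : (\int[mu]_x (f x)%:E = \int[mu]_x limn_einf (fun n => (f_ n x)%:E))%E.
  apply: eq_integral => x _.
  have cE : (fun n => (f_ n x)%:E) @ \oo --> (f x)%:E by apply: cvg_EFin; [exact: nearW|exact: cf].
  by have [-> _] := cvg_limn_einf_sup cE.
apply: le_trans (fatou _ _ _ _) _ => //.
- by move=> n; exact/measurable_EFinP.
- by move=> n x _; rewrite lee_fin.
rewrite limn_einf_lim; apply: lime_le.
  apply: ereal_nondecreasing_is_cvgn => m n mn; apply: ereal_inf_le_tmp => _ [p /= np <-].
  by exists p => //=; rewrite (leq_trans mn).
apply: nearW => n; apply: le_trans (fC n); apply: ereal_inf_lbound.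
by exists n => /=.
Qed.

(** The sum of the absolute increments has finite integral, hence is finite almost everywhere, and
    there the telescoping series converges absolutely. This stands in for completeness of L^2 and
    directly yields a pointwise limit, to which Fatou applies. *)
Lemma ae_cvg_summable (f_ : nat -> T -> R) (a : nat -> R) :
  (forall n, measurable_fun setT (f_ n)) -> cvgn (series a) -> (forall n, 0 <= a n) ->
  (forall n, (\int[mu]_x `|f_ n.+1 x - f_ n x|%:E <= (a n)%:E)%E) ->
  exists2 A, measurable A & mu (~` A) = 0%E /\ forall x, A x -> cvgn (f_ ^~ x).
Proof.
move=> mf ca a0 ha.
pose S x : \bar R := (\sum_(n <oo) `|f_ n.+1 x - f_ n x|%:E)%E.
have mg n : measurable_fun setT (fun x => `|f_ n.+1 x - f_ n x|%:E).
  apply/measurable_EFinP; apply: (measurableT_comp (@normr_measurable _ setT)).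
  exact: measurable_funB.
have mS : measurable_fun setT S by apply: ge0_emeasurable_sum => // n x _ _; rewrite lee_fin.
have S0 x : (0 <= S x)%E by apply: nneseries_ge0 => n _ _; rewrite lee_fin.
have IS : (\int[mu]_x S x < +oo)%E.
  rewrite integral_nneseries//.
  apply: (@le_lt_trans _ _ (\sum_(n <oo) (a n)%:E)%E).
    apply: lee_nneseries => [n _ _|n _]; [exact: integral_ge0|exact: ha].
  rewrite (_ : (\sum_(n <oo) (a n)%:E)%E = (limn (series a))%:E) ?ltry//.
  rewrite -EFin_lim//; congr (limn _); apply/funext => n /=.
  by rewrite /series/= sumEFin.
exists [set x | (S x < +oo)%E].
  by have := emeasurable_fun_infty_o measurableT mS +oo; rewrite setTI.
split.
  have /integrable_ae : mu.-integrable setT S.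
    by apply/integrableP; split => //; under eq_integral do rewrite gee0_abs//.
  move=> /(_ measurableT) h; apply/negligibleP.
    by apply: measurableC; have := emeasurable_fun_infty_o measurableT mS +oo; rewrite setTI.
  apply: negligibleS h => x /= Sx /(_ Logic.I) fS; apply: Sx; rewrite -ge0_fin_numE//.
move=> x /= Sx.
have h : cvgn (series (fun n => f_ n.+1 x - f_ n x)).
  apply: normed_cvg; apply: nondecreasing_is_cvgn.
    by apply/nondecreasing_seqP => n; rewrite /normed_series_of/= /series/= big_nat_recr//= lerDl.
  exists (fine (S x)) => _ [n _ <-]; rewrite -lee_fin fineK ?ge0_fin_numE//.
  rewrite /normed_series_of/= /series/= -sumEFin.
  by apply: nneseries_lim_ge => i _ _; rewrite lee_fin.
have -> : f_ ^~ x = (fun n => f_ 0%N x + series (fun n => f_ n.+1 x - f_ n x) n).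
  apply/funext => n; rewrite /series/= telescope_sumr//; ring.
by apply: is_cvgD => //; exact: is_cvg_cst.
Qed.

End Convergence.

(** * Weak solutions *)

Section WeakSolution.
Context {R : realType} {dd : measure_display} {T : measurableType dd}.
Variable mu : {sigma_finite_measure set T -> \bar R}.
Variable k : T -> T -> R.
Hypothesis mk : measurable_fun setT (fun p : T * T => k p.1 p.2).
Hypothesis k0 : forall x y, 0 <= k x y.
Variable O : set T.

Local Notation finE := (finE mu k).
Local Notation B := (B mu k).

(* H_Omega, normalized to vanish everywhere outside [O] rather than almost everywhere. *)
Definition HO (u : T -> R) :=
  [/\ finE u, rintegrable mu (fun x => u x ^+ 2) & forall x, ~ O x -> u x = 0].

Lemma HO_measurable u : HO u -> measurable_fun setT u.
Proof. by case=> -[]. Qed.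

Lemma HO_finE u : HO u -> finE u. Proof. by case. Qed.

Lemma HO_lin a b u v : HO u -> HO v -> HO (fun x => a * u x + b * v x).
Proof.
move=> [Eu Iu zu] [Ev Iv zv]; split; first exact: finE_lin.
- apply: (@rintegrable_le _ _ _ _ (fun x => 2 * a ^+ 2 * u x ^+ 2 + 2 * b ^+ 2 * v x ^+ 2)).
  + apply: measurable_funX; apply: measurable_funD; apply: measurable_funM => //.
      by case: Eu.
    by case: Ev.
  + by apply: rintegrableD; exact: rintegrableZ.
  + move=> x; rewrite ger0_norm ?sqr_ge0//.
    by have := sqr_ge0 (a * u x - b * v x); nra.
- by move=> x Ox; rewrite zu// zv// !mulr0 addr0.
Qed.

Hypothesis mO : measurable O.
Hypothesis Oy : (mu O < +oo)%E.
Variable cP : R.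
Hypothesis cP0 : 0 < cP.
Hypothesis poincare : forall v, HO v -> cP * \int[mu]_x (v x ^+ 2) <= B v v.

(** Young's inequality with a free weight [c]; since [u] vanishes off [O], the constant term is
    confined to [O], which has finite measure. *)
Lemma HO_abs_le u c : HO u -> 0 < c -> forall x, `|u x| <= c * u x ^+ 2 + c^-1 * \1_O x.
Proof.
move=> [_ _ zu] c0 x; rewrite -(real_normK (num_real (u x))).
have [/set_mem Ox|/negP Ox] := boolP (x \in O); last first.
  rewrite zu; last by move=> Ox'; apply: Ox; exact: mem_set.
  by rewrite normr0 expr0n/= mulr0 add0r mulr_ge0// invr_ge0 ltW.
rewrite indicE mem_set// mulr1; set a := `|u x|.
have a0 : 0 <= a by exact: normr_ge0.
rewrite -(ler_pM2l c0) mulrDr mulfV ?gt_eqF//.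
by have := sqr_ge0 (c * a - 1); nra.
Qed.

Variable psi : T -> R.
Hypothesis mpsi : measurable_fun setT psi.
Variable M : R.
Hypothesis psiM : forall x, `|psi x| <= M.

Lemma HO_abs_integrable u : HO u -> rintegrable mu (fun x => `|u x|).
Proof.
move=> Hu; have [_ Iu _] := Hu.
apply: (@rintegrable_le _ _ _ _ (fun x => 1 * u x ^+ 2 + 1^-1 * \1_O x)).
- by apply: measurableT_comp => //; exact: HO_measurable.
- apply: rintegrableD; apply: rintegrableZ => //; exact: rintegrable_indic.
- by move=> x; rewrite normr_id; exact: HO_abs_le.
Qed.

Lemma psi_integrable u : HO u -> rintegrable mu (fun x => psi x * u x).
Proof.
move=> Hu; apply: (@rintegrable_le _ _ _ _ (fun x => M * `|u x|)).
- by apply: measurable_funM => //; exact: HO_measurable.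
- exact/rintegrableZ/HO_abs_integrable.
- by move=> x; rewrite normrM ler_wpM2r.
Qed.

Let l u := \int[mu]_x (psi x * u x).

Let l_lin a b u v : HO u -> HO v -> l (fun x => a * u x + b * v x) = a * l u + b * l v.
Proof.
move=> Hu Hv; rewrite /l -Rintegral_lin; [|exact: psi_integrable..].
by apply: eq_Rintegral => x _; ring.
Qed.

(** The functional whose Euler-Lagrange equation is the weak equation. *)
Let J u := B u u / 2 - l u.

Let J_lin a b u v : HO u -> HO v -> J (fun x => a * u x + b * v x) =
  (a ^+ 2 * B u u + 2 * a * b * B u v + b ^+ 2 * B v v) / 2 - a * l u - b * l v.
Proof.
move=> Hu Hv; have Eu := HO_finE Hu; have Ev := HO_finE Hv.
by rewrite /J l_lin// B_quad//; ring.
Qed.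

Let oO := fine (mu O).

Let J_bound u : HO u -> - (M ^+ 2 / cP * oO * 2) <= J u.
Proof.
move=> Hu; have [Eu Iu zu] := Hu.
have M0 : 0 <= M by have := psiM point; apply: le_trans.
have h : l u <= (cP / 2) * \int[mu]_x (u x ^+ 2) + (M ^+ 2 * 2 / cP) * \int[mu]_x (\1_O x).
  have IO : rintegrable mu (\1_O : T -> R) by exact: rintegrable_indic.
  rewrite -Rintegral_lin//; apply: Rintegral_le.
  - exact: psi_integrable.
  - by apply: rintegrableD; exact: rintegrableZ.
  - move=> x; apply: (le_trans (ler_norm _)); rewrite normrM.
    apply: (@le_trans _ _ (M * `|u x|)); first by rewrite ler_wpM2r.
    have [M00|Mn0] := eqVneq M 0.
      rewrite M00 mul0r expr0n/= !mul0r addr0 mulr_ge0// ?sqr_ge0// divr_ge0// ltW//.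
    have Mp : 0 < M by rewrite lt_neqAle eq_sym Mn0.
    (* With this weight, [M] times the quadratic term of Young's inequality is cP / 2 u^2, which the
       Poincare inequality absorbs into [B u u / 2]. *)
    have c0 : 0 < cP / 2 / M by rewrite !divr_gt0.
    have := HO_abs_le Hu c0 x; rewrite -(ler_pM2l Mp); move=> /le_trans; apply.
    rewrite le_eqVlt; apply/orP; left; apply/eqP; field.
    by rewrite ?Mn0 gt_eqF.
rewrite (@Rintegral_indic _ _ _ mu O mO) -/oO in h.
have := poincare Hu; rewrite /J; lra.
Qed.

Let HO0 : HO (fun=> 0).
Proof.
split; first exact: finE_cst.
- rewrite (_ : (fun _ => _) = cst 0); first exact: integrable0.
  by apply/funext => x; rewrite expr0n.
- by [].
Qed.

Let Jset := [set J u | u in [set u | HO u]].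

Let Jset_inf : has_inf Jset.
Proof.
split; first by exists (J (fun=> 0)), (fun=> 0).
by exists (- (M ^+ 2 / cP * oO * 2)) => _ [u Hu <-]; exact: J_bound.
Qed.

Let m := inf Jset.

Let m_le u : HO u -> m <= J u.
Proof. by move=> Hu; apply: inf_lbound; [case: Jset_inf|exists u]. Qed.

Let vn_ex n : exists u, HO u /\ J u < m + 4^-1 ^+ n.
Proof.
have e0 : 0 < (4^-1 ^+ n : R) by rewrite exprn_gt0.
by have [_ [u Hu <-] h] := inf_adherent e0 Jset_inf; exists u.
Qed.

(** Parallelogram identity: the energy of u - v is 4 (J u + J v) minus 8 times J at the midpoint,
    and the midpoint competes for the infimum. *)
Let B_sub a b u v : HO u -> HO v -> J u < m + a -> J v < m + b ->
  B (fun x => 1 * u x + (-1) * v x) (fun x => 1 * u x + (-1) * v x) <= 4 * (a + b).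
Proof.
move=> Hu Hv; have Eu := HO_finE Hu; have Ev := HO_finE Hv.
have := m_le (HO_lin 2^-1 2^-1 Hu Hv); rewrite J_lin//.
by rewrite B_quad// /J; lra.
Qed.

(** Direct method. Functions within 4^-n of the infimum are Cauchy in energy by the parallelogram
    identity and in L^2 by the Poincare inequality, hence converge almost everywhere, and Fatou
    bounds the energy of their difference to the limit. The equation is read off from first
    variations of these near-minimizers, with errors that tend to 0. *)
Lemma exists_weak_solution : exists2 u, HO u &
  forall v, HO v -> B u v = \int[mu]_x (psi x * v x).
Proof.
have /choice[v /all_and2[Hv Jv]] := vn_ex.
pose q : R := 4^-1.
have q1 : 0 < q < 1 by rewrite /q; apply/andP; split; lra.
have qn i j : (i <= j)%N -> q ^+ j <= q ^+ i.
  by move=> ij; rewrite ler_wiXn2l//; [rewrite /q; lra|lra].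
have Bd i j : (i <= j)%N ->
    B (fun x => 1 * v i x + (-1) * v j x) (fun x => 1 * v i x + (-1) * v j x) <= 8 * q ^+ i.
  move=> ij; apply: (le_trans (B_sub (Hv i) (Hv j) (Jv i) (Jv j))).
  by have := qn _ _ ij; rewrite -/q; lra.
have Ld i j : (i <= j)%N -> \int[mu]_x (1 * v i x + (-1) * v j x) ^+ 2 <= 8 * q ^+ i / cP.
  move=> ij; rewrite ler_pdivlMr// mulrC; apply: le_trans (Bd _ _ ij).
  exact/poincare/HO_lin.
pose h : R := 2^-1.
have hq n : q ^+ n = h ^+ n * h ^+ n by rewrite -exprMn /q /h; congr (_ ^+ n); lra.
have h0 n : 0 < h ^+ n by rewrite exprn_gt0// /h; lra.
have [A mA [A0 cA]] : exists2 A, measurable A & mu (~` A) = 0%E /\ forall x, A x -> cvgn (v ^~ x).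
  apply: (@ae_cvg_summable _ _ _ _ _ (fun n => (8 / cP + oO) * h ^+ n)).
  - by move=> n; exact: HO_measurable.
  - rewrite (_ : (fun n => _) = geometric (8 / cP + oO) h)//.
    by apply: is_cvg_geometric_series; rewrite /h ger0_norm; lra.
  - by move=> n; rewrite mulr_ge0 ?(ltW (h0 n))// addr_ge0 ?divr_ge0 ?(ltW cP0)// fine_ge0.
  - move=> n.
    have Hd := HO_lin 1 (-1) (Hv n) (Hv n.+1).
    have Id : rintegrable mu (fun x => `|1 * v n x + (-1) * v n.+1 x|) by exact: HO_abs_integrable.
    rewrite (eq_integral (fun x => (`|1 * v n x + (-1) * v n.+1 x|)%:E)); last first.
      by move=> x _; rewrite distrC mul1r mulN1r.
    rewrite -EFin_Rintegral// lee_fin.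
    have hn0 : 0 < (h ^+ n)^-1 by rewrite invr_gt0.
    have I2 : rintegrable mu (fun x => (1 * v n x + (-1) * v n.+1 x) ^+ 2) by case: Hd.
    have IO : rintegrable mu (\1_O : T -> R) by exact: rintegrable_indic.
    apply: (@le_trans _ _ (\int[mu]_x ((h ^+ n)^-1 * (1 * v n x + (-1) * v n.+1 x) ^+ 2 + h ^+ n * \1_O x))).
      apply: Rintegral_le => //; first by apply: rintegrableD; exact: rintegrableZ.
      by move=> x; have := HO_abs_le Hd hn0 x; rewrite invrK.
    rewrite Rintegral_lin// (Rintegral_indic _ mO) -/oO mulrDl.
    rewrite [h ^+ n * oO]mulrC lerD2r.
    apply: (@le_trans _ _ ((h ^+ n)^-1 * (8 * q ^+ n / cP))).
      by rewrite ler_wpM2l ?(ltW hn0)//; exact: Ld.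
    rewrite hq le_eqVlt; apply/orP; left; apply/eqP; field.
    by rewrite !gt_eqF.
(* Set to 0 on the null complement of [A], the sequence converges at every point and no integral
   changes. *)
pose w n x := v n x * \1_A x.
pose u x := limn (fun n => w n x).
have cw x : w ^~ x @ \oo --> u x.
  have [/set_mem Ax|/negP Ax] := boolP (x \in A).
    have -> : w ^~ x = v ^~ x by apply/funext => n; rewrite /w indicE mem_set// mulr1.
    have -> : u x = limn (v ^~ x).
      by rewrite /u; congr (limn _); apply/funext => n; rewrite /w indicE mem_set// mulr1.
    exact: cA.
  have e : w ^~ x = cst 0.
    apply/funext => n; rewrite /w indicE memNset ?mulr0// => Ax'; exact/Ax/mem_set.
  by rewrite /u e lim_cst//; exact: cvg_cst.
have mw n : measurable_fun setT (w n).
  by apply: measurable_funM; [exact: HO_measurable|exact: measurable_indic].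
have mu_ : measurable_fun setT u by apply: (measurable_fun_cvg mw) => x _; exact: cw.
have wae n : exists2 N, measurable N & mu N = 0%E /\ forall x, ~ N x -> v n x = w n x.
  exists (~` A); first exact: measurableC.
  by split=> // x /contrapT Ax; rewrite /w indicE mem_set// mulr1.
have Hw n : HO (w n).
  have [Ev Iv zv] := Hv n; split.
  - exact: finE_ae (wae n).
  - apply: (@rintegrable_le _ _ _ _ (fun x => v n x ^+ 2)) => //.
      exact: measurable_funX.
    move=> x; rewrite ger0_norm ?sqr_ge0// /w indicE.
    by case: (_ \in _); rewrite ?mulr1// mulr0 expr0n/= sqr_ge0.
  - by move=> x Ox; rewrite /w zv// mul0r.
have Bw (z : T -> R) n : measurable_fun setT z -> B (w n) z = B (v n) z.
  move=> mz; apply/esym; apply: B_ae => //; exact: HO_measurable.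
have Jw n : J (w n) < m + q ^+ n.
  have mv := HO_measurable (Hv n).
  have -> : J (w n) = J (v n); last exact: Jv.
  rewrite /J Bw// Bsym Bw//; congr (_ - _).
  apply: Rintegral_ae; [exact: measurable_funM..|].
  have [N mN [N0 hN]] := wae n.
  exists N; split => // x /= hx; apply: contrapT => Nx; apply: hx.
  by rewrite hN.
have Bwd i j : (i <= j)%N ->
    B (fun x => 1 * w i x + (-1) * w j x) (fun x => 1 * w i x + (-1) * w j x) <= 8 * q ^+ i.
  move=> ij; apply: (le_trans (B_sub (Hw i) (Hw j) (Jw i) (Jw j))).
  by have := qn _ _ ij; lra.
pose z n x := 1 * w n x + (-1) * u x.
have mz n : measurable_fun setT (z n).
  by apply: measurable_funD; apply: measurable_funM.
have Ez n : finE (z n) /\ B (z n) (z n) <= 8 * q ^+ n.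
  suff [Iz h2] : rintegrable (mu \x mu)%E (Q k (z n) (z n)) /\ B (z n) (z n) <= 8 * q ^+ n by [].
  apply: Rintegral_le_fin.
  - exact: measurable_Q.
  - exact: Quu_ge0.
  (* Fatou in the second index turns the Cauchy estimate into a bound on the difference to the
     limit. *)
  pose g j x := 1 * w n x + (-1) * w (n + j)%N x.
  have Hg j : HO (g j) by exact: HO_lin.
  apply: (@fatou_bound _ _ _ _ (fun j => Q k (g j) (g j))).
  - by move=> j; apply: measurable_Q => //; exact: HO_measurable.
  - by move=> j p; exact: Quu_ge0.
  - move=> p.
    have cg x : g ^~ x @ \oo --> z n x.
      apply: cvgD; first exact: cvg_cst.
      apply: cvgM; first exact: cvg_cst.
      have := cw x; rewrite -(cvg_shiftn n) => h3.
      by apply: cvg_trans h3; apply: near_eq_cvg; apply: nearW => j; rewrite addnC.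
    by apply: cvgM; [apply: cvgM; apply: cvgB; exact: cg|exact: cvg_cst].
  - move=> j; rewrite -EFin_Rintegral; last by case: (Hg j) => -[].
    by rewrite lee_fin; apply: Bwd; exact: leq_addr.
have Lz : rintegrable mu (fun x => z 0%N x ^+ 2).
  suff [] : rintegrable mu (fun x => z 0%N x ^+ 2) /\ \int[mu]_x (z 0%N x ^+ 2) <= 8 / cP by [].
  apply: Rintegral_le_fin; [exact: measurable_funX|by move=> x; exact: sqr_ge0|].
  pose g j x := 1 * w 0%N x + (-1) * w j x.
  have Hg j : HO (g j) by exact: HO_lin.
  apply: (@fatou_bound _ _ _ _ (fun j x => g j x ^+ 2)).
  - by move=> j; apply: measurable_funX => //; exact: HO_measurable.
  - by move=> j p; exact: sqr_ge0.
  - move=> x.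
    have cg : g ^~ x @ \oo --> z 0%N x.
      apply: cvgD; first exact: cvg_cst.
      by apply: cvgM; [exact: cvg_cst|exact: cw].
    by rewrite [_ ^+ 2]expr2; under eq_fun do rewrite expr2; exact: cvgM.
  - move=> j; rewrite -EFin_Rintegral; last by case: (Hg j).
    rewrite lee_fin ler_pdivlMr// mulrC; apply: le_trans (poincare (Hg j)) _.
    by have := Bwd 0%N j (leq0n j); rewrite expr0 mulr1.
have uz n x : u x = 1 * w n x + (-1) * z n x by rewrite /z; ring.
have Hz : HO (z 0%N).
  split=> //; first by case: (Ez 0%N).
  move=> x Ox; have w0 n : w n x = 0 by case: (Hw n) => _ _; exact.
  have -> : z 0%N x = - u x by rewrite /z w0; ring.
  have -> : u x = limn (fun=> 0 : R) by rewrite /u; congr (limn _); apply/funext.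
  by rewrite lim_cst// oppr0.
have Hu : HO u.
  rewrite (_ : u = fun x => 1 * w 0%N x + (-1) * z 0%N x); first exact: HO_lin.
  by apply/funext => x; exact: uz.
exists u => // t Ht; rewrite -/(l t).
have Et := HO_finE Ht; have Eu := HO_finE Hu.
pose C := 5 + B t t.
have Btt := Buu_ge0 mu k0 t.
have C0 : 0 < C by rewrite /C; lra.
(* Variations of [w n] with steps 2^-n and -2^-n lose 4^-n in [J], so |B(w n, t) - l t| <= 2^-n (1 +
   B(t, t) / 2). Nonnegativity of the form at z n + s t, with B(z n, z n) <= 8 4^-n, gives |B(z n,
   t)| <= 2^-n (4 + B(t, t) / 2). The sum is 2^-n [C]. *)
have key n : `|B u t - l t| <= h ^+ n * C.
  have [Ezn Bzn] := Ez n; have Ew := HO_finE (Hw n).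
  have -> : B u t = B (w n) t - B (z n) t.
    rewrite (_ : u = fun x => 1 * w n x + (-1) * z n x).
      by rewrite B_linl//; ring.
    by apply/funext => x; exact: uz.
  have J1 s : - q ^+ n <= s * (B (w n) t - l t) + s ^+ 2 * (B t t / 2).
    have := m_le (HO_lin 1 s (Hw n) Ht); rewrite J_lin//.
    by have := Jw n; rewrite /J; lra.
  have B1 s : 0 <= B (z n) (z n) + 2 * s * B (z n) t + s ^+ 2 * B t t.
    have := Buu_ge0 mu k0 (fun x => 1 * z n x + s * t x).
    by rewrite B_quad//; lra.
  have := J1 (h ^+ n); have := J1 (- h ^+ n).
  have := B1 (h ^+ n); have := B1 (- h ^+ n).
  move: Bzn; rewrite !sqrrN hq !expr2 /C.
  set a := B (w n) t - l t; set b := B (z n) t; set Z := B (z n) (z n); set c := B t t in Btt *.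
  have := h0 n; set g := h ^+ n => g0 hZ h1 h2 h3 h4.
  have ->: B (w n) t - b - l t = a - b by rewrite /a; ring.
  have i1 : - g * (1 + c / 2) <= a by rewrite -(ler_pM2l g0); lra.
  have i2 : a <= g * (1 + c / 2) by rewrite -(ler_pM2l g0); lra.
  have i3 : - g * (4 + c / 2) <= b by rewrite -(ler_pM2l g0); lra.
  have i4 : b <= g * (4 + c / 2) by rewrite -(ler_pM2l g0); lra.
  by rewrite ler_norml; apply/andP; split; lra.
apply/eqP; rewrite -subr_eq0 -normr_eq0; apply/negPn/negP => en0.
have e0 : 0 < `|B u t - l t| / C by rewrite divr_gt0// lt_neqAle eq_sym en0/=.
have hc : h ^+ n @[n --> \oo] --> 0.
  by apply: cvg_expr; rewrite /h ger0_norm; lra.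
move/cvgrPdist_lt : hc => /(_ _ e0) [N _ /(_ N (leqnn N))].
rewrite /= sub0r normrN ger0_norm ?(ltW (h0 N))// ltr_pdivlMr//.
by rewrite ltNge key.
Qed.

End WeakSolution.

(** * Faber-Krahn inequality *)

Section GammaBounds.
Context {R : realType}.
Local Notation leb := (@lebesgue_measure R).

(** The integrand may blow up at 0, so the fundamental theorem of calculus is applied on
    [1/(n+2), 1] and n tends to infinity. *)
Lemma integral_powR_01 (s : R) : 0 < s ->
  (\int[leb]_(t in `]0%R, 1%R]%classic) (t `^ (s - 1))%:E <= (s^-1)%:E)%E.
Proof.
move=> s0.
pose F (n : nat) : set R := `[(n.+2%:R^-1 : R), 1]%classic.
have a0 n : 0 < (n.+2%:R^-1 : R) by rewrite invr_gt0 ltr0n.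
have a1 n : (n.+2%:R^-1 : R) < 1 by rewrite invf_lt1 ?ltr0n// ltr1n.
have UF : `]0%R, 1%R]%classic = \bigcup_n F n.
  apply/seteqP; split=> t /=; rewrite ?in_itv/=.
    move=> /andP[t0 t1]; exists (Num.Def.trunc t^-1) => //; rewrite /F/= in_itv/= t1 andbT.
    rewrite invf_ple ?posrE ?ltr0n//.
    by apply: (le_trans (ltW (truncnS_gt _))); rewrite ler_nat.
  by move=> [n _]; rewrite /F/= in_itv/= => /andP[h ->]; rewrite (lt_le_trans _ h).
have mf D : measurable D -> measurable_fun D (fun t : R => (t `^ (s - 1))%:E).
  move=> mD; apply/measurable_EFinP; apply: measurable_funTS.
  exact: measurable_powR.
have cv := @ge0_nondecreasing_set_cvg_integral _ (measurableTypeR R) R F (fun t : R => (t `^ (s - 1))%:E) leb.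
rewrite UF; apply: cvge_le (cv _ _ _ _).
- apply: nearW => n.
  rewrite (@continuous_FTC2 _ _ (fun t => t `^ s / s))//.
  + rewrite powR1 div1r -EFinB lee_fin lerBlDr lerDl divr_ge0 ?powR_ge0// ltW//.
  + apply: continuous_in_subspaceT => t /set_mem; rewrite /= in_itv/= => /andP[h _].
    have t0 : 0 < t by exact: lt_le_trans h.
    apply: differentiable_continuous; apply/derivable1_diffP.
    by apply: derivable_powR; rewrite in_itv/= t0.
  + have cF t : 0 < t -> {for t, continuous (fun t : R => t `^ s / s)}.
      move=> t0; have c1 : {for t, continuous (fun t : R => t `^ s)}.
        apply: differentiable_continuous; apply/derivable1_diffP.
        by apply: derivable_powR; rewrite in_itv/= t0.
      by apply: cvgM; [exact: c1|exact: cvg_cst].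
    split.
    * move=> t; rewrite in_itv/= => /andP[h _]; have t0 : 0 < t by exact: lt_trans h.
      apply: derivableM => //; by apply: derivable_powR; rewrite in_itv/= t0.
    * by apply: cvg_at_right_filter; apply: cF.
    * by apply: cvg_at_left_filter; apply: cF.
  + move=> t; rewrite in_itv/= => /andP[h _]; have t0 : 0 < t by exact: lt_trans h.
    rewrite derive1E deriveMr//; last by apply: derivable_powR; rewrite in_itv/= t0.
    rewrite -derive1E powR_derive1 ?in_itv/= ?t0//.
    by rewrite /GRing.scale/=; field; rewrite gt_eqF.
- move=> m n mn; apply/subsetPset => t; rewrite /F/= !in_itv/= => /andP[h ->].
  rewrite (le_trans _ h)// lef_pV2 ?posrE ?ltr0n// ler_nat !ltnS; exact: mn.
- by move=> n; exact: measurable_itv.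
- by move=> n; apply: mf; exact: measurable_itv.
- by move=> n t _; rewrite lee_fin powR_ge0.
Qed.

Lemma integral_expN_half : (\int[leb]_(t in `]0%R, +oo[%classic) (expR (- (t / 2)))%:E <= 2%:E)%E.
Proof.
have r0 : 0 < (2^-1 : R) by [].
have := integral_exponential_pdf r0.
have -> : (\int[leb]_x (exponential_pdf 2^-1 x)%:E = \int[leb]_(x in `[0%R, +oo[) ((2^-1 : R) * expR (- (2^-1 : R) * x))%:E)%E.
  rewrite [RHS]integral_mkcond; apply: eq_integral => x _.
  by rewrite /exponential_pdf !patchE; case: ifP.
have mE D : measurable D -> measurable_fun D (fun x : R => (expR (- (2^-1 : R) * x))%:E).
  move=> mD; apply/measurable_EFinP; apply: measurable_funTS.
  by apply: measurableT_comp => //; exact: measurable_funM.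
under eq_integral do rewrite EFinM.
rewrite ge0_integralZl//; last exact: (mE _ (measurable_itv _)).
move=> h; apply: (@le_trans _ _ (\int[leb]_(x in `[0%R, +oo[) (expR (- (2^-1 : R) * x))%:E)%E).
  under eq_integral do rewrite mulrC -mulNr.
  apply: ge0_subset_integral => //.
  - exact: (mE _ (measurable_itv _)).
  - by move=> x /=; rewrite !in_itv/= !andbT; exact: ltW.
by rewrite -(@lee_pmul2l _ (2^-1)%:E)//= ?h -?EFinM ?lee_fin ?mulVf// lte_fin.
Qed.

Let g (s t : R) : R := t `^ (s - 1) * expR (- t).

Let g_ge0 s t : 0 <= g s t. Proof. by rewrite mulr_ge0 ?powR_ge0 ?expR_ge0. Qed.

Let mg (D : set (measurableTypeR R)) s : measurable D -> measurable_fun D (fun t => (g s t)%:E).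
Proof.
move=> mD; apply/measurable_EFinP; apply: measurable_funTS.
apply: measurable_funM; first exact: measurable_powR.
by apply: measurableT_comp.
Qed.

(** Below 1 the exponential is at most 1. Above 1, t^(n+1) <= 2^(n+1) (n+1)! e^(t/2) by a single
    term of the exponential series, which leaves e^(-t/2), of integral at most 2. *)
Lemma Gamma_integral_le (n : nat) (s : R) : 0 < s -> s <= n.+2%:R ->
  (\int[leb]_(t in `]0%R, +oo[%classic) (t `^ (s - 1) * expR (- t))%:E <=
    (s^-1 + 2 ^+ n.+2 * n.+1`!%:R)%:E)%E.
Proof.
move=> s0 sn.
rewrite (_ : `]0%R, +oo[%classic = `]0%R, 1%R] `|` `]1%R, +oo[); last first.
  apply/seteqP; split=> t /=; rewrite !in_itv/= !andbT.
    by move=> t0; case: (leP t 1) => ?; [left; rewrite t0|right].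
  by move=> [/andP[]//|/(lt_trans ltr01)].
rewrite -[X in (X <= _)%E]/(\int[leb]_(t in _) (g s t)%:E)%E.
rewrite ge0_integral_setU//; last 3 first.
- by apply: mg; apply: measurableU; exact: measurable_itv.
- by move=> t _; rewrite lee_fin g_ge0.
- apply/disj_setPS => t [/=]; rewrite !in_itv/= => /andP[_ t1] /andP[t2 _].
  by move: (le_lt_trans t1 t2); rewrite ltxx.
rewrite EFinD; apply: leeD.
  apply: le_trans (integral_powR_01 s0); apply: ge0_le_integral => //.
  - by move=> t _; rewrite lee_fin g_ge0.
  - exact: mg.
  - by apply/measurable_EFinP; apply: measurable_funTS; exact: measurable_powR.
  - move=> t /=; rewrite in_itv/= lee_fin => /andP[t0 _].
    by rewrite /g ler_piMr ?powR_ge0// -expR0 ler_expR oppr_le0 ltW.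
pose K : R := 2 ^+ n.+1 * n.+1`!%:R.
have K0 : 0 <= K by rewrite /K mulr_ge0// exprn_ge0.
apply: (@le_trans _ _ (\int[leb]_(t in `]1%R, +oo[) (K%:E * (expR (- (t / 2)))%:E))%E).
  apply: ge0_le_integral => //.
  - by move=> t _; rewrite lee_fin g_ge0.
  - exact: mg.
  - apply: measurable_funTS; apply: measurable_funeM; apply/measurable_EFinP.
    by apply: measurableT_comp => //; apply: measurableT_comp => //; exact: measurable_funM.
  - move=> t /=; rewrite in_itv/= andbT -EFinM lee_fin => t1.
    have t0 : 0 <= t by lra.
    rewrite /g; have -> : - t = - (t / 2) + - (t / 2) by lra.
    rewrite expRD mulrA ler_wpM2r ?expR_ge0//.
    rewrite expRN ler_pdivrMr ?expR_gt0//.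
    apply: (@le_trans _ _ (t ^+ n.+1)).
      by rewrite -powR_mulrn// ler_powR ?(ltW t1)// lerBlDr natr1.
    have := @expR_ge1Dxn _ (t / 2) n (divr_ge0 t0 (ler0n _ 2)).
    move=> h; rewrite /K -mulrA.
    apply: (@le_trans _ _ (2 ^+ n.+1 * (n.+1`!%:R * ((t / 2) ^+ n.+1 / n.+1`!%:R)))).
      rewrite expr_div_n le_eqVlt; apply/orP; left; apply/eqP; field.
      by rewrite ?expf_neq0// pnatr_eq0 -lt0n fact_gt0.
    by rewrite !ler_wpM2l// ?exprn_ge0//; lra.
rewrite ge0_integralZl//; last first.
  apply: measurable_funTS; apply/measurable_EFinP.
  by apply: measurableT_comp => //; apply: measurableT_comp => //; exact: measurable_funM.
rewrite (_ : 2 ^+ n.+2 * _ = K * 2); last by rewrite /K exprS; ring.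
rewrite (EFinM K 2); apply: lee_wpmul2l; first by rewrite lee_fin.
apply: le_trans integral_expN_half; apply: ge0_subset_integral => //.
- apply: measurable_funTS; apply/measurable_EFinP.
  by apply: measurableT_comp => //; apply: measurableT_comp => //; exact: measurable_funM.
- by move=> t /=; rewrite !in_itv/= !andbT; apply: lt_trans.
Qed.

(** On [1, 2] the integrand is at least e^-2 / t, whatever s > 0. *)
Lemma Gamma_integral_ge (s : R) : 0 < s ->
  ((expR (-2) / 2)%:E <= \int[leb]_(t in `]0%R, +oo[%classic) (t `^ (s - 1) * expR (- t))%:E)%E.
Proof.
move=> s0.
apply: (@le_trans _ _ (\int[leb]_(t in `[1%R, 2%R]%classic) (g s t)%:E)%E); last first.
  apply: ge0_subset_integral => //.
  - exact: mg.
  - by move=> t _; rewrite lee_fin g_ge0.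
  - by move=> t /=; rewrite !in_itv/= => /andP[h _]; rewrite andbT; lra.
apply: (@le_trans _ _ (\int[leb]_(t in `[1%R, 2%R]%classic) (expR (-2) / 2)%:E)%E).
  rewrite integral_cst//= lebesgue_measure_itv/= lte_fin ltr1n/= -EFinB -EFinM lee_fin; lra.
apply: ge0_le_integral => //.
- exact: mg.
- move=> t /=; rewrite in_itv/= lee_fin => /andP[t1 t2]; rewrite /g mulrC.
  apply: ler_pM => //; rewrite ?expR_ge0//; last by rewrite ler_expR; lra.
  apply: (@le_trans _ _ (t `^ (-1))).
    by rewrite powR_inv1; [rewrite lef_pV2 ?posrE; lra|lra].
  by rewrite ler_powR//; lra.
Qed.

Lemma Gamma_pos_bounds (n : nat) (s : R) : 0 < s -> s <= n.+2%:R ->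
  expR (-2) / 2 <= Gamma_pos s /\ Gamma_pos s <= s^-1 + 2 ^+ n.+2 * n.+1`!%:R.
Proof.
move=> s0 sn; have h1 := Gamma_integral_ge s0; have h2 := Gamma_integral_le s0 sn.
rewrite /Gamma_pos; set I := (\int[_]_(_ in _) _)%E in h1 h2 *.
have If : I \is a fin_num.
  rewrite ge0_fin_numE; first exact: le_lt_trans h2 (ltry _).
  by apply: le_trans h1; rewrite lee_fin divr_ge0 ?expR_ge0.
by rewrite -!lee_fin fineK.
Qed.

(** As alpha tends to 2, -alpha/2 approaches the pole of Gamma at -1, which is the source of the
    factor 2 - alpha: |Gamma(-alpha/2)| = Gamma(1 - alpha/2) / (alpha/2), and Gamma(s) <= 1/s + 4 <=
    5/s for 0 < s <= 1. The factor alpha/2 is at least alpha0/2, and the remaining ones are bounded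
    below uniformly. *)
Lemma kalpha_const_ge (d : nat) (alpha0 : R) : 0 < alpha0 ->
  exists2 c : R, 0 < c & forall alpha, alpha0 <= alpha -> alpha < 2 ->
   forall x y : pt R d, c * (2 - alpha) * (eucl y x) `^ (- (d%:R + alpha)) <= kalpha alpha x y.
Proof.
move=> a0; pose g0 : R := expR (-2) / 2.
have g00 : 0 < g0 by rewrite /g0 divr_gt0 ?expR_gt0.
have pi0 : 0 < (pi : R) `^ (d%:R / 2) by rewrite powR_gt0 ?pi_gt0.
exists (g0 * alpha0 / (20 * pi `^ (d%:R / 2))).
  by rewrite divr_gt0 ?mulr_gt0.
move=> alpha a1 a2 x y; rewrite /kalpha ler_wpM2r ?powR_ge0//.
have h1 : g0 <= Gamma ((d%:R + alpha) / 2).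
  have s0 : 0 < (d%:R + alpha) / 2 by rewrite divr_gt0// ltr_wpDl//; lra.
  rewrite /Gamma s0; have [] := @Gamma_pos_bounds d ((d%:R + alpha) / 2) s0 => //.
  have -> : (d.+2%:R : R) = d%:R + 2 by rewrite -(addn2 d) natrD.
  by have : 0 <= (d%:R : R) by []; lra.
have s0 : 0 < 1 - alpha / 2 by lra.
have [h2 h3] : g0 <= Gamma_pos (1 - alpha / 2) /\ Gamma_pos (1 - alpha / 2) <= (1 - alpha / 2)^-1 + 2 ^+ 2 * 1`!%:R.
  by apply: Gamma_pos_bounds => //; lra.
have -> : `|Gamma (- (alpha / 2))| = Gamma_pos (1 - alpha / 2) / (alpha / 2).
  rewrite /Gamma ifF; last by apply/negbTE; rewrite -leNgt; lra.
  rewrite [- (alpha / 2) + 1]addrC normrM normfV normrN (ger0_norm (_ : 0 <= alpha / 2)); last lra.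
  by rewrite ger0_norm//; lra.
set G1 := Gamma _ in h1 *; set G2 := Gamma_pos _ in h2 h3 *.
have G20 : 0 < G2 by lra.
have p2 : 1 <= (2 : R) `^ alpha by rewrite -[leLHS](powRr0 2) ler_powR//; lra.
have h4 : G2 * (1 - alpha / 2) <= 5.
  apply: (@le_trans _ _ (((1 - alpha / 2)^-1 + 2 ^+ 2 * 1`!%:R) * (1 - alpha / 2))).
    by rewrite ler_wpM2r// ltW.
  by rewrite mulrDl mulVf ?gt_eqF// (_ : 1`!%:R = 1 :> R)// expr2; lra.
rewrite ler_pdivlMr; last by rewrite mulr_gt0// divr_gt0//; lra.
have -> : g0 * alpha0 / (20 * pi `^ (d%:R / 2)) * (2 - alpha) * (pi `^ (d%:R / 2) * (G2 / (alpha / 2)))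
   = (alpha0 / alpha) * g0 * ((G2 * (1 - alpha / 2)) / 5).
  by field; rewrite !gt_eqF//; lra.
apply: (@le_trans _ _ (1 * g0 * 1)).
  apply: ler_pM.
  - by rewrite mulr_ge0 ?(ltW g00)// divr_ge0//; lra.
  - by rewrite divr_ge0// mulr_ge0 ?(ltW G20)// ltW.
  - by rewrite ler_wpM2r ?(ltW g00)// ler_pdivrMr; lra.
  - by lra.
by rewrite mulr1; apply: ler_pM => //; lra.
Qed.

End GammaBounds.

(** * From iterated integrals to integrals over the product measure *)

Section FormBridge.
Context {R : realType} {d : nat}.
Local Notation T := (pt R d).
Local Notation mu := (lebn (R := R) d).
Local Notation P := (mu \x mu)%E.

Lemma iint2E (F : T -> T -> \bar R) :
  measurable_fun setT (fun p : T * T => F p.1 p.2) -> (forall x y, 0 <= F x y)%E ->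
  iint2 F = (\int[P]_p F p.1 p.2)%E.
Proof.
move=> mF F0; rewrite /iint2 fubini_tonelli1//.
rewrite iintE; last 2 first.
- exact: measurable_iint.
- move=> x; rewrite iintE//; first exact: integral_ge0.
  exact: (measurableT_comp mF (pair1_measurable _)).
apply: eq_integral => x _; rewrite iintE//.
exact: (measurableT_comp mF (pair1_measurable _)).
Qed.

Lemma sint2E (F : T -> T -> \bar R) :
  measurable_fun setT (fun p : T * T => F p.1 p.2) ->
  sint2 F = (\int[P]_p F p.1 p.2)%E.
Proof.
move=> mF; rewrite /sint2 [RHS]integralE.
have g0 (z : \bar R) : (0 <= maxe z 0)%E by rewrite le_max lexx orbT.
have mN : measurable_fun setT (fun p : T * T => - F p.1 p.2)%E by exact: measurableT_comp.
rewrite (@iint2E (fun x y => maxe (F x y) 0)%E)//; last exact: measurable_maxe.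
rewrite (@iint2E (fun x y => maxe (- F x y) 0)%E)//; last exact: measurable_maxe.
by congr (_ - _)%E; apply: eq_integral => p _; rewrite ?funeposE ?funenegE.
Qed.

Lemma sintE (f : T -> \bar R) : measurable_fun setT f ->
  sint f = (\int[mu]_x f x)%E.
Proof.
move=> mf; rewrite /sint [RHS]integralE.
have g0 (z : \bar R) : (0 <= maxe z 0)%E by rewrite le_max lexx orbT.
have mN : measurable_fun setT (fun p : T => - f p)%E by exact: measurableT_comp.
rewrite (@iintE _ _ (fun x => maxe (f x) 0)%E)//; last exact: measurable_maxe.
rewrite (@iintE _ _ (fun x => maxe (- f x) 0)%E)//; last exact: measurable_maxe.
by congr (_ - _)%E; apply: eq_integral => p _; rewrite ?funeposE ?funenegE.
Qed.

Lemma measurable_kalpha alpha :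
  measurable_fun setT (fun p : T * T => kalpha alpha p.1 p.2).
Proof.
rewrite /kalpha; apply: measurable_funM; first exact: measurable_cst.
by apply: (measurableT_comp (measurable_powR _)); exact: measurable_eucl.
Qed.

End FormBridge.

(** * Faber-Krahn inequality for the fractional form, through increments *)

Section FaberKrahn.
Context {R : realType} {d : nat}.
Local Notation T := (pt R d).
Local Notation mu := (lebn (R := R) d).
Local Notation P := (mu \x mu)%E.
Hypothesis d0 : (0 < d)%N.

Variable w : T -> R.
Hypothesis mw : measurable_fun setT w.

Definition incr (h : T) : \bar R := (\int[mu]_x ((w x - w (affine 1 h x)) ^+ 2)%:E)%E.

Let mshift2 : measurable_fun setT (fun p : T * T => affine 1 p.1 p.2 : T).
Proof. exact: measurable_affine. Qed.

Let mshift (h : T) : measurable_fun setT (fun x : T => affine 1 h x : T).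
Proof. exact: measurable_affine. Qed.

Let mwsq : measurable_fun setT (fun p : T * T => ((w p.2 - w (affine 1 p.1 p.2)) ^+ 2)%:E).
Proof.
apply/measurable_EFinP; apply: measurable_funX; apply: measurable_funB.
  exact: measurableT_comp.
exact: (measurableT_comp mw mshift2).
Qed.

Let mwsq1 (h : T) : measurable_fun setT (fun x : T => ((w x - w (affine 1 h x)) ^+ 2)%:E).
Proof. exact: (measurableT_comp mwsq (pair1_measurable h)). Qed.

Lemma incr_ge0 h : (0 <= incr h)%E.
Proof. by apply: integral_ge0 => x _; rewrite lee_fin sqr_ge0. Qed.

Lemma measurable_incr : measurable_fun setT incr.
Proof.
apply: (measurable_fun_fubini_tonelli_F (fun p : T * T => ((w p.2 - w (affine 1 p.1 p.2)) ^+ 2)%:E)) => //.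
by move=> p; rewrite lee_fin sqr_ge0.
Qed.

(* Doubling [h] multiplies [incr h] by at most 4, so the increments at all smaller dyadic
   scales are bounded below by those at distance about [rho]; the ratio of the resulting
   geometric series produces the factor [2 - alpha] in [fractional_faber_krahn]. *)
Lemma incr_double (h : T) : (incr (affine 2 origin h) <= 4%:E * incr h)%E.
Proof.
have e x : affine 1 (affine 2 origin h) x = affine 1 h (affine 1 h x).
  apply: eq_from_tnth => i; rewrite !tnth_affine tnth_origin; ring.
pose f x := ((w x - w (affine 1 h x)) ^+ 2)%:E.
have f0 x : (0 <= f x)%E by rewrite lee_fin sqr_ge0.
have mf : measurable_fun setT f := mwsq1 h.
have mfh : measurable_fun setT (fun x => f (affine 1 h x)) by exact: measurableT_comp.
have -> : (4%:E * incr h = \int[mu]_x (2%:E * (f x + f (affine 1 h x))))%E.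
  rewrite ge0_integralZl//; last 2 first.
  - exact: emeasurable_funD.
  - by move=> x _; rewrite adde_ge0.
  rewrite ge0_integralD// -(integral_shift h mf f0) -/(incr h).
  rewrite -[in RHS]mule2n.
  by rewrite -[in RHS]mule_natl muleA -EFinM -natrM.
apply: ge0_le_integral => //.
- by move=> x _; rewrite lee_fin sqr_ge0.
- by apply: measurable_funeM; exact: emeasurable_funD.
move=> x _; rewrite e /f -EFinD -EFinM lee_fin.
set a := w x; set b := w (affine 1 h x); set c := w _.
by have := sqr_ge0 ((a - b) - (b - c)); nra.
Qed.

Lemma incr_half (h : T) : (incr h <= 4%:E * incr (affine 2^-1 origin h))%E.
Proof.
have {1}-> : h = affine 2 origin (affine 2^-1 origin h).
  by apply: eq_from_tnth => i; rewrite !tnth_affine tnth_origin; field.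
exact: incr_double.
Qed.

Variable alpha : R.
Hypothesis alpha0 : 0 < alpha.
Hypothesis alpha2 : alpha < 2.

Let N (h : T) : R := (eucl h origin) `^ (- (d%:R + alpha)).

Let mN : measurable_fun setT N.
Proof. by apply: (measurableT_comp (measurable_powR _)); exact: measurable_eucl. Qed.

Let N0 h : 0 <= N h. Proof. exact: powR_ge0. Qed.

Let Ibelow (rho : R) : \bar R := (\int[mu]_h ((\1_(oball origin rho) h * N h)%:E * incr h))%E.

Let mfI (A : set T) : measurable A -> measurable_fun setT (fun h => ((\1_A h * N h)%:E * incr h)%E).
Proof.
move=> mA; apply: emeasurable_funM; last exact: measurable_incr.
by apply/measurable_EFinP; apply: measurable_funM => //; exact: measurable_indic.
Qed.

Let fI0 (A : set T) h : (0 <= ((\1_A h * N h)%:E * incr h))%E.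
Proof. by rewrite mule_ge0 ?incr_ge0// lee_fin mulr_ge0. Qed.

(** Substitute h/2 for h: the Jacobian 2^-d, the kernel factor 2^(d + alpha) and the constant 2^(2 -
    alpha) multiply to 4, which is exactly the loss in [incr_half]. *)
Lemma Ibelow_half rho : (Ibelow rho <= (2 `^ (2 - alpha))%:E * Ibelow (rho / 2))%E.
Proof.
have mb r : measurable (oball (origin : T) r) by exact: measurable_oball.
have c0 : 0 < (2^-1 : R) by [].
pose f h := ((\1_(oball (origin : T) (rho / 2)) h * N h)%:E * incr h)%E.
have mf : measurable_fun setT f := mfI (mb _).
have maff : measurable_fun setT (fun h : T => affine 2^-1 origin h : T) by exact: measurable_affine.
have mfa : measurable_fun setT (fun h : T => f (affine 2^-1 origin h)) := measurableT_comp mf maff.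
have f0 h : (0 <= f h)%E by exact: fI0.
have c1 : 0 <= (2^-1 : R) ^+ d by rewrite exprn_ge0// ltW.
have -> : Ibelow (rho / 2) = (\int[mu]_h ((2^-1 ^+ d)%:E * f (affine 2^-1 origin h)))%E.
  rewrite (integralZT mu c1 (fun h => f0 _) mfa).
  exact: (integral_lebn_affine _ c0 mf f0).
have ff0 h : (0 <= (2^-1 ^+ d)%:E * f (affine 2^-1 origin h))%E by rewrite mule_ge0.
rewrite -integralZT ?powR_ge0//; last exact: measurable_funeM.
apply: le_integralT.
- by move=> h; exact: fI0.
- exact: mfI.
- by apply: measurable_funeM; exact: measurable_funeM.
move=> h; rewrite /f.
have eh : eucl (affine 2^-1 origin h) origin = 2^-1 * eucl h origin.
  by rewrite -{2}(affine_origin 2^-1 (origin : T)) eucl_affine// ltW.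
have -> : \1_(oball origin (rho / 2)) (affine 2^-1 origin h) = \1_(oball origin rho) h :> R.
  rewrite !indicE; congr (_%:R); congr (nat_of_bool _).
  apply/idP/idP => /set_mem; rewrite /oball/= => hh; apply/mem_set; rewrite /oball/=.
    by move: hh; rewrite eucl_sym eh [eucl h _]eucl_sym; lra.
  by rewrite eucl_sym eh eucl_sym; lra.
have -> : N (affine 2^-1 origin h) = 2 `^ (d%:R + alpha) * N h.
  rewrite /N eh powRM ?eucl_ge0//.
  by congr (_ * _); rewrite -powR_inv1// -powRrM mulN1r opprK.
rewrite !muleA -!EFinM.
have -> : 2 `^ (2 - alpha) * 2^-1 ^+ d * (\1_(oball origin rho) h * (2 `^ (d%:R + alpha) * N h))
   = (\1_(oball origin rho) h * N h) * 4 :> R.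
  rewrite -[2^-1 ^+ d]powR_mulrn ?ltW// -powR_inv1// -powRrM.
  have -> : 2 `^ (2 - alpha) * 2 `^ (-1 * d%:R) * (\1_(oball origin rho) h * (2 `^ (d%:R + alpha) * N h))
   = (\1_(oball origin rho) h * N h) * (2 `^ (2 - alpha) * 2 `^ (-1 * d%:R) * 2 `^ (d%:R + alpha)) :> R by ring.
  rewrite -!powRD; last 2 first.
  - by apply/implyP.
  - by apply/implyP.
  rewrite (_ : 2 - alpha + -1 * d%:R + (d%:R + alpha) = 2%:R); last by ring.
  by rewrite powR_mulrn//; congr (_ * _); ring.
rewrite (EFinM (\1_(oball origin rho) h * N h) 4) -muleA; apply: lee_wpmul2l; last exact: incr_half.
by rewrite lee_fin mulr_ge0.
Qed.
Let ann (rho : R) : set T := oball origin rho `\` oball origin (rho / 2).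

Let mann rho : measurable (ann rho).
Proof. by apply: measurableD; exact: measurable_oball. Qed.

Let Iann (rho : R) : \bar R := (\int[mu]_h ((\1_(ann rho) h * N h)%:E * incr h))%E.

Let Ibelow_split rho : 0 < rho -> Ibelow rho = (Ibelow (rho / 2) + Iann rho)%E.
Proof.
move=> r0; have mb r : measurable (oball (origin : T) r) by exact: measurable_oball.
rewrite /Ibelow /Iann -integralDT; last 4 first.
- by move=> h; exact: fI0.
- exact: (mfI (mb _)).
- by move=> h; exact: fI0.
- exact: (mfI (mann _)).
apply: eq_integral => h _; rewrite -ge0_muleDl ?lee_fin ?mulr_ge0//.
congr (_ * _)%E; rewrite -EFinD -mulrDl; congr (_ * _)%:E.
rewrite !indicE /ann in_setD.
have [h2|h2] := boolP (h \in oball origin (rho / 2)); last by rewrite andbT add0r.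
rewrite andbF addr0; congr (_%:R); congr (nat_of_bool _).
by apply/mem_set; apply: oball_subr (set_mem h2); lra.
Qed.

Let two_powN_ge t : 0 <= t -> 1 - t <= ((2 : R) `^ t)^-1.
Proof.
move=> t0; rewrite -powRN /powR pnatr_eq0/=.
apply: le_trans (expR_ge1Dx _).
have : ln (2 : R) <= 1.
  rewrite -[leRHS]expRK ler_ln ?posrE ?expR_gt0//.
  by have := @expR_ge1Dx R 1; lra.
by move=> h; have := ler_wpM2l t0 h; lra.
Qed.

(** The inner ball carries at least the proportion 2^-(2 - alpha) >= 1 - (2 - alpha) of the energy,
    because ln 2 <= 1, and the annulus gets at most the rest. Finiteness makes the subtraction
    legitimate. *)
Let Iann_le rho : 0 < rho -> (Ibelow rho < +oo)%E -> (Iann rho <= (2 - alpha)%:E * Ibelow rho)%E.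
Proof.
move=> r0 Iy.
have I0 r : (0 <= Ibelow r)%E by apply: integral_ge0 => h _; exact: fI0.
have X0 : (0 <= Iann rho)%E by apply: integral_ge0 => h _; exact: fI0.
have sp := Ibelow_split r0; have hf := Ibelow_half rho.
have Jy : (Ibelow (rho / 2) < +oo)%E by apply: le_lt_trans Iy; rewrite sp leeDl.
have Xy : (Iann rho < +oo)%E by apply: le_lt_trans Iy; rewrite sp leeDr.
have q0 : 0 < (2 : R) `^ (2 - alpha) by exact: powR_gt0.
have t0 : 0 <= 2 - alpha by rewrite subr_ge0 ltW.
have := two_powN_ge t0.
move: sp hf (I0 rho) (I0 (rho / 2)).
rewrite -(fineK (_ : Ibelow rho \is a fin_num)) ?ge0_fin_numE//.
rewrite -(fineK (_ : Ibelow (rho / 2) \is a fin_num)) ?ge0_fin_numE//.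
rewrite -(fineK (_ : Iann rho \is a fin_num)) ?ge0_fin_numE//.
rewrite -EFinD -!EFinM !lee_fin => -[].
set I := fine _; set J := fine _; set X := fine _ => sp hf i0 j0 h.
rewrite mulrC -ler_pdivrMr// in hf.
have := ler_wpM2l i0 h; lra.
Qed.

Variable A : set T.
Hypothesis mA : measurable A.
Hypothesis wA : forall x, ~ A x -> w x = 0.

(** For fixed x, the annulus has volume at least V rho^d / 2, and the displacements leading into [A]
    fill at most V rho^d / 4. So displacements of volume at least V rho^d / 4 lead to a zero of [w],
    where the squared increment equals w(x)^2. *)
Let Iann_ge rho : 0 < rho -> (mu A <= (vol1 (R := R) (d := d) / 4 * rho ^+ d)%:E)%E ->
  ((rho `^ (- (d%:R + alpha)) * (vol1 (R := R) (d := d) / 4 * rho ^+ d))%:E * \int[mu]_x (w x ^+ 2)%:E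
    <= Iann rho)%E.
Proof.
move=> r0 hA; have mb r : measurable (oball (origin : T) r) by exact: measurable_oball.
set v0 := vol1 / 4 * _ in hA *; set c := rho `^ _.
have c0 : 0 <= c by exact: powR_ge0.
have v00 : 0 <= v0 by rewrite /v0 mulr_ge0 ?exprn_ge0 ?(ltW r0)// divr_ge0// ltW// vol1_gt0.
have mw2 : measurable_fun setT (fun x => (w x ^+ 2)%:E : \bar R).
  by apply/measurable_EFinP; exact: measurable_funX.
pose G (p : T * T) : \bar R := ((\1_(ann rho) p.1)%:E * ((w p.2 - w (affine 1 p.1 p.2)) ^+ 2)%:E)%E.
have mG : measurable_fun setT G.
  apply: emeasurable_funM => //; apply/measurable_EFinP.
  by apply: measurableT_comp => //; exact: measurable_indic.
have G0 p : (0 <= G p)%E by rewrite mule_ge0// lee_fin ?sqr_ge0.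
apply: (@le_trans _ _ (\int[mu]_h (c%:E * ((\1_(ann rho) h)%:E * incr h)))%E); last first.
  apply: le_integralT.
  - by move=> h; rewrite mule_ge0// mule_ge0 ?lee_fin// incr_ge0.
  - apply: measurable_funeM; apply: emeasurable_funM; last exact: measurable_incr.
    by apply/measurable_EFinP; exact: measurable_indic.
  - exact: (mfI (mann _)).
  - move=> h; rewrite muleA -EFinM; apply: lee_wpmul2r; first exact: incr_ge0.
    rewrite lee_fin mulrC indicE; have [hh|_] := boolP (h \in _); last by rewrite !mul0r.
    rewrite !mul1r /N; move/set_mem : hh; rewrite /ann /oball/= ![eucl origin _]eucl_sym => -[h1 h2].
    have e0 : 0 < eucl h origin by move/negP : h2; rewrite -leNgt; lra.
    rewrite /c !powRN lef_pV2 ?posrE ?powR_gt0//.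
    by rewrite ge0_ler_powR ?nnegrE ?(ltW e0) ?(ltW r0) ?(ltW h1)// addr_ge0// ltW.
have mi : measurable_fun setT (fun h => (\1_(ann rho) h)%:E * incr h)%E.
  apply: emeasurable_funM; last exact: measurable_incr.
  by apply/measurable_EFinP; exact: measurable_indic.
rewrite integralZT//; last by move=> h; rewrite mule_ge0 ?lee_fin ?incr_ge0.
rewrite EFinM -muleA; apply: lee_wpmul2l; first by rewrite lee_fin.
have -> : (\int[mu]_h ((\1_(ann rho) h)%:E * incr h) = \int[mu]_h \int[mu]_x G (h, x))%E.
  apply: eq_integral => h _; rewrite /incr -integralZT//.
  by move=> x; rewrite lee_fin sqr_ge0.
rewrite (@fubini_tonelli _ _ _ _ _ mu mu G)//.
rewrite -integralZT//; last by move=> x; rewrite lee_fin sqr_ge0.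
apply: le_integralT.
- by move=> x; rewrite mule_ge0// ?lee_fin ?sqr_ge0.
- exact: measurable_funeM.
- exact: (measurable_fun_fubini_tonelli_G G).
move=> x.
pose S := ann rho `\` [set h | A (affine 1 h x)].
have mAx : measurable [set h : T | A (affine 1 h x)].
  have := measurableT_comp mshift2 (pair2_measurable x).
  by move=> /(_ measurableT A mA); rewrite setTI.
have mS : measurable S by exact: measurableD.
have muAx : mu [set h : T | A (affine 1 h x)] = mu A.
  rewrite -[in LHS](setIT [set h | _]) -integral_indic// -(setIT A) -integral_indic//.
  rewrite [RHS](integral_shift x)//; last exact/measurable_EFinP/measurable_indic.
  apply: eq_integral => h _; congr EFin; rewrite !indicE setIT.
  rewrite affine1C.
  by rewrite (_ : (h \in [set h0 : T | A (affine 1 h0 x)]) = (affine 1 h x \in A)).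
have hS : (v0%:E <= mu S)%E.
  have : (mu (oball origin rho) <= mu (oball (origin : T) (rho / 2)) + (mu S + mu A))%E.
    rewrite -muAx.
    apply: (@le_trans _ _ (mu (oball (origin : T) (rho / 2) `|` (S `|` [set h : T | A (affine 1 h x)])))).
      apply: le_measure; rewrite ?inE//.
        by apply: measurableU => //; exact: measurableU.
      move=> h hh; have [h2|h2] := pselect (oball (origin : T) (rho / 2) h); first by left.
      by right; have [h3|h3] := pselect (A (affine 1 h x)); [right|left; split].
    apply: (le_trans (measureU2 _ _ _)) => //; first exact: measurableU.
    by rewrite leeD2l// measureU2.
  rewrite !lebn_ball ?divr_gt0//.
  have [->|Sy] := eqVneq (mu S) +oo%E; first by rewrite leey.
  have Sf : mu S \is a fin_num by rewrite ge0_fin_numE// lt_neqAle Sy leey.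
  have Af : mu A \is a fin_num by rewrite ge0_fin_numE//; exact: le_lt_trans hA (ltry _).
  move: hA; rewrite -(fineK Sf) -(fineK Af) -!EFinD !lee_fin.
  rewrite expr_div_n /v0.
  set V := vol1; set r := rho ^+ d; set a := fine (mu A); set s := fine (mu S).
  have rV : 0 < r * V by rewrite mulr_gt0 ?vol1_gt0// exprn_gt0.
  have h2 : r / 2 ^+ d * V <= r * V / 2.
    rewrite mulrAC ler_wpM2l ?(ltW rV)// lef_pV2 ?posrE ?exprn_gt0//.
    by rewrite -[leLHS]expr1 ler_eXn2l// ltr1n.
  lra.
have Sb : (\int[mu]_h ((w x ^+ 2)%:E * (\1_S h)%:E) = (w x ^+ 2)%:E * mu S)%E.
  rewrite integralZT ?sqr_ge0//; first by rewrite integral_indic// setIT.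
  exact/measurable_EFinP/measurable_indic.
rewrite muleC; apply: (@le_trans _ _ ((w x ^+ 2)%:E * mu S)%E).
  by apply: lee_wpmul2l => //; rewrite lee_fin sqr_ge0.
rewrite -Sb; apply: le_integralT.
- by move=> h; rewrite mule_ge0// lee_fin ?sqr_ge0.
- by apply: measurable_funeM; apply/measurable_EFinP; exact: measurable_indic.
- exact: (measurableT_comp mG (pair2_measurable x)).
move=> h; rewrite /G -!EFinM lee_fin !indicE.
have [/set_mem[h1 h2]|_] := boolP (h \in S); last by rewrite mulr0 mulr_ge0// sqr_ge0.
by rewrite mem_set// mul1r mulr1 (wA h2) subr0.
Qed.

Let Ibelow_le rho : (Ibelow rho <=
  \int[P]_p ((w p.1 - w p.2) ^+ 2 * (eucl p.2 p.1) `^ (- (d%:R + alpha)))%:E)%E.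
Proof.
pose G (p : T * T) : \bar R := ((w p.1 - w p.2) ^+ 2 * (eucl p.2 p.1) `^ (- (d%:R + alpha)))%:E.
have mG : measurable_fun setT G.
  apply/measurable_EFinP; apply: measurable_funM.
    apply: measurable_funX; apply: measurable_funB.
      exact: measurable_fst_comp.
    exact: measurable_snd_comp.
  by apply: (measurableT_comp (measurable_powR _)); exact: measurable_eucl.
have G0 p : (0 <= G p)%E by rewrite lee_fin mulr_ge0 ?sqr_ge0 ?powR_ge0.
rewrite -/(\int[P]_p G p)%E (@fubini_tonelli1 _ _ _ _ _ mu mu G)// /fubini_F.
pose H (p : T * T) : \bar R := G (p.2, affine 1 p.1 p.2).
have mH : measurable_fun setT H.
  apply: measurableT_comp mG _; apply: measurable_fun_pair => //.
have -> : (\int[mu]_x \int[mu]_y G (x, y) = \int[mu]_x \int[mu]_h H (h, x))%E.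
  apply: eq_integral => x _.
  rewrite (@integral_shift R d x (fun y => G (x, y)) (measurableT_comp mG (pair1_measurable x)) (fun y => G0 _)).
  apply: eq_integral => h _; congr (G (_, _)).
  exact: affine1C.
rewrite -(@fubini_tonelli _ _ _ _ _ mu mu H mH (fun p => G0 _)).
apply: le_integralT.
- by move=> h; exact: fI0.
- by apply: mfI; exact: measurable_oball.
- exact: (@measurable_fun_fubini_tonelli_F _ _ _ _ _ mu H mH (fun p => G0 _)).
move=> h; apply: (@le_trans _ _ ((N h)%:E * incr h)%E).
  apply: lee_wpmul2r; first exact: incr_ge0.
  by rewrite lee_fin ler_piMl// indicE lern1 leq_b1.
rewrite /incr -integralZT//; last by move=> x; rewrite lee_fin sqr_ge0.
rewrite le_eqVlt; apply/orP; left; apply/eqP; apply: eq_integral => x _.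
by rewrite /H /G/= affine1C eucl_shift -EFinM mulrC affine1C.
Qed.

Lemma fractional_faber_krahn rho : 0 < rho ->
  (mu A <= (vol1 (R := R) (d := d) / 4 * rho ^+ d)%:E)%E ->
  ((rho `^ (- alpha) * (vol1 (R := R) (d := d) / 4))%:E * \int[mu]_x (w x ^+ 2)%:E <=
   (2 - alpha)%:E * \int[P]_p ((w p.1 - w p.2) ^+ 2 * (eucl p.2 p.1) `^ (- (d%:R + alpha)))%:E)%E.
Proof.
move=> r0 hA; have a20 : 0 < 2 - alpha by rewrite subr_gt0.
have := Ibelow_le rho; set E := (\int[P]_p _)%E => IE.
have [->|Ey] := eqVneq E +oo%E; first by rewrite gt0_muley ?leey// lte_fin.
have Iy : (Ibelow rho < +oo)%E by apply: le_lt_trans IE _; rewrite lt_neqAle Ey leey.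
apply: (@le_trans _ _ ((2 - alpha)%:E * Ibelow rho)%E); last first.
  by apply: lee_wpmul2l => //; rewrite lee_fin ltW.
apply: le_trans (Iann_le r0 Iy); apply: le_trans (Iann_ge r0 hA).
apply: lee_wpmul2r; first by apply: integral_ge0 => x _; rewrite lee_fin sqr_ge0.
rewrite lee_fin le_eqVlt; apply/orP; left; apply/eqP.
rewrite opprD powRD; last by apply/implyP => _; rewrite gt_eqF.
rewrite !powRN powR_mulrn ?(ltW r0)//; field.
by rewrite !gt_eqF ?powR_gt0 ?exprn_gt0.
Qed.

End FaberKrahn.

(** * Transfer of the Faber-Krahn inequality to the kernel *)

Section KernelFaberKrahn.
Context {R : realType} {d : nat}.
Local Notation T := (pt R d).
Local Notation mu := (lebn (R := R) d).
Local Notation P := (mu \x mu)%E.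

Lemma Eform_integral (k : T -> T -> R) (U : set T) (u v : T -> R) :
  measurable_fun setT (fun p : T * T => k p.1 p.2) -> measurable U ->
  measurable_fun setT u -> measurable_fun setT v ->
  Eform k U u v = (\int[P]_p (\1_U p.1 * \1_U p.2 * Q k u v p)%:E)%E.
Proof.
move=> mk mU mu_ mv.
have m1 : measurable_fun setT (\1_U : T -> R) by exact: measurable_indic.
have e x y : \1_U x * \1_U y * ((u y - u x) * (v y - v x) * k x y) =
  \1_U x * \1_U y * Q k u v (x, y) by rewrite /Q/=; ring.
rewrite /Eform sint2E; first by apply: eq_integral => -[x y] _; rewrite e.
under eq_fun do rewrite e.
apply/measurable_EFinP.
rewrite (_ : (fun _ => _) = (fun p : T * T => \1_U p.1 * \1_U p.2 * Q k u v p)); last first.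
  by apply/funext => -[].
apply: measurable_funM; last exact: measurable_Q.
by apply: measurable_funM; [exact: measurable_fst_comp|exact: measurable_snd_comp].
Qed.

Lemma Eform_B (k : T -> T -> R) (u v : T -> R) :
  measurable_fun setT (fun p : T * T => k p.1 p.2) -> (forall x y, 0 <= k x y) ->
  finE mu k u -> finE mu k v -> Eform k setT u v = (B mu k u v)%:E.
Proof.
move=> mk k0 Eu Ev; rewrite Eform_integral//; [|by case: Eu|by case: Ev].
rewrite /B EFin_Rintegral; last exact: rintegrable_Q.
by apply: eq_integral => p _; rewrite !indicT !mul1r.
Qed.

Definition fracQ (alpha : R) (u : T -> R) (p : T * T) : R :=
  (u p.1 - u p.2) ^+ 2 * (eucl p.2 p.1) `^ (- (d%:R + alpha)).

Lemma fracQ_ge0 alpha u p : 0 <= fracQ alpha u p.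
Proof. by rewrite mulr_ge0 ?sqr_ge0 ?powR_ge0. Qed.

Lemma measurable_fracQ alpha u : measurable_fun setT u -> measurable_fun setT (fracQ alpha u).
Proof.
move=> mu_; apply: measurable_funM.
  apply: measurable_funX; apply: measurable_funB.
    exact: measurable_fst_comp.
  exact: measurable_snd_comp.
by apply: (measurableT_comp (measurable_powR _)); exact: measurable_eucl.
Qed.

Lemma measurable_indic2 (U : set T) : measurable U ->
  measurable_fun setT (fun p : T * T => \1_U p.1 * \1_U p.2 : R).
Proof.
move=> mU; have m1 : measurable_fun setT (\1_U : T -> R) by exact: measurable_indic.
by apply: measurable_funM; [exact: measurable_fst_comp|exact: measurable_snd_comp].
Qed.

Lemma E_ge_fractional (c_l alpha0 : R) : 0 < c_l -> 0 < alpha0 ->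
  exists2 c : R, 0 < c & forall (alpha : R) (k : T -> T -> R), alpha0 <= alpha -> alpha < 2 ->
    measurable_fun setT (fun p : T * T => k p.1 p.2) -> (forall x y, 0 <= k x y) ->
    E_ge alpha k c_l -> forall x0 r (u : T -> R), 0 < r -> L2on (oball x0 r) u ->
    ((c * (2 - alpha))%:E * \int[P]_p (\1_(oball x0 r) p.1 * \1_(oball x0 r) p.2 * fracQ alpha u p)%:E
     <= \int[P]_p (\1_(oball x0 r) p.1 * \1_(oball x0 r) p.2 * Q k u u p)%:E)%E.
Proof.
move=> cl0 a00; have [c c0 hc] := @kalpha_const_ge R d alpha0 a00.
exists (c_l * c); first exact: mulr_gt0.
move=> alpha k a1 a2 mk k0 hE x0 r u r0 Lu.
have mu_ : measurable_fun setT u by case: Lu.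
have mb : measurable (oball x0 r) by exact: measurable_oball.
have a20 : 0 <= 2 - alpha by lra.
have := hE x0 r r0 u Lu; rewrite (Eform_integral mk mb mu_ mu_) (Eform_integral (@measurable_kalpha R d alpha) mb mu_ mu_).
apply: le_trans.
have -> : c_l * c * (2 - alpha) = c_l * (c * (2 - alpha)) by ring.
rewrite EFinM -muleA; apply: lee_wpmul2l; first by rewrite lee_fin ltW.
have m2 := measurable_indic2 mb.
have i0 (p : T * T) : 0 <= \1_(oball x0 r) p.1 * \1_(oball x0 r) p.2 :> R by rewrite mulr_ge0.
have cc0 : 0 <= c * (2 - alpha) by rewrite mulr_ge0// ltW.
rewrite -integralZT//; last 2 first.
- by move=> p; rewrite lee_fin mulr_ge0// fracQ_ge0.
- by apply/measurable_EFinP; apply: measurable_funM => //; exact: measurable_fracQ.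
apply: le_integralT.
- by move=> p; rewrite mule_ge0// lee_fin// mulr_ge0// fracQ_ge0.
- apply: measurable_funeM.
  by apply/measurable_EFinP; apply: measurable_funM => //; exact: measurable_fracQ.
- apply/measurable_EFinP; apply: measurable_funM => //; apply: measurable_Q => //.
  exact: measurable_kalpha.
- move=> p; rewrite -EFinM lee_fin mulrCA ler_wpM2l// /Q /fracQ -expr2 mulrCA.
  by rewrite ler_wpM2l ?sqr_ge0//; exact: hc.
Qed.

(** [E_ge] compares forms on balls only, so the space is exhausted by the balls of radius n + 1 and
    Fatou recovers the fractional energy on R^d. The factors 2 - alpha of [E_ge_fractional] and
    [fractional_faber_krahn] cancel, which makes [cF] uniform in alpha. *)
Lemma faber_krahn (d0 : (0 < d)%N) (c_l alpha0 : R) : 0 < c_l -> 0 < alpha0 ->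
  exists2 cF : R, 0 < cF & forall (alpha : R) (k : T -> T -> R), alpha0 <= alpha -> alpha < 2 ->
    measurable_fun setT (fun p : T * T => k p.1 p.2) -> (forall x y, 0 <= k x y) ->
    E_ge alpha k c_l -> forall (w : T -> R) (A : set T) (rho : R), 0 < rho ->
    finE mu k w -> rintegrable mu (fun x => w x ^+ 2) -> measurable A ->
    (mu A <= (vol1 (R := R) (d := d) / 4 * rho ^+ d)%:E)%E ->
    (forall x, ~ A x -> w x = 0) ->
    cF * rho `^ (- alpha) * \int[mu]_x (w x ^+ 2) <= B mu k w w.
Proof.
move=> cl0 a00; have [c c0 hc] := E_ge_fractional cl0 a00.
have v0 : 0 < vol1 (R := R) (d := d) / 4 by rewrite divr_gt0// vol1_gt0.
exists (c * (vol1 (R := R) (d := d) / 4)); first exact: mulr_gt0.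
move=> alpha k a1 a2 mk k0 hE w A rho r0 Ew Lw mA hA wA.
have mw : measurable_fun setT w by case: Ew.
have ap : 0 < alpha by exact: lt_le_trans a1.
have a20 : 0 < 2 - alpha by lra.
have := @fractional_faber_krahn R d d0 w mw alpha ap a2 A mA wA rho r0 hA.
have Lw2 : (\int[mu]_x (w x ^+ 2)%:E < +oo)%E.
  apply/(rintegrable_ge0P _ (measurable_funX 2 mw)) => //.
  by move=> x; exact: sqr_ge0.
have L2n n : L2on (oball origin n.+1%:R) w.
  split=> //; rewrite iintE; last 2 first.
  - apply/measurable_EFinP; apply: measurable_funM; last exact: measurable_funX.
    by apply: measurable_indic; exact: measurable_oball.
  - by move=> x; rewrite lee_fin mulr_ge0// sqr_ge0.
  apply: le_lt_trans Lw2; apply: le_integralT.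
  - by move=> x; rewrite lee_fin mulr_ge0// sqr_ge0.
  - apply/measurable_EFinP; apply: measurable_funM; last exact: measurable_funX.
    by apply: measurable_indic; exact: measurable_oball.
  - by apply/measurable_EFinP; exact: measurable_funX.
  - by move=> x; rewrite lee_fin ler_piMl ?sqr_ge0// indicE lern1 leq_b1.
have mB n : measurable (oball (origin : T) n.+1%:R) by exact: measurable_oball.
have mn n := measurable_indic2 (mB n).
have i0 n (p : T * T) : 0 <= \1_(oball origin n.+1%:R) p.1 * \1_(oball origin n.+1%:R) p.2 :> R by rewrite mulr_ge0.
have i1 n (p : T * T) : \1_(oball origin n.+1%:R) p.1 * \1_(oball origin n.+1%:R) p.2 <= 1 :> R.
  by rewrite !indicE -natrM lern1; case: (_ \in _); case: (_ \in _).
have fE : (\int[P]_p (fracQ alpha w p)%:E <= (B mu k w w / (c * (2 - alpha)))%:E)%E.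
  apply: (@fatou_bound _ _ _ _ (fun n p => \1_(oball origin n.+1%:R) p.1 * \1_(oball origin n.+1%:R) p.2 * fracQ alpha w p)).
  - by move=> n; apply: measurable_funM => //; exact: measurable_fracQ.
  - by move=> n p; rewrite mulr_ge0// fracQ_ge0.
  - move=> p; apply: cvg_near_cst.
    exists (maxn (Num.Def.trunc (eucl origin p.1)) (Num.Def.trunc (eucl origin p.2))) => // n /=.
    rewrite geq_max => /andP[h1 h2].
    have hh q : (Num.Def.trunc (eucl origin q) <= n)%N -> oball (origin : T) n.+1%:R q.
      by move=> h; rewrite /oball/=; apply: (lt_le_trans (truncnS_gt _)); rewrite ler_nat.
    by rewrite !indicE !mem_set ?mul1r; [|exact: hh|exact: hh].
  - move=> n; have := hc alpha k a1 a2 mk k0 hE origin n.+1%:R w (ltr0Sn _ _) (L2n n).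
    have cc : 0 < c * (2 - alpha) by rewrite mulr_gt0.
    have h : (\int[P]_p (\1_(oball origin n.+1%:R) p.1 * \1_(oball origin n.+1%:R) p.2 * Q k w w p)%:E <= (B mu k w w)%:E)%E.
      rewrite /B EFin_Rintegral; last by case: Ew.
      apply: le_integralT.
      + by move=> p; rewrite lee_fin mulr_ge0// Quu_ge0.
      + by apply/measurable_EFinP; apply: measurable_funM => //; exact: measurable_Q.
      + by apply/measurable_EFinP; exact: measurable_Q.
      + by move=> p; rewrite lee_fin ler_piMl// Quu_ge0.
    move=> /le_trans /(_ h); set I := (\int[_]_p _)%E => h2.
    rewrite -(@lee_pmul2l _ (c * (2 - alpha))%:E)//.
    by rewrite -EFinM [_ * (B mu k w w / _)]mulrC divfK ?gt_eqF.
have Iw := EFin_Rintegral Lw; rewrite -Iw => h.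
have : (((rho `^ (- alpha) * (vol1 (R := R) (d := d) / 4)) * \int[mu]_x (w x ^+ 2))%:E <=
    ((2 - alpha) * (B mu k w w / (c * (2 - alpha))))%:E)%E.
  rewrite EFinM; apply: (le_trans h); rewrite [leRHS]EFinM; apply: lee_wpmul2l => //.
  by rewrite lee_fin ltW.
rewrite lee_fin.
have -> : (2 - alpha) * (B mu k w w / (c * (2 - alpha))) = B mu k w w / c.
  by field; rewrite !gt_eqF.
rewrite ler_pdivlMr//; apply: le_trans; rewrite le_eqVlt; apply/orP; left; apply/eqP; ring.
Qed.

End KernelFaberKrahn.

(** * De Giorgi iteration *)

Section Lipschitz.
Context {R : realType}.

Lemma max_lip (c a b : R) : `|Num.max c a - Num.max c b| <= `|a - b|.
Proof.
have := ler_norm (a - b); have := ler_norm (b - a); rewrite [`|b - a|]distrC.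
set n := `|a - b| => h1 h2; have n0 : 0 <= n by exact: normr_ge0.
by case: (leP c a) => ca; case: (leP c b) => cb; rewrite ler_norml; apply/andP; split; lra.
Qed.

Lemma min_lip (c a b : R) : `|Num.min c a - Num.min c b| <= `|a - b|.
Proof.
have := ler_norm (a - b); have := ler_norm (b - a); rewrite [`|b - a|]distrC.
set n := `|a - b| => h1 h2; have n0 : 0 <= n by exact: normr_ge0.
by case: (leP c a) => ca; case: (leP c b) => cb; rewrite ler_norml; apply/andP; split; lra.
Qed.

End Lipschitz.

(** * Cutoff functions and integrals of the kernel *)

Section Cutoff.
Context {R : realType} {d : nat}.
Local Notation T := (pt R d).
Implicit Types x y : T.

Definition cutoff (x0 : T) (s r : R) (x : T) : R :=
  Num.max 0 (Num.min 1 ((r - eucl x0 x) / (r - s))).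

Variables (x0 : T) (s r : R).
Hypothesis sr : s < r.
Local Notation tau := (cutoff x0 s r).

Let rs0 : 0 < r - s. Proof. by rewrite subr_gt0. Qed.

Lemma cutoff_ge0 x : 0 <= tau x. Proof. by rewrite /cutoff le_max lexx. Qed.

Lemma cutoff_le1 x : tau x <= 1.
Proof. by rewrite /cutoff ge_max ler01 ge_min lexx. Qed.

Lemma cutoff1 x : eucl x0 x <= s -> tau x = 1.
Proof.
move=> h; rewrite /cutoff min_l ?max_r// ler_pdivlMr// mul1r.
by rewrite lerD2l lerN2.
Qed.

Lemma cutoff0 x : ~ oball x0 r x -> tau x = 0.
Proof.
rewrite /oball/= => /negP; rewrite -leNgt => h.
by rewrite /cutoff max_l// ge_min ler_pdivrMr// mul0r subr_le0 h orbT.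
Qed.

Lemma cutoff_lip x y : `|tau x - tau y| <= (r - s)^-1 * eucl x y.
Proof.
apply: le_trans (max_lip _ _ _) _; apply: le_trans (min_lip _ _ _) _.
rewrite -mulrBl normrM mulrC (ger0_norm (_ : 0 <= (r - s)^-1)) ?invr_ge0 ?(ltW rs0)//.
rewrite ler_wpM2l ?invr_ge0 ?(ltW rs0)//.
rewrite (_ : _ - _ = eucl x0 y - eucl x0 x); last by ring.
have := eucl_triangle x x0 y; have := eucl_triangle y x0 x; rewrite [eucl y x]eucl_sym => h1 h2.
by rewrite ler_norml; apply/andP; split; lra.
Qed.

Lemma cutoff_lip1 x y : `|tau x - tau y| <= 1.
Proof.
have := cutoff_ge0 x; have := cutoff_ge0 y; have := cutoff_le1 x; have := cutoff_le1 y => *.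
by rewrite ler_norml; apply/andP; split; lra.
Qed.

(** The right-hand side has the shape of the integrand of [U1] at radius r - s, so that integrating
    it against [k] gives a bound of order (r - s)^(-alpha). *)
Lemma cutoff_sqr_le x y :
  (tau x - tau y) ^+ 2 <= (r - s)^-1 ^+ 2 * Num.min ((r - s) ^+ 2) (eucl x y ^+ 2).
Proof.
rewrite -(real_normK (num_real (tau x - tau y))).
rewrite /Num.min; case: ltP => _.
  rewrite -exprMn mulVf ?gt_eqF// expr1n.
  by rewrite expr_le1 ?cutoff_lip1.
by rewrite -exprMn ler_sqr ?nnegrE ?cutoff_lip// mulr_ge0 ?eucl_ge0// invr_ge0 ltW.
Qed.

Lemma measurable_cutoff : measurable_fun setT tau.
Proof.
apply: measurable_maxr => //; apply: measurable_minr => //.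
apply: measurable_funM => //; apply: measurable_funB => //.
exact: measurable_eucl.
Qed.

End Cutoff.

Section KernelBounds.
Context {R : realType} {d : nat}.
Local Notation T := (pt R d).
Local Notation mu := (lebn (R := R) d).
Local Notation P := (mu \x mu)%E.
Variables (k : T -> T -> R) (alpha cU : R).
Hypothesis mk : measurable_fun setT (fun p : T * T => k p.1 p.2).
Hypothesis k0 : forall x y, 0 <= k x y.
Hypothesis ksym : forall x y, k x y = k y x.
Hypothesis cU0 : 0 < cU.
Hypothesis hU1 : U1 alpha k cU.

Local Notation finE := (finE mu k).
Local Notation B := (B mu k).
Local Notation HO := (HO mu k).

Lemma kernel_section_le (g : T -> T -> R) (L : R) (rho : R) : 0 < rho -> 0 <= L ->
  measurable_fun setT (fun p : T * T => g p.1 p.2) ->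
  (forall x y, 0 <= g x y) -> (forall x y, g x y <= L * Num.min (rho ^+ 2) (eucl y x ^+ 2)) ->
  forall x, (\int[mu]_y (g x y * k x y)%:E <= (L * (cU * rho `^ (2 - alpha)))%:E)%E.
Proof.
move=> r0 L0 mg g0 hg x.
have mk1 : measurable_fun setT (fun y => k x y) := measurableT_comp mk (pair1_measurable x).
have mg1 : measurable_fun setT (fun y => g x y) := measurableT_comp mg (pair1_measurable x).
have mm : measurable_fun setT (fun y => Num.min (rho ^+ 2) (eucl y x ^+ 2)).
  by apply: measurable_minr => //; apply: measurable_funX; exact: measurable_eucl.
have m0 y : 0 <= Num.min (rho ^+ 2) (eucl y x ^+ 2) by rewrite le_min !sqr_ge0.
have := hU1 r0 x; rewrite iintE; last 2 first.
- by apply/measurable_EFinP; exact: measurable_funM.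
- by move=> y; rewrite lee_fin mulr_ge0.
move=> h; apply: (@le_trans _ _ (\int[mu]_y (L%:E * (Num.min (rho ^+ 2) (eucl y x ^+ 2) * k x y)%:E)))%E.
  apply: le_integralT.
  - by move=> y; rewrite lee_fin mulr_ge0.
  - by apply/measurable_EFinP; exact: measurable_funM.
  - by apply: measurable_funeM; apply/measurable_EFinP; exact: measurable_funM.
  - by move=> y; rewrite -EFinM lee_fin mulrA ler_wpM2r.
rewrite integralZT//.
- by rewrite EFinM; apply: lee_wpmul2l => //; rewrite lee_fin.
- by move=> y; rewrite lee_fin mulr_ge0.
- by apply/measurable_EFinP; exact: measurable_funM.
Qed.

Lemma weighted_kernel_le (g : T -> T -> R) (C : R) (f : T -> R) :
  measurable_fun setT (fun p : T * T => g p.1 p.2) -> (forall x y, 0 <= g x y) ->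
  (forall x, (\int[mu]_y (g x y * k x y)%:E <= C%:E)%E) ->
  (forall x, 0 <= f x) -> rintegrable mu f ->
  rintegrable P (fun p => f p.1 * (g p.1 p.2 * k p.1 p.2)) /\
  \int[P]_p (f p.1 * (g p.1 p.2 * k p.1 p.2)) <= C * \int[mu]_x f x.
Proof.
move=> mg g0 hC f0 If; have mf := rintegrable_measurable If.
have mfg : measurable_fun setT (fun p : T * T => f p.1 * (g p.1 p.2 * k p.1 p.2)).
  apply: measurable_funM; first exact: measurable_fst_comp.
  exact: measurable_funM.
have fg0 p : 0 <= f p.1 * (g p.1 p.2 * k p.1 p.2) by rewrite !mulr_ge0.
have C0 : 0 <= C.
  rewrite -lee_fin; apply: le_trans (hC (@origin R d)); apply: integral_ge0 => y _.
  by rewrite lee_fin mulr_ge0.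
apply: Rintegral_le_fin => //.
pose F (p : T * T) : \bar R := (f p.1 * (g p.1 p.2 * k p.1 p.2))%:E.
have mF : measurable_fun setT F by exact/measurable_EFinP.
have F0 p : (0 <= F p)%E by rewrite lee_fin.
rewrite (@fubini_tonelli1 _ _ _ _ _ mu mu F mF F0) /fubini_F.
rewrite EFinM EFin_Rintegral//.
have mgk x : measurable_fun setT (fun y => (g x y * k x y)%:E).
  have mgk2 : measurable_fun setT (fun p : T * T => g p.1 p.2 * k p.1 p.2) by exact: measurable_funM.
  by apply/measurable_EFinP; exact: (measurableT_comp mgk2 (pair1_measurable x)).
have gk0 x y : (0 <= (g x y * k x y)%:E)%E by rewrite lee_fin mulr_ge0.
rewrite -(@integralZT _ _ _ mu C (fun x => (f x)%:E))//; last exact/measurable_EFinP.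
apply: le_integralT.
- by move=> x; apply: integral_ge0 => y _; exact: F0.
- exact: (@measurable_fun_fubini_tonelli_F _ _ _ _ _ mu F mF F0).
- by apply: measurable_funeM; exact/measurable_EFinP.
- move=> x; rewrite (_ : (\int[mu]_y F (x, y))%E = ((f x)%:E * \int[mu]_y (g x y * k x y)%:E)%E).
    by rewrite muleC; apply: lee_wpmul2r => //; rewrite lee_fin.
  by rewrite -(integralZT mu (f0 x) (gk0 x) (mgk x)).
Qed.

Lemma swap_kernel (g : T -> T -> R) (f : T -> R) :
  (forall x y, g x y = g y x) ->
  measurable_fun setT (fun p : T * T => g p.1 p.2) -> (forall x y, 0 <= g x y) ->
  measurable_fun setT f -> (forall x, 0 <= f x) ->
  rintegrable P (fun p => f p.1 * (g p.1 p.2 * k p.1 p.2)) ->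
  rintegrable P (fun p => f p.2 * (g p.1 p.2 * k p.1 p.2)) /\
  \int[P]_p (f p.2 * (g p.1 p.2 * k p.1 p.2)) = \int[P]_p (f p.1 * (g p.1 p.2 * k p.1 p.2)).
Proof.
move=> gs mg g0 mf f0 I1.
have m1 : measurable_fun setT (fun p : T * T => f p.1 * (g p.1 p.2 * k p.1 p.2)).
  exact: rintegrable_measurable I1.
have m2 : measurable_fun setT (fun p : T * T => f p.2 * (g p.1 p.2 * k p.1 p.2)).
  apply: measurable_funM; first exact: measurable_snd_comp.
  exact: measurable_funM.
have p1 (p : T * T) : 0 <= f p.1 * (g p.1 p.2 * k p.1 p.2) by rewrite !mulr_ge0.
have p2 (p : T * T) : 0 <= f p.2 * (g p.1 p.2 * k p.1 p.2) by rewrite !mulr_ge0.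
have e : (\int[P]_p (f p.2 * (g p.1 p.2 * k p.1 p.2))%:E = \int[P]_p (f p.1 * (g p.1 p.2 * k p.1 p.2))%:E)%E.
  rewrite [RHS]prod_swap; last 2 first.
  - exact/measurable_EFinP.
  - by move=> p; rewrite lee_fin.
  by apply: eq_integral => -[x y] _ /=; rewrite gs ksym.
split; last by rewrite /Rintegral e.
by apply/rintegrable_ge0P => //; rewrite e; apply/rintegrable_ge0P.
Qed.

Section CutoffEnergy.
Variables (x0 : T) (s r : R).
Hypothesis sr : s < r.
Local Notation tau := (cutoff x0 s r).
Let g x y := (tau x - tau y) ^+ 2.

Let mg : measurable_fun setT (fun p : T * T => g p.1 p.2).
Proof.
have mt := @measurable_cutoff R d x0 s r.
apply: measurable_funX; apply: measurable_funB.
  exact: measurable_fst_comp.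
exact: measurable_snd_comp.
Qed.

Let g0 x y : 0 <= g x y. Proof. exact: sqr_ge0. Qed.

Let gs x y : g x y = g y x. Proof. by rewrite /g -sqrrN opprB. Qed.

Let rs0 : 0 < r - s. Proof. by rewrite subr_gt0. Qed.

Lemma cutoff_kernel_le x :
  (\int[mu]_y (g x y * k x y)%:E <= (cU * (r - s) `^ (- alpha))%:E)%E.
Proof.
have L0 : 0 <= (r - s)^-1 ^+ 2 by rewrite exprn_ge0// invr_ge0 ltW.
have := kernel_section_le rs0 L0 mg g0 _ x.
rewrite (_ : _ * (cU * _) = cU * (r - s) `^ (- alpha)); last first.
  rewrite powRB; last by apply/implyP => _; rewrite gt_eqF.
  rewrite powR_mulrn ?(ltW rs0)// powRN; field.
  by rewrite !gt_eqF ?powR_gt0.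
by apply => a b; rewrite [eucl b a]eucl_sym; exact: cutoff_sqr_le.
Qed.

Lemma cutoff_weighted (f : T -> R) : (forall x, 0 <= f x) -> rintegrable mu f ->
  rintegrable P (fun p => (f p.1 + f p.2) * (g p.1 p.2 * k p.1 p.2)) /\
  \int[P]_p ((f p.1 + f p.2) * (g p.1 p.2 * k p.1 p.2)) <=
    2 * (cU * (r - s) `^ (- alpha)) * \int[mu]_x f x.
Proof.
move=> f0 If.
have [I1 h1] := weighted_kernel_le mg g0 cutoff_kernel_le f0 If.
have [I2 h2] := swap_kernel gs mg g0 (rintegrable_measurable If) f0 I1.
rewrite (_ : (fun p => _) = (fun p => f p.1 * (g p.1 p.2 * k p.1 p.2) + f p.2 * (g p.1 p.2 * k p.1 p.2))); last first.
  by apply/funext => p; rewrite mulrDl.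
split; first exact: rintegrableD.
rewrite RintegralD// h2; lra.
Qed.

Lemma ball_indic_integrable : rintegrable mu (\1_(oball x0 r) : T -> R).
Proof.
by apply: rintegrable_indic; [exact: measurable_oball|exact: lebn_ball_lty].
Qed.

Lemma finE_cutoff : finE tau /\
  B tau tau <= 2 * (cU * (r - s) `^ (- alpha)) * \int[mu]_x \1_(oball x0 r) x.
Proof.
have i0 (x : T) : 0 <= \1_(oball x0 r) x :> R by [].
have [I1 h1] := cutoff_weighted i0 ball_indic_integrable.
have mt := @measurable_cutoff R d x0 s r.
have hQ p : Q k tau tau p <= (\1_(oball x0 r) p.1 + \1_(oball x0 r) p.2) * (g p.1 p.2 * k p.1 p.2).
  rewrite /Q -expr2 -/(g _ _).
  have [h|h] := pselect (oball x0 r p.1 \/ oball x0 r p.2).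
    have gk0 : 0 <= g p.1 p.2 * k p.1 p.2 by exact: mulr_ge0.
    rewrite -[leLHS]mul1r; apply: ler_wpM2r => //.
    by rewrite !indicE; case: h => h; rewrite (mem_set h)// ?lerDl ?lerDr.
  rewrite /g !cutoff0 ?subrr ?expr0n/= ?mulr0 ?mul0r ?mulr0//.
    by move=> h1'; apply: h; right.
  by move=> h1'; apply: h; left.
have IQ : rintegrable P (Q k tau tau).
  apply: (@rintegrable_le _ _ _ _ (fun p => (\1_(oball x0 r) p.1 + \1_(oball x0 r) p.2) * (g p.1 p.2 * k p.1 p.2))) => //.
    exact: measurable_Q.
  by move=> p; rewrite ger0_norm ?Quu_ge0.
split; first by split.
by apply: le_trans h1; apply: Rintegral_le.
Qed.

End CutoffEnergy.

End KernelBounds.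

Lemma geometric_bound_le0 (R : realType) (x c q : R) : 0 < q < 1 -> (forall n : nat, x <= c * q ^+ n) -> x <= 0.
Proof.
move=> /andP[q0 q1] h; have hc : (c * q ^+ n) @[n --> \oo] --> c * 0.
  by apply: cvgM; [exact: cvg_cst|apply: cvg_expr; rewrite ger0_norm ?ltW].
by rewrite mulr0 in hc; apply: (cvgr_to_ge hc); exact: nearW.
Qed.

(* [q `^ beta = 16^-1] compensates the two factors [4 ^ j] lost at step [j] of the
   iteration, from the levels and from the radii. *)
Lemma de_giorgi_constants (R : realType) (beta C : R) : 0 < beta -> 0 < C ->
  exists m q : R, [/\ 0 < m <= 1, 0 < q < 1, q `^ beta = 16^-1 & C * m `^ beta <= q].
Proof.
move=> b0 C0; pose q : R := 16 `^ (- beta^-1).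
have q0 : 0 < q by exact: powR_gt0.
have q1 : q < 1.
  rewrite /q powRN invf_lt1 ?powR_gt0//.
  have : (1 : R) `^ beta^-1 < 16 `^ beta^-1 by rewrite gt0_ltr_powR ?invr_gt0 ?nnegrE ?ltr1n.
  by rewrite powR1.
have qb : q `^ beta = 16^-1 by rewrite /q -powRrM mulNr mulVf ?gt_eqF// powR_inv1.
pose m0 := (q / C) `^ beta^-1.
have m00 : 0 < m0 by rewrite powR_gt0 ?divr_gt0.
exists (Num.min 1 m0), q; split; [|by rewrite q0|by []|].
  by rewrite lt_min ltr01 m00 ge_min lexx.
rewrite mulrC -ler_pdivlMr//.
apply: (@le_trans _ _ (m0 `^ beta)).
  by rewrite ge0_ler_powR ?nnegrE ?(ltW b0) ?(ltW m00)// ?le_min ?ler01 ?(ltW m00)// ge_min lexx orbT.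
by rewrite /m0 -powRrM mulVf ?gt_eqF// powRr1// divr_ge0// ltW.
Qed.

Section DeGiorgi.
Context {R : realType} {d : nat}.
Local Notation T := (pt R d).
Local Notation mu := (lebn (R := R) d).
Local Notation P := (mu \x mu)%E.
Variables (k : T -> T -> R) (alpha cU : R).
Hypothesis mk : measurable_fun setT (fun p : T * T => k p.1 p.2).
Hypothesis k0 : forall x y, 0 <= k x y.
Hypothesis ksym : forall x y, k x y = k y x.
Hypothesis cU0 : 0 < cU.
Hypothesis hU1 : U1 alpha k cU.

Local Notation finE := (finE mu k).
Local Notation B := (B mu k).
Local Notation HO := (HO mu k).

(** The weak form of L U >= K on [A], with L the operator of the form. [K] takes both signs: 1 for
    the potential of a ball inside that ball, negative for sources that are merely bounded. *)
Definition supersol (A : set T) (K : R) (U : T -> R) :=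
  forall v, HO A v -> (forall x, 0 <= v x) -> K * \int[mu]_x v x <= B U v.

Lemma bounded_ball_integrable (x0 : T) (r M : R) (f : T -> R) : measurable_fun setT f ->
  (forall x, `|f x| <= M) -> (forall x, ~ oball x0 r x -> f x = 0) ->
  rintegrable mu f.
Proof.
move=> mf fM f0.
apply: (@rintegrable_le _ _ _ _ (fun x => M * \1_(oball x0 r) x)) => //.
  by apply: rintegrableZ; exact: ball_indic_integrable.
move=> x; rewrite indicE; have [h|h] := boolP (x \in oball x0 r); first by rewrite mulr1.
by rewrite f0 ?normr0 ?mulr0// => h'; move/negP : h; apply; exact: mem_set.
Qed.

Lemma bounded_ball_HO (x0 : T) (r M : R) (f : T -> R) : finE f ->
  (forall x, `|f x| <= M) -> (forall x, ~ oball x0 r x -> f x = 0) ->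
  HO (oball x0 r) f.
Proof.
move=> Ef fM f0; split=> //.
apply: (@bounded_ball_integrable x0 r (M ^+ 2)).
- by apply: measurable_funX; case: Ef.
- move=> x; rewrite normrX ler_sqr ?nnegrE//.
  exact: le_trans (fM x).
- by move=> x h; rewrite f0// expr0n.
Qed.

Section Caccioppoli.
Variables (x0 : T) (s r l K : R) (U : T -> R).
Hypotheses (sr : s < r) (l0 : 0 <= l) (EU : finE U) (U0 : forall x, 0 <= U x).
Hypothesis hU : supersol (oball x0 r) K U.
Local Notation tau := (cutoff x0 s r).
Let w x := Num.max 0 (l - U x).

Let mU : measurable_fun setT U. Proof. by case: EU. Qed.
Let w0 x : 0 <= w x. Proof. by rewrite /w le_max lexx. Qed.
Let wl x : w x <= l. Proof. by rewrite /w ge_max l0 gerBl U0. Qed.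
Let mw : measurable_fun setT w.
Proof. by apply: measurable_maxr => //; exact: measurable_funB. Qed.

Let Ew : finE w.
Proof.
apply: (@finE_dom1 _ _ _ _ _ mk k0 1 U) => // x y.
rewrite mul1r; apply: le_trans (max_lip _ _ _) _.
by rewrite (_ : _ - _ = U y - U x) 1?distrC//; ring.
Qed.

Let Et : finE tau. Proof. by have [] := finE_cutoff mk k0 ksym hU1 x0 sr. Qed.

Let tn x : `|tau x| <= 1.
Proof. by rewrite ger0_norm ?cutoff_ge0 ?cutoff_le1. Qed.

Let Etw : finE (fun x => tau x * w x).
Proof.
apply: (@finE_mul _ _ _ _ _ mk k0 (1 + l)) => // x.
  by apply: le_trans (tn x) _; rewrite lerDl.
by rewrite ger0_norm//; have := wl x; lra.
Qed.

Let twl x : `|tau x * w x| <= l.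
Proof.
by rewrite normrM -[leRHS]mul1r (ger0_norm (w0 x)); apply: ler_pM => //; exact: w0.
Qed.

Lemma caccioppoli_HO : HO (oball x0 r) (fun x => tau x * w x).
Proof.
apply: (@bounded_ball_HO _ _ l) => // x h.
by rewrite cutoff0 ?mul0r.
Qed.

Let v x := tau x * (tau x * w x).

Let Ev : finE v.
Proof.
apply: (@finE_mul _ _ _ _ _ mk k0 (1 + l)) => // x.
  by apply: le_trans (tn x) _; rewrite lerDl.
by apply: le_trans (twl x) _; rewrite lerDr.
Qed.

Let Hv : HO (oball x0 r) v.
Proof.
apply: (@bounded_ball_HO _ _ l) => // x.
  by rewrite /v normrM -[leRHS]mul1r; apply: ler_pM.
by move=> h; rewrite /v cutoff0 ?mul0r.
Qed.

(** The test function is tau^2 w, with w the positive part of l - U. As U is nonnegative on the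
    whole space, 0 <= w <= l everywhere, so the product w(x) w(y) in the cutoff term is at most l
    times the value of w at a point of the ball: long jumps are covered without a separate tail
    term. The source term stays on the left, where a positive [K] is useful. *)
Lemma caccioppoli :
  B (fun x => tau x * w x) (fun x => tau x * w x) + K * \int[mu]_x (tau x * (tau x * w x)) <=
  2 * l * (cU * (r - s) `^ (- alpha)) * \int[mu]_x (\1_(oball x0 r) x * w x).
Proof.
have v0 x : 0 <= v x by rewrite /v !mulr_ge0 ?cutoff_ge0.
have := hU Hv v0; rewrite -/(v _).
pose f x : R := \1_(oball x0 r) x * w x.
have mI : measurable_fun setT (\1_(oball x0 r) : T -> R).
  by apply: measurable_indic; exact: measurable_oball.
have f0 x : 0 <= f x by rewrite mulr_ge0.
have If : rintegrable mu f.
  apply: (@bounded_ball_integrable x0 r l); first exact: measurable_funM.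
    by move=> x; rewrite ger0_norm// -[leRHS]mul1r ler_pM// indicE lern1 leq_b1.
  by move=> x h; rewrite /f indicE memNset ?mul0r.
have [IF hF] := cutoff_weighted mk k0 ksym hU1 x0 sr f0 If.
set F := (fun p : T * T => _) in IF hF.
have : B U v <= \int[P]_p (l * F p + (-1) * Q k (fun x => tau x * w x) (fun x => tau x * w x) p).
  apply: B_le => //.
    by apply: rintegrableD; apply: rintegrableZ => //; exact: rintegrable_Q.
  move=> p; rewrite /Q /F /v.
  set a := U p.1; set b := U p.2; set s' := tau p.1; set t := tau p.2.
  (* Equality holds when both values are at most l; if only one is, the other value is replaced by
     l. *)
  have key : (a - b) * (s' * (s' * w p.1) - t * (t * w p.2)) <=
     w p.1 * w p.2 * (s' - t) ^+ 2 - (s' * w p.1 - t * w p.2) * (s' * w p.1 - t * w p.2).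
    rewrite /w -/a -/b; case: (leP 0 (l - a)) => la; case: (leP 0 (l - b)) => lb.
    - by rewrite le_eqVlt; apply/orP; left; apply/eqP; ring.
    - have h1 : (l - a) * (a - l) <= (l - a) * 0 by rewrite ler_wpM2l//; lra.
      have h2 : (l - a) * (a - b) <= (l - a) * (a - l) by rewrite ler_wpM2l//; lra.
      have := ler_wpM2l (sqr_ge0 s') h2; lra.
    - have h2 : (l - b) * (b - a) <= (l - b) * (b - l) by rewrite ler_wpM2l//; lra.
      have := ler_wpM2l (sqr_ge0 t) h2; lra.
    - by rewrite !mulr0 !mul0r subrr mulr0 mul0r subr0.
  (* If [tau] differs at the two points, one of them lies in the ball; [w] is bounded by [l] at the
     other. *)
  have key2 : w p.1 * w p.2 * (s' - t) ^+ 2 <= l * ((f p.1 + f p.2) * (s' - t) ^+ 2).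
    rewrite mulrA.
    have [h|h] := pselect (oball x0 r p.1).
      rewrite ler_wpM2r ?sqr_ge0// mulrC; apply: ler_pM => //.
      by rewrite {1}/f indicE (mem_set h) mul1r lerDl.
    have [h'|h'] := pselect (oball x0 r p.2).
      rewrite ler_wpM2r ?sqr_ge0//; apply: ler_pM => //.
      by rewrite {2}/f indicE (mem_set h') mul1r lerDr.
    by rewrite /s' /t !cutoff0// subrr expr0n/= !mulr0.
  have := ler_wpM2r (k0 p.1 p.2) (le_trans key (lerB key2 (lexx _))); lra.
rewrite (Rintegral_lin _ _ IF (rintegrable_Q mk k0 Etw Etw)) -/(B _ _).
move=> h1 h2; have h3 := ler_wpM2l l0 hF.
rewrite -/(v _); lra.
Qed.

End Caccioppoli.
Section Iteration.
Hypothesis d0 : (0 < d)%N.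
Variables (alpha0 cF : R).
Hypotheses (alpha00 : 0 < alpha0) (alpha1 : alpha0 <= alpha) (alpha2 : alpha < 2).
Hypothesis cF0 : 0 < cF.
Let v0 : R := vol1 (R := R) (d := d) / 4.
Hypothesis FK : forall (w : T -> R) (A : set T) (rho : R), 0 < rho ->
    finE w -> rintegrable mu (fun x => w x ^+ 2) -> measurable A ->
    (mu A <= (v0 * rho ^+ d)%:E)%E ->
    (forall x, ~ A x -> w x = 0) ->
    cF * rho `^ (- alpha) * \int[mu]_x (w x ^+ 2) <= B w w.

Let beta : R := alpha0 / d%:R.

Let v00 : 0 < v0. Proof. by rewrite /v0 divr_gt0// vol1_gt0. Qed.

(** The scale rho = r m^(1/d) satisfies rho^d = m r^d. As m <= 1 and beta = alpha0/d <= alpha/d, the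
    gain m^(-alpha/d) is at least m^(-beta), whose exponent is free of alpha. *)
Lemma faber_krahn_relative (w : T -> R) (A : set T) (r m : R) : 0 < r -> 0 < m -> m <= 1 ->
    finE w -> rintegrable mu (fun x => w x ^+ 2) -> measurable A ->
    (mu A <= (v0 * (m * r ^+ d))%:E)%E ->
    (forall x, ~ A x -> w x = 0) ->
    cF * r `^ (- alpha) * m `^ (- beta) * \int[mu]_x (w x ^+ 2) <= B w w.
Proof.
move=> r0 m0 m1 Ew Lw mA hA wA.
have dR : 0 < (d%:R : R) by rewrite ltr0n.
pose rho := r * m `^ (d%:R^-1).
have mp : 0 < m `^ (d%:R^-1) by exact: powR_gt0.
have rho0 : 0 < rho by rewrite mulr_gt0.
have erho : rho ^+ d = m * r ^+ d.
  rewrite /rho exprMn mulrC -[(m `^ _) ^+ d]powR_mulrn ?(ltW mp)// -powRrM mulVf ?gt_eqF//.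
  by rewrite powRr1 ?ltW.
rewrite -erho in hA; apply: le_trans (FK rho0 Ew Lw mA hA wA).
apply: ler_wpM2r; first by apply: Rintegral_ge0 => x _; exact: sqr_ge0.
rewrite -mulrA; apply: ler_wpM2l; first exact: ltW.
rewrite /rho powRM ?(ltW r0) ?(ltW mp)//; apply: ler_wpM2l; first exact: powR_ge0.
rewrite -powRrM; apply: ger_powR; first by rewrite m0 m1.
by rewrite mulrN lerN2 mulrC /beta ler_wpM2r// invr_ge0 ltW.
Qed.

Let lev (U : T -> R) (x0 : T) (l r : R) : set T := [set x | U x < l] `&` oball x0 r.

Lemma measurable_lev U x0 l r : measurable_fun setT U -> measurable (lev U x0 l r).
Proof.
move=> mU; apply: measurableI; last exact: measurable_oball.
rewrite -[X in measurable X]setTI; exact: measurable_fun_ltr.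
Qed.

Lemma lev_lty U x0 l r : measurable_fun setT U -> (mu (lev U x0 l r) < +oo)%E.
Proof.
move=> mU; apply: le_lt_trans (lebn_ball_lty x0 r); apply: le_measure; rewrite ?inE.
- exact: measurable_lev.
- exact: measurable_oball.
- by move=> x [].
Qed.

(** Faber-Krahn bounds the L^2 norm of tau w, supported in the larger sublevel set, by its energy;
    Caccioppoli bounds the energy by the measure of that same set; and tau w >= l1 - l2 on the
    smaller sublevel set. *)
Lemma de_giorgi_step (U : T -> R) (x0 : T) (K r m l1 l2 r1 r2 : R) :
  finE U -> (forall x, 0 <= U x) -> 0 <= K -> 0 < r -> 0 < m -> m <= 1 ->
  0 <= l2 -> l2 < l1 -> r2 < r1 ->
  supersol (oball x0 r1) (- K) U ->
  (mu (lev U x0 l1 r1) <= (v0 * (m * r ^+ d))%:E)%E ->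
  cF * r `^ (- alpha) * m `^ (- beta) * ((l1 - l2) ^+ 2 * fine (mu (lev U x0 l2 r2))) <=
   (K * l1 + 2 * l1 ^+ 2 * (cU * (r1 - r2) `^ (- alpha))) * (v0 * (m * r ^+ d)).
Proof.
move=> EU U0 K0 r0 m0 m1 l20 l12 r21 hU hX.
have mU : measurable_fun setT U by case: EU.
have l10 : 0 <= l1 by lra.
have mA1 := measurable_lev x0 l1 r1 mU.
have mA2 := measurable_lev x0 l2 r2 mU.
have cac := @caccioppoli x0 r2 r1 l1 (- K) U r21 l10 EU U0 hU.
have Htw := @caccioppoli_HO x0 r2 r1 l1 U r21 l10 EU U0.
pose w x := Num.max 0 (l1 - U x); pose t := cutoff x0 r2 r1.
have mw : measurable_fun setT w by apply: measurable_maxr => //; exact: measurable_funB.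
have mt : measurable_fun setT t by exact: measurable_cutoff.
have mI (A : set T) : measurable A -> measurable_fun setT (\1_A : T -> R) by exact: measurable_indic.
have w0 x : 0 <= w x by rewrite /w le_max lexx.
have wl x : w x <= l1 by rewrite /w ge_max l10 gerBl U0.
have tw x : ~ lev U x0 l1 r1 x -> t x * w x = 0 /\ \1_(oball x0 r1) x * w x = 0.
  move=> h; have [hb|hb] := pselect (oball x0 r1 x); last first.
    by rewrite /t cutoff0// indicE memNset// !mul0r.
  have lU : l1 <= U x by rewrite leNgt; apply/negP => hl; apply: h.
  by rewrite /w max_l ?mulr0// subr_le0.
have t0 x : 0 <= t x by exact: cutoff_ge0.
have t1 x : t x <= 1 by apply: cutoff_le1.
have IA1 : rintegrable mu (\1_(lev U x0 l1 r1) : T -> R).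
  by apply: rintegrable_indic => //; exact: lev_lty.
have X0 : \int[mu]_x (\1_(lev U x0 l1 r1) x) <= v0 * (m * r ^+ d).
  by rewrite -lee_fin EFin_Rintegral// integral_indic// setIT.
have i1 : \int[mu]_x (\1_(oball x0 r1) x * w x) <= l1 * (v0 * (m * r ^+ d)).
  apply: le_trans (ler_wpM2l l10 X0); rewrite -RintegralZl//.
  apply: Rintegral_le.
  - apply: (@bounded_ball_integrable x0 r1 l1).
    + by apply: measurable_funM => //; apply: mI; exact: measurable_oball.
    + by move=> x; rewrite ger0_norm ?mulr_ge0// -[leRHS]mul1r ler_pM// indicE lern1 leq_b1.
    + by move=> x h; rewrite indicE memNset ?mul0r.
  - exact: rintegrableZ.
  - move=> x; have [h|h] := pselect (lev U x0 l1 r1 x).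
      by rewrite [X in _ <= _ * X]indicE mem_set// mulr1 -[leRHS]mul1r ler_pM// indicE lern1 leq_b1.
    by have [_ ->] := tw x h; rewrite mulr_ge0.
have i2 : \int[mu]_x (t x * (t x * w x)) <= l1 * (v0 * (m * r ^+ d)).
  apply: le_trans (ler_wpM2l l10 X0); rewrite -RintegralZl//.
  apply: Rintegral_le.
  - apply: (@bounded_ball_integrable x0 r1 l1).
    + by apply: measurable_funM => //; exact: measurable_funM.
    + move=> x; rewrite ger0_norm ?mulr_ge0// -[leRHS]mul1r ler_pM ?mulr_ge0//.
      by rewrite -[leRHS]mul1r ler_pM.
    + by move=> x h; rewrite /t cutoff0 ?mul0r.
  - exact: rintegrableZ.
  - move=> x; have [h|h] := pselect (lev U x0 l1 r1 x).
      rewrite indicE mem_set// mulr1 -[leRHS]mul1r ler_pM ?mulr_ge0//.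
      by rewrite -[leRHS]mul1r ler_pM.
    by have [-> _] := tw x h; rewrite mulr0 mulr_ge0.
have Ltw : rintegrable mu (fun x => (t x * w x) ^+ 2) by case: Htw.
have fk := faber_krahn_relative r0 m0 m1 (HO_finE Htw) Ltw mA1 hX (fun x h => (tw x h).1).
have i3 : (l1 - l2) ^+ 2 * fine (mu (lev U x0 l2 r2)) <= \int[mu]_x ((t x * w x) ^+ 2).
  have IA2 : rintegrable mu (\1_(lev U x0 l2 r2) : T -> R).
    by apply: rintegrable_indic => //; exact: lev_lty.
  rewrite -(Rintegral_indic _ mA2) -RintegralZl//; apply: Rintegral_le => //.
    exact: rintegrableZ.
  move=> x; rewrite indicE; have [/set_mem[h1 h2]|_] := boolP (x \in _); last by rewrite mulr0 sqr_ge0.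
  rewrite mulr1 /t (cutoff1 r21 (ltW h2)) mul1r.
  rewrite ler_sqr ?nnegrE ?subr_ge0 ?(ltW l12)// /w le_max; apply/orP; right.
  by rewrite lerD2l lerN2 ltW.
have c0 : 0 <= cF * r `^ (- alpha) * m `^ (- beta) by rewrite !mulr_ge0 ?powR_ge0 ?(ltW cF0).
apply: le_trans (ler_wpM2l c0 i3) _; apply: le_trans fk _.
have q0 : 0 <= 2 * l1 * (cU * (r1 - r2) `^ (- alpha)).
  by rewrite !mulr_ge0 ?powR_ge0 ?(ltW cU0).
have j1 := ler_wpM2l q0 i1; have j2 := ler_wpM2l K0 i2.
rewrite -/t -/w in cac; lra.
Qed.

Lemma supersol_sub (A A' : set T) (K : R) U : A' `<=` A -> supersol A K U -> supersol A' K U.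
Proof.
move=> sA hU v [Ev Lv zv] v0'; apply: hU => //; split => // x Ax.
by apply: zv => /sA.
Qed.

Variables ms q : R.
Hypotheses (ms01 : 0 < ms <= 1) (q01 : 0 < q < 1) (qb : q `^ beta = 16^-1).
Hypothesis Cms : 16 * (1 + 32 * cU) / cF * ms `^ beta <= q.

(** Along levels and radii decreasing geometrically to l/2 and r/2, the sublevel set at step j has
    measure at most v0 ms q^j r^d, because the gain m^(-beta) outweighs the shrinking gaps. The
    condition on [K] makes the source no larger than the cutoff term. *)
Lemma de_giorgi (U : T -> R) (x0 : T) (K r l : R) :
  finE U -> (forall x, 0 <= U x) -> 0 <= K -> 0 < r -> 0 < l -> K <= l * r `^ (- alpha) ->
  supersol (oball x0 r) (- K) U ->
  (mu ([set x | (U x < l)%R] `&` oball x0 r) <= (v0 * (ms * r ^+ d))%:E)%E ->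
  mu ([set x | (U x < l / 2)%R] `&` oball x0 (r / 2)) = 0%E.
Proof.
move=> EU U0 K0 r0 l0 hK hU hA.
have mU : measurable_fun setT U by case: EU.
have /andP[ms0 ms1] := ms01; have /andP[q0 q1] := q01.
pose h : R := 2^-1; have h0 : 0 < h by rewrite /h.
have h1 : h < 1 by rewrite /h; lra.
pose lj (j : nat) : R := l * h * (1 + h ^+ j); pose rj (j : nat) : R := r * h * (1 + h ^+ j).
have hj0 j : 0 < h ^+ j by exact: exprn_gt0.
have hj1 j : h ^+ j <= 1 by rewrite exprn_ile1// ltW.
have key j : (mu (lev U x0 (lj j) (rj j)) <= (v0 * ((ms * q ^+ j) * r ^+ d))%:E)%E.
  elim: j => [|j IH].
    have hh : h * (1 + 1) = 1 by rewrite /h; lra.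
    have -> : lj 0%N = l by rewrite /lj expr0 -mulrA hh mulr1.
    have -> : rj 0%N = r by rewrite /rj expr0 -mulrA hh mulr1.
    by rewrite expr0 mulr1.
  pose m := ms * q ^+ j.
  have m0 : 0 < m by rewrite mulr_gt0// exprn_gt0.
  have m1 : m <= 1 by rewrite mulr_ile1 ?(ltW ms0) ?exprn_ge0 ?exprn_ile1 ?(ltW q0) ?(ltW q1).
  have l20 : 0 <= lj j.+1 by rewrite /lj !mulr_ge0 ?(ltW l0) ?(ltW h0)// addr_ge0// ltW.
  have l12 : lj j.+1 < lj j.
    rewrite /lj ltr_pM2l ?mulr_gt0// ltrD2l exprS.
    by rewrite -[ltRHS]mul1r ltr_pM2r.
  have r21 : rj j.+1 < rj j.
    rewrite /rj ltr_pM2l ?mulr_gt0// ltrD2l exprS.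
    by rewrite -[ltRHS]mul1r ltr_pM2r.
  have rjr : rj j <= r.
    rewrite /rj -mulrA -[leRHS]mulr1 ler_wpM2l ?(ltW r0)//.
    by have := hj1 j; rewrite /h; lra.
  have ljl : lj j <= l.
    rewrite /lj -mulrA -[leRHS]mulr1 ler_wpM2l ?(ltW l0)//.
    by have := hj1 j; rewrite /h; lra.
  have hUj : supersol (oball x0 (rj j)) (- K) U.
    by apply: supersol_sub hU; exact: oball_subr.
  have lj0 : 0 <= lj j by lra.
  have := de_giorgi_step EU U0 K0 r0 m0 m1 l20 l12 r21 hUj IH.
  have -> : lj j - lj j.+1 = l * (h ^+ j / 4) by rewrite /lj exprS /h; field.
  have -> : rj j - rj j.+1 = r * (h ^+ j / 4) by rewrite /rj exprS /h; field.
  have g0 : 0 < h ^+ j / 4 by rewrite divr_gt0.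
  rewrite powRM ?(ltW r0) ?(ltW g0)//.
  set a := r `^ (- alpha) in hK *; have a0 : 0 < a by exact: powR_gt0.
  set Y := fine _; set Z := v0 * (m * _).
  have Z0 : 0 < Z by rewrite /Z mulr_gt0 ?v00// mulr_gt0 ?m0// exprn_gt0.
  pose g := h ^+ j; rewrite -/g in g0 *.
  have gp : 0 < g by exact: hj0.
  (* The base is at most 1 and alpha < 2, so exponent 2 gives a loss uniform in alpha. *)
  have p2 : (g / 4) `^ (- alpha) <= 16 * (g ^-2).
    apply: (@le_trans _ _ ((g / 4) `^ (- 2%:R))).
      apply: ger_powR; first by rewrite g0/=; have := hj1 j; rewrite -/g; lra.
      by rewrite lerN2 ltW.
    rewrite powRN powR_mulrn ?(ltW g0)// le_eqVlt; apply/orP; left; apply/eqP; field.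
    by rewrite gt_eqF.
  (* The gain g^-4, with g = 2^-j, pays for the factor g^2 of the squared level gap and for the loss
     g^-2 above. *)
  have mb : m `^ (- beta) = (ms `^ beta)^-1 * g ^- 4.
    rewrite /m powRM ?(ltW ms0) ?exprn_ge0 ?(ltW q0)// !powRN; congr (_ * _).
    rewrite -(powR_mulrn _ (ltW q0)) -powRrM mulrC powRrM powR_mulrn ?powR_ge0// qb.
    by rewrite /g -exprM mulnC exprM; congr ((_ ^+ j)^-1); rewrite /h; field.
  have msb : 0 < ms `^ beta by exact: powR_gt0.
  move=> hstep.
  suff hY : Y <= q * Z.
    rewrite -(fineK (_ : mu (lev U x0 (lj j.+1) (rj j.+1)) \is a fin_num)) ?ge0_fin_numE//; last exact: lev_lty.
    rewrite lee_fin; apply: (le_trans hY); rewrite /Z /m exprS.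
    by rewrite le_eqVlt; apply/orP; left; apply/eqP; ring.
  have c0 : 0 < cF * a * m `^ (- beta) * (l * (g / 4)) ^+ 2.
    have mb0 : 0 < m `^ (- beta) by exact: powR_gt0.
    apply: mulr_gt0; last by apply: exprn_gt0; exact: mulr_gt0.
    by apply: mulr_gt0 => //; exact: mulr_gt0.
  rewrite -(ler_pM2l c0) -[leLHS]mulrA; apply: (le_trans hstep).
  apply: (@le_trans _ _ (l ^+ 2 * a * ((1 + 32 * cU) * g ^- 2) * Z)).
    apply: ler_wpM2r; first exact: ltW.
    have gm : 1 <= g ^- 2.
      by rewrite -exprVn exprn_ege1// invf_ge1// hj1.
    have e1 : K * lj j <= l * a * l by apply: ler_pM.
    have e2 : 2 * lj j ^+ 2 * (cU * (a * (g / 4) `^ (- alpha))) <= 2 * l ^+ 2 * (cU * (a * (16 * g ^- 2))).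
      apply: ler_pM.
      - by rewrite mulr_ge0// sqr_ge0.
      - by rewrite !mulr_ge0 ?powR_ge0 ?(ltW cU0) ?(ltW a0).
      - by rewrite ler_wpM2l// ler_sqr ?nnegrE// (le_trans lj0).
      - by rewrite ler_wpM2l ?(ltW cU0)// ler_wpM2l// ltW.
    have e3 : l ^+ 2 * a * 1 <= l ^+ 2 * a * g ^- 2.
      by rewrite ler_wpM2l// mulr_ge0 ?sqr_ge0// ltW.
    lra.
  rewrite [leRHS]mulrA; apply: ler_wpM2r; first exact: ltW.
  rewrite mb.
  have -> : cF * a * ((ms `^ beta)^-1 * g ^- 4) * (l * (g / 4)) ^+ 2 * q =
     l ^+ 2 * a * (g ^- 2 * (cF / 16 * (q / ms `^ beta))).
    by field; rewrite !gt_eqF.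
  apply: ler_wpM2l; first by rewrite mulr_ge0 ?sqr_ge0 ?(ltW a0).
  rewrite [leLHS]mulrC; apply: ler_wpM2l; first by rewrite invr_ge0 sqr_ge0.
  have : 16 * (1 + 32 * cU) / cF <= q / ms `^ beta by rewrite ler_pdivlMr.
  have cF16 : 0 <= cF / 16 by rewrite divr_ge0// ltW.
  move=> /(ler_wpM2l cF16); apply: le_trans; rewrite le_eqVlt; apply/orP; left; apply/eqP.
  by field; rewrite gt_eqF.
rewrite -/(lev U x0 (l / 2) (r / 2)).
have mF := lev_lty x0 (l / 2) (r / 2) mU.
have Yf : mu (lev U x0 (l / 2) (r / 2)) \is a fin_num by rewrite ge0_fin_numE.
have : fine (mu (lev U x0 (l / 2) (r / 2))) <= 0.
  apply: (@geometric_bound_le0 _ _ (v0 * (ms * r ^+ d)) q q01) => n.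
  rewrite -lee_fin fineK//.
  apply: (@le_trans _ _ (mu (lev U x0 (lj n) (rj n)))).
    apply: le_measure; rewrite ?inE; [exact: measurable_lev..|].
    move=> x [/= x1 x2]; split => /=.
      apply: (lt_le_trans x1); rewrite /lj -mulrA ler_wpM2l ?(ltW l0)//.
      by have := hj0 n; rewrite /h; lra.
    apply: oball_subr x2; rewrite /rj -mulrA ler_wpM2l ?(ltW r0)//.
    by have := hj0 n; rewrite /h; lra.
  apply: le_trans (key n) _; rewrite lee_fin le_eqVlt; apply/orP; left; apply/eqP; ring.
move=> Y0; apply/eqP; rewrite eq_le measure_ge0 andbT.
by rewrite -(fineK Yf) lee_fin.
Qed.

End Iteration.
End DeGiorgi.

(** * Inequalities for the logarithmic test function *)

Section LogInequalities.
Context {R : realType}.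
Implicit Types a b s t : R.

Lemma ln_le_sub1 a : 0 < a -> ln a <= a - 1.
Proof.
move=> a0; have := @le_ln1Dx R (a - 1).
by rewrite (_ : 1 + (a - 1) = a); [apply; lra|ring].
Qed.

Lemma ln_lip m a b : 0 < m -> m <= a -> m <= b -> `|ln a - ln b| <= m^-1 * `|a - b|.
Proof.
move=> m0; wlog ab : a b / b <= a => [h ma mb|ma mb].
  have [ba|/ltW ab] := leP b a; first exact: h.
  by rewrite distrC [`|a - b|]distrC; exact: h.
have a0 : 0 < a by lra.
have b0 : 0 < b by lra.
rewrite !ger0_norm ?subr_ge0// ?ler_ln//.
rewrite -ln_div//; apply: le_trans (ln_le_sub1 _) _; first by rewrite divr_gt0.
rewrite (_ : a / b - 1 = b^-1 * (a - b)); last by field; rewrite gt_eqF.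
by rewrite ler_wpM2r ?subr_ge0 ?lef_pV2.
Qed.

Lemma inv_lip m a b : 0 < m -> m <= a -> m <= b -> `|a^-1 - b^-1| <= m^-1 ^+ 2 * `|a - b|.
Proof.
move=> m0 ma mb; have a0 : 0 < a by lra.
have b0 : 0 < b by lra.
rewrite (_ : a^-1 - b^-1 = (a^-1 * b^-1) * (b - a)); last by field; rewrite !gt_eqF.
rewrite normrM [`|b - a|]distrC ler_wpM2r//.
have ai : 0 < a^-1 by rewrite invr_gt0.
have bi : 0 < b^-1 by rewrite invr_gt0.
rewrite ger0_norm; last by rewrite mulr_ge0// ltW.
by rewrite expr2; apply: ler_pM; rewrite ?(ltW ai) ?(ltW bi) ?lef_pV2.
Qed.

(** With x >= y the square roots of a and b, the claim reduces to ln(x/y) <= x/y - y/x, which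
    follows from ln z <= z - 1 and y/x <= 1. *)
Lemma ln_sqr_le a b : 0 < a -> 0 < b -> (ln a - ln b) ^+ 2 <= 4 * ((a - b) ^+ 2 / (a * b)).
Proof.
wlog ab : a b / b <= a => [h a0 b0|a0 b0].
  have [ba|/ltW ab] := leP b a; first exact: h.
  rewrite -[(ln a - _) ^+ 2]sqrrN -[(a - b) ^+ 2]sqrrN !opprB mulrC [a * b]mulrC [_ * 4]mulrC.
  exact: h.
pose x := Num.sqrt a; pose y := Num.sqrt b.
have x0 : 0 < x by rewrite sqrtr_gt0.
have y0 : 0 < y by rewrite sqrtr_gt0.
have xy : y <= x by rewrite ler_wsqrtr.
have -> : a = x ^+ 2 by rewrite sqr_sqrtr// ltW.
have -> : b = y ^+ 2 by rewrite sqr_sqrtr// ltW.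
rewrite !lnXn//.
have -> : (ln x *+ 2 - ln y *+ 2) = 2 * ln (x / y) by rewrite ln_div ?posrE//; ring.
have -> : 4 * ((x ^+ 2 - y ^+ 2) ^+ 2 / (x ^+ 2 * y ^+ 2)) = (2 * (x / y - y / x)) ^+ 2.
  by field; rewrite !gt_eqF.
have z0 : 0 <= ln (x / y) by rewrite ln_ge0// ler_pdivlMr// mul1r.
have h : ln (x / y) <= x / y - y / x.
  apply: le_trans (ln_le_sub1 _) _; first by rewrite divr_gt0.
  by rewrite lerD2l lerN2 ler_pdivrMr// mul1r.
by rewrite ler_sqr ?nnegrE ?mulr_ge0//; lra.
Qed.

(** The right side minus the left is (s b - t a)^2 / (a b). *)
Lemma log_test_le a b s t : 0 < a -> 0 < b ->
  (a - b) * (s * (s * a^-1) - t * (t * b^-1)) <= (s - t) ^+ 2.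
Proof.
move=> a0 b0; rewrite -subr_ge0.
rewrite (_ : _ - _ = (s * b - t * a) ^+ 2 / (a * b)); last by field; rewrite !gt_eqF.
by rewrite divr_ge0 ?sqr_ge0// mulr_ge0 ?ltW.
Qed.

(** The case of two points where the cutoff is 1, hence the literal factors 1. Here the product is
    exactly - (a - b)^2 / (a b), which yields the gain that the logarithmic estimate is after. *)
Lemma log_test_le1 a b : 0 < a -> 0 < b ->
  (a - b) * (1 * (1 * a^-1) - 1 * (1 * b^-1)) <= - 4^-1 * (ln a - ln b) ^+ 2.
Proof.
move=> a0 b0; have := ln_sqr_le a0 b0.
rewrite (_ : (a - b) * _ = - ((a - b) ^+ 2 / (a * b))); first by lra.
by field; rewrite !gt_eqF.
Qed.

End LogInequalities.

(** * Lower bounds for nonnegative supersolutions *)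

Section LowerBoundGrowth.
Context {R : realType} {d : nat}.
Local Notation T := (pt R d).
Local Notation mu := (lebn (R := R) d).
Local Notation P := (mu \x mu)%E.
Variables (k : T -> T -> R) (alpha cU alpha0 cF ms q : R).
Hypothesis mk : measurable_fun setT (fun p : T * T => k p.1 p.2).
Hypothesis k0 : forall x y, 0 <= k x y.
Hypothesis ksym : forall x y, k x y = k y x.
Hypothesis cU0 : 0 < cU.
Hypothesis hU1 : U1 alpha k cU.
Hypothesis d0 : (0 < d)%N.
Hypotheses (alpha00 : 0 < alpha0) (alpha1 : alpha0 <= alpha) (alpha2 : alpha < 2).

Local Notation finE := (finE mu k).
Local Notation B := (B mu k).
Local Notation HO := (HO mu k).
Local Notation v0 := (vol1 (R := R) (d := d) / 4).

Hypothesis ms01 : 0 < ms <= 1.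
Hypothesis DG : forall (U : T -> R) (x0 : T) (K r l : R),
  finE U -> (forall x, 0 <= U x) -> 0 <= K -> 0 < r -> 0 < l -> K <= l * r `^ (- alpha) ->
  supersol k (oball x0 r) (- K) U ->
  (mu ([set x | (U x < l)%R] `&` oball x0 r) <= (v0 * (ms * r ^+ d))%:E)%E ->
  mu ([set x | (U x < l / 2)%R] `&` oball x0 (r / 2)) = 0%E.

Let V : R := vol1 (R := R) (d := d).
Let V0 : 0 < V. Proof. exact: vol1_gt0. Qed.

Let int_ball (x0 : T) r : 0 < r -> \int[mu]_x (\1_(oball x0 r) x) = r ^+ d * V.
Proof.
move=> r0; rewrite Rintegral_indic; last exact: measurable_oball.
by rewrite [X in fine X](lebn_ball x0 r0).
Qed.

Let halfpow r : 0 < r -> (r / 2) `^ (- alpha) <= 4 * r `^ (- alpha).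
Proof.
move=> r0; rewrite powRM ?(ltW r0)// mulrC ler_wpM2r ?powR_ge0//.
rewrite -powR_inv1// -powRrM mulN1r opprK.
rewrite (_ : 4 = (2 : R) `^ 2%:R); last by rewrite powR_mulrn//; ring.
by apply: ler_powR; [lra|exact: ltW].
Qed.

(** The value for which the Caccioppoli bound at level lower_delta r^alpha meets exactly the density
    threshold of [de_giorgi] on the ball of radius r/2. *)
Definition lower_delta : R := ms / (64 * cU * 2 ^+ d).

Lemma lower_delta_gt0 : 0 < lower_delta.
Proof. by case/andP : ms01 => m0 _; rewrite divr_gt0// !mulr_gt0// exprn_gt0. Qed.

(* One Caccioppoli step at the level [l = lower_delta * r `^ alpha]: the positive source
   term forces {u < l / 2} to be so small that [de_giorgi] applies. *)
Lemma torsion_lower_bound (u : T -> R) (x0 : T) (r : R) :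
  finE u -> (forall x, 0 <= u x) -> 0 < r -> supersol k (oball x0 r) 1 u ->
  mu ([set x | (u x < lower_delta * r `^ alpha / 4)%R] `&` oball x0 (r / 4)) = 0%E.
Proof.
move=> Eu u0 r0 hu; have /andP[m0 m1] := ms01.
have mu_ : measurable_fun setT u by case: Eu.
have ra0 : 0 < r `^ alpha by exact: powR_gt0.
pose l := lower_delta * r `^ alpha.
have l0 : 0 < l by rewrite mulr_gt0// lower_delta_gt0.
have r20 : r / 2 < r by lra.
have r2p : 0 < r / 2 by lra.
have -> : lower_delta * r `^ alpha / 4 = (l / 2) / 2 by rewrite /l; field.
have -> : r / 4 = (r / 2) / 2 by field.
have cac := caccioppoli mk k0 ksym hU1 r20 (ltW l0) Eu u0 hu.
have HB := Buu_ge0 mu k0 (fun x => cutoff x0 (r / 2) r x * Num.max 0 (l - u x)).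
pose A := [set x | (u x < l / 2)%R] `&` oball x0 (r / 2).
have mA : measurable A.
  apply: measurableI; last exact: measurable_oball.
  by rewrite -[X in measurable X]setTI; exact: measurable_fun_ltr.
have Ay : (mu A < +oo)%E.
  apply: le_lt_trans (lebn_ball_lty x0 (r / 2)); apply: le_measure; rewrite ?inE//.
    exact: measurable_oball.
  by move=> x [].
have mI (S : set T) : measurable S -> measurable_fun setT (\1_S : T -> R) by exact: measurable_indic.
have mw : measurable_fun setT (fun x => Num.max 0 (l - u x)).
  by apply: measurable_maxr => //; exact: measurable_funB.
have w0 x : 0 <= Num.max 0 (l - u x) by rewrite le_max lexx.
have wl x : Num.max 0 (l - u x) <= l by rewrite ge_max (ltW l0) gerBl u0.
have mt := @measurable_cutoff R d x0 (r / 2) r.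
have i1 : \int[mu]_x (\1_(oball x0 r) x * Num.max 0 (l - u x)) <= l * (r ^+ d * V).
  rewrite -(int_ball x0 r0) -RintegralZl//; last exact: ball_indic_integrable.
  apply: Rintegral_le.
  - apply: (@bounded_ball_integrable _ _ x0 r l).
    + by apply: measurable_funM => //; apply: mI; exact: measurable_oball.
    + by move=> x; rewrite ger0_norm ?mulr_ge0// -[leRHS]mul1r ler_pM// indicE lern1 leq_b1.
    + by move=> x h; rewrite indicE memNset ?mul0r.
  - by apply: rintegrableZ; exact: ball_indic_integrable.
  - by move=> x; rewrite mulrC ler_wpM2r.
have i2 : l / 2 * fine (mu A) <= \int[mu]_x (cutoff x0 (r / 2) r x * (cutoff x0 (r / 2) r x * Num.max 0 (l - u x))).
  have IA : rintegrable mu (\1_A : T -> R) by exact: rintegrable_indic.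
  rewrite -(Rintegral_indic mu mA) -RintegralZl//; apply: Rintegral_le.
  - exact: rintegrableZ.
  - apply: (@bounded_ball_integrable _ _ x0 r l).
    + by apply: measurable_funM => //; exact: measurable_funM.
    + move=> x; rewrite ger0_norm ?mulr_ge0 ?cutoff_ge0// -[leRHS]mul1r ler_pM ?mulr_ge0 ?cutoff_ge0 ?cutoff_le1//.
      by rewrite -[leRHS]mul1r ler_pM ?cutoff_ge0 ?cutoff_le1.
    + by move=> x h; rewrite cutoff0 ?mul0r.
  - move=> x; rewrite indicE; have [/set_mem[/= h1 h2]|_] := boolP (x \in A); last first.
      by rewrite mulr0 !mulr_ge0 ?cutoff_ge0.
    rewrite mulr1 (cutoff1 r20 (ltW h2)) !mul1r le_max; apply/orP; right; lra.
have hp : (r - r / 2) `^ (- alpha) <= 4 * r `^ (- alpha).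
  by rewrite (_ : r - r / 2 = r / 2); [exact: halfpow|lra].
(* The source 1 is nonnegative, so [u] is a supersolution with constant 0 as well. *)
apply: (DG (K := 0)) => //.
- by rewrite divr_gt0.
- by rewrite mulr_ge0 ?powR_ge0// ltW// divr_gt0.
- move=> v Hv vp; rewrite oppr0 mul0r.
  apply: le_trans (_ : 1 * \int[mu]_x v x <= _).
    by rewrite mul1r; apply: Rintegral_ge0 => x _.
  exact: (supersol_sub (oball_subr (ltW r20)) hu Hv vp).
have Af : mu A \is a fin_num by rewrite ge0_fin_numE.
rewrite -/A -(fineK Af) lee_fin.
set X := fine _ in i2 *.
have hc : 2 * l * (cU * (r - r / 2) `^ (- alpha)) <= 2 * l * (cU * (4 * r `^ (- alpha))).
  apply: ler_wpM2l; first by rewrite mulr_ge0 ?(ltW l0).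
  by apply: ler_wpM2l => //; exact: ltW.
have c01 : 0 <= 2 * l * (cU * (r - r / 2) `^ (- alpha)).
  apply: mulr_ge0; first by rewrite mulr_ge0 ?(ltW l0).
  by apply: mulr_ge0; [exact: ltW|exact: powR_ge0].
have rdV : 0 <= l * (r ^+ d * V).
  by rewrite mulr_ge0 ?(ltW l0)// mulr_ge0 ?exprn_ge0 ?(ltW r0) ?(ltW V0).
have j1 : l / 2 * X <= 2 * l * (cU * (4 * r `^ (- alpha))) * (l * (r ^+ d * V)).
  apply: (le_trans i2); rewrite mul1r in cac.
  apply: (@le_trans _ _ (2 * l * (cU * (r - r / 2) `^ (- alpha)) * \int[mu]_x (\1_(oball x0 r) x * Num.max 0 (l - u x)))).
    lra.
  apply: le_trans (ler_wpM2l c01 i1) _; exact: ler_wpM2r.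
have l2 : 0 < l / 2 by rewrite divr_gt0.
rewrite -(ler_pM2l l2); apply: (le_trans j1).
rewrite le_eqVlt; apply/orP; left; apply/eqP.
rewrite /l /lower_delta expr_div_n powRN -/V; field.
by rewrite !gt_eqF ?exprn_gt0.
Qed.

Variable cE : R.
Hypothesis cE0 : 0 < cE.
Hypothesis Efrac : forall x0 r (u : T -> R), 0 < r -> L2on (oball x0 r) u ->
    (cE%:E * \int[P]_p (\1_(oball x0 r) p.1 * \1_(oball x0 r) p.2 * fracQ alpha u p)%:E
     <= \int[P]_p (\1_(oball x0 r) p.1 * \1_(oball x0 r) p.2 * Q k u u p)%:E)%E.

Section LogEstimate.
Variables (U : T -> R) (x0 : T) (K r lam : R).
Hypotheses (EU : finE U) (U0 : forall x, 0 <= U x) (K0 : 0 <= K) (r0 : 0 < r).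
Hypotheses (lam0 : 0 < lam) (lam1 : lam < 1) (hK : K <= lam * r `^ (- alpha)).
Hypothesis hU : supersol k (oball x0 (2 * r)) (- K) U.

Let W x := U x + lam.
Let W0 x : 0 < W x. Proof. by rewrite ltr_wpDl. Qed.
Let Wl x : lam <= W x. Proof. by rewrite lerDr. Qed.
Let EW : finE W. Proof. exact: finE_shift. Qed.
Let mU : measurable_fun setT U. Proof. by case: EU. Qed.
Let mW : measurable_fun setT W. Proof. by case: EW. Qed.
Let f x := Num.max 0 (- ln (W x)).
Local Notation tau := (cutoff x0 r (2 * r)).
Local Notation ball := (oball x0 r).

Let r2r : r < 2 * r. Proof. by have := r0; lra. Qed.

Let mf : measurable_fun setT f.
Proof.
apply: measurable_maxr => //; apply: measurableT_comp => //.
by apply: (measurableT_comp (@measurable_ln R)).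
Qed.

Let f_lip x y : `|f x - f y| <= `|ln (W x) - ln (W y)|.
Proof.
apply: le_trans (max_lip _ _ _) _.
by rewrite distrC (_ : _ - _ = ln (W x) - ln (W y)) //; ring.
Qed.

Let Ef : finE f.
Proof.
apply: (@finE_dom1 _ _ _ _ _ mk k0 lam^-1 W) => // x y.
by apply: le_trans (f_lip x y) _; exact: ln_lip.
Qed.

Let f0 x : 0 <= f x. Proof. by rewrite le_max lexx. Qed.

Let f_le x : f x <= - ln lam.
Proof.
have h : 0 <= - ln lam by rewrite oppr_ge0 ln_le0// ltW.
by rewrite ge_max h lerN2 ler_ln ?posrE ?W0// Wl.
Qed.

Let Et : finE tau. Proof. by have [] := finE_cutoff mk k0 ksym hU1 x0 r2r. Qed.

Let v x := tau x * (tau x * (W x)^-1).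

Let Wi_le x : `|(W x)^-1| <= lam^-1.
Proof. by rewrite ger0_norm ?invr_ge0 ?(ltW (W0 x))// lef_pV2 ?posrE ?W0// Wl. Qed.

Let Wi0 x : 0 <= (W x)^-1. Proof. by rewrite invr_ge0 ltW. Qed.

Let li0 : 0 < lam^-1. Proof. by rewrite invr_gt0. Qed.

Let mWi : measurable_fun setT (fun x => (W x)^-1).
Proof.
rewrite (_ : (fun x => (W x)^-1) = (fun x => W x `^ (-1))).
  exact: (measurableT_comp (measurable_powR _)).
by apply/funext => x; rewrite powR_inv1// ltW.
Qed.

Let EWi : finE (fun x => (W x)^-1).
Proof.
apply: (@finE_dom1 _ _ _ _ _ mk k0 (lam^-1 ^+ 2) W) => // x y.
exact: inv_lip.
Qed.

Let tn x : `|tau x| <= 1.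
Proof. by rewrite ger0_norm ?cutoff_ge0 ?cutoff_le1. Qed.

Let EtW : finE (fun x => tau x * (W x)^-1).
Proof.
apply: (@finE_mul _ _ _ _ _ mk k0 (1 + lam^-1)) => // x.
  by apply: le_trans (tn x) _; rewrite lerDl ltW.
by apply: le_trans (Wi_le x) _; rewrite lerDr.
Qed.

Let tWl x : `|tau x * (W x)^-1| <= lam^-1.
Proof. by rewrite normrM -[leRHS]mul1r; apply: ler_pM. Qed.

Let Ev : finE v.
Proof.
apply: (@finE_mul _ _ _ _ _ mk k0 (1 + lam^-1)) => // x.
  by apply: le_trans (tn x) _; rewrite lerDl ltW.
by apply: le_trans (tWl x) _; rewrite lerDr.
Qed.

Let v_le x : `|v x| <= lam^-1.
Proof. by rewrite /v normrM -[leRHS]mul1r; apply: ler_pM. Qed.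

Let v_out x : ~ oball x0 (2 * r) x -> v x = 0.
Proof. by move=> h; rewrite /v cutoff0 ?mul0r. Qed.

Let Hv : HO (oball x0 (2 * r)) v.
Proof. exact: (@bounded_ball_HO _ _ _ x0 (2 * r) lam^-1). Qed.

Let v_ge0 x : 0 <= v x. Proof. by rewrite /v !mulr_ge0 ?cutoff_ge0. Qed.

Let r20 : 0 < 2 * r. Proof. by rewrite mulr_gt0. Qed.

Let int_v : \int[mu]_x v x <= lam^-1 * ((2 * r) ^+ d * V).
Proof.
rewrite -(int_ball x0 r20) -RintegralZl//; last exact: ball_indic_integrable.
apply: Rintegral_le.
- by apply: (@bounded_ball_integrable _ _ x0 (2 * r) lam^-1 v) => //; case: Ev.
- by apply: rintegrableZ; exact: ball_indic_integrable.
- move=> x; have [h|h] := pselect (oball x0 (2 * r) x).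
    by rewrite indicE mem_set// mulr1; apply: le_trans (v_le x); rewrite ler_norm.
  by rewrite v_out// mulr_ge0// ltW.
Qed.

(** Collects 2 cU from the energy of the cutoff and 1 from the source, both on the ball of radius 2
    r (whence 2^d), times the 4 of [ln_sqr_le]. *)
Definition log_const : R := 4 * (2 * cU + 1) * 2 ^+ d.

Let mball : measurable ball. Proof. exact: measurable_oball. Qed.

Let i1 (p : T * T) : 0 <= (\1_ball p.1 * \1_ball p.2 : R) <= 1.
Proof.
by rewrite mulr_ge0//= !indicE -natrM lern1; case: (_ \in _); case: (_ \in _).
Qed.

Let IQ : rintegrable P (fun p => \1_ball p.1 * \1_ball p.2 * Q k f f p).
Proof.
apply: (@rintegrable_le _ _ _ _ (Q k f f)); last 2 first.
- by case: Ef.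
- move=> p; have /andP[h1 h2] := i1 p.
  have Q0 := Quu_ge0 k0 f p; rewrite ger0_norm; last exact: mulr_ge0.
  exact: ler_piMl.
- by apply: measurable_funM; [exact: measurable_indic2|exact: measurable_Q].
Qed.

(** The test function is tau^2 / W with W = U + lam. The shift makes 1/W and ln W Lipschitz
    functions of U, and K / lam <= r^(-alpha) brings the source to the order of the cutoff energy.
    The logarithmic gain is kept only on pairs of points of the ball, which is where [E_ge] will be
    applied. *)
Lemma log_energy :
  \int[P]_p (\1_ball p.1 * \1_ball p.2 * Q k f f p) <= log_const * (r ^+ d * V) * r `^ (- alpha).
Proof.
have h1 := hU Hv v_ge0.
have : B U v = B W v by rewrite -(B_shiftl mu k lam U v).
move=> eB; rewrite eB in h1.
have h2 : B W v <= \int[P]_p (1 * Q k tau tau p + (- 4^-1) * (\1_ball p.1 * \1_ball p.2 * Q k f f p)).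
  apply: B_le => //.
    by apply: rintegrableD; apply: rintegrableZ => //; case: Et.
  move=> p; rewrite /Q /v.
  set a := W p.1; set b := W p.2.
  have a0 : 0 < a by exact: W0.
  have b0 : 0 < b by exact: W0.
  have kk := k0 p.1 p.2.
  have [/andP[/set_mem p1 /set_mem p2]|hn] := boolP ((p.1 \in ball) && (p.2 \in ball)).
    rewrite !indicE (mem_set p1) (mem_set p2) !(cutoff1 r2r (ltW p1)) !(cutoff1 r2r (ltW p2)) /=.
    have := log_test_le1 a0 b0.
    have : (f p.1 - f p.2) ^+ 2 <= (ln a - ln b) ^+ 2.
      rewrite -(real_normK (num_real (f _ - _))) -(real_normK (num_real (ln a - _))).
      by rewrite ler_sqr ?nnegrE// f_lip.
    move=> h3 h4.
    have h5 : (a - b) * (1 * (1 * a^-1) - 1 * (1 * b^-1)) <= - 4^-1 * (f p.1 - f p.2) ^+ 2.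
      by apply: (le_trans h4); rewrite !mulNr lerN2 ler_wpM2l.
    have h6 := ler_wpM2r kk h5; apply: (le_trans h6).
    by rewrite le_eqVlt; apply/orP; left; apply/eqP; ring.
  have -> : \1_ball p.1 * \1_ball p.2 = 0 :> R.
    by rewrite !indicE -natrM mulnb (negbTE hn).
  apply: le_trans (ler_wpM2r kk (log_test_le (tau p.1) (tau p.2) a0 b0)) _.
  by rewrite le_eqVlt; apply/orP; left; apply/eqP; ring.
rewrite (Rintegral_lin _ _ (proj2 Et) IQ) -/(B _ _) in h2.
have [_ h3] := finE_cutoff mk k0 ksym hU1 x0 r2r.
rewrite (int_ball x0 r20) (_ : 2 * r - r = r) in h3; last by ring.
have h4 := ler_wpM2l K0 int_v.
have rV : 0 <= (2 * r) ^+ d * V by rewrite mulr_ge0 ?exprn_ge0 ?(ltW r20) ?(ltW V0).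
have h5 : K * (lam^-1 * ((2 * r) ^+ d * V)) <= r `^ (- alpha) * ((2 * r) ^+ d * V).
  rewrite [leLHS]mulrA; apply: ler_wpM2r => //.
  by rewrite ler_pdivrMr// mulrC.
rewrite /log_const exprMn in h3 h5 *.
rewrite -/(B tau tau) in h2.
set I := (X in X <= _); set c := B tau tau in h2 h3.
have h6 : I <= 4 * (c + K * \int[mu]_x v x) by rewrite -/I in h2; lra.
rewrite exprMn in h4; lra.
Qed.

(** The function [f] vanishes on {U >= 1} and is at least L = - ln (2 lam) on {U < lam}. Pairs from
    these sets give fractional energy at least (2 r)^(-d - alpha) L^2 times the product of their
    measures, and {U >= 1} fills half of the ball. The constant [cE] will contain the factor 2 -
    alpha, so this bound degenerates as alpha tends to 2; it serves only the qualitative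
    continuity. *)
Lemma log_measure_bound :
  (mu ([set x | (1 <= U x)%R] `&` ball) >= (r ^+ d * V / 2)%:E)%E ->
  1 <= - ln (2 * lam) ->
  - ln (2 * lam) * fine (mu ([set x | (U x < lam)%R] `&` ball)) <=
    (2 * log_const * 2 ^+ d.+2 / cE) * r ^+ d.
Proof.
set S := [set x | (1 <= U x)%R] `&` ball; set A := [set x | (U x < lam)%R] `&` ball.
move=> hS L1; set L := - ln (2 * lam) in L1 *.
have mS : measurable S.
  apply: measurableI => //; rewrite -[X in measurable X]setTI.
  exact: measurable_fun_ler.
have mA : measurable A.
  apply: measurableI => //; rewrite -[X in measurable X]setTI.
  exact: measurable_fun_ltr.
have Ay : (mu A < +oo)%E.
  apply: le_lt_trans (lebn_ball_lty x0 r); apply: le_measure; rewrite ?inE//.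
  by move=> x [].
have Sy : (mu S < +oo)%E.
  apply: le_lt_trans (lebn_ball_lty x0 r); apply: le_measure; rewrite ?inE//.
  by move=> x [].
have L2f : L2on ball f.
  have h x : \1_ball x * f x ^+ 2 <= (ln lam) ^+ 2 * \1_ball x.
    rewrite mulrC; apply: ler_wpM2r => //; rewrite -[leRHS]sqrrN.
    by rewrite ler_sqr ?nnegrE ?f0 ?f_le// (le_trans (f0 x) (f_le x)).
  split=> //; rewrite iintE; last 2 first.
  - apply/measurable_EFinP; apply: measurable_funM; last exact: measurable_funX.
    exact: measurable_indic.
  - by move=> x; rewrite lee_fin mulr_ge0// sqr_ge0.
  have I2 : rintegrable mu (fun x => (ln lam) ^+ 2 * \1_ball x).
    by apply: rintegrableZ; exact: ball_indic_integrable.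
  apply: le_lt_trans (_ : (\int[mu]_x ((ln lam) ^+ 2 * \1_ball x)%:E < +oo)%E).
    apply: le_integralT.
    - by move=> x; rewrite lee_fin mulr_ge0 ?sqr_ge0.
    - apply/measurable_EFinP; apply: measurable_funM; last exact: measurable_funX.
      exact: measurable_indic.
    - by apply/measurable_EFinP; exact: rintegrable_measurable I2.
    - by move=> x; rewrite lee_fin.
  by rewrite -EFin_Rintegral ?ltry.
have := Efrac r0 L2f; rewrite -[X in (_ <= X)%E](EFin_Rintegral IQ).
move=> h1; have {h1} : (cE%:E * \int[P]_p (\1_ball p.1 * \1_ball p.2 * fracQ alpha f p)%:E <=
   (log_const * (r ^+ d * V) * r `^ (- alpha))%:E)%E.
  by apply: (le_trans h1); rewrite lee_fin; exact: log_energy.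
have cc0 : 0 <= (2 * r) `^ (- (d%:R + alpha)) * L ^+ 2 by rewrite mulr_ge0 ?powR_ge0 ?sqr_ge0.
have hlow : (((2 * r) `^ (- (d%:R + alpha)) * L ^+ 2)%:E * (mu A * mu S) <=
    \int[P]_p (\1_ball p.1 * \1_ball p.2 * fracQ alpha f p)%:E)%E.
  have mAS : measurable (A `*` S) by exact: measurableX.
  have -> : (mu A * mu S = \int[P]_p (\1_(A `*` S) p)%:E)%E.
    by rewrite integral_indic// setIT; exact: esym (@product_measure1E _ _ T T R mu mu A S mA mS).
  have mI : measurable_fun setT (fun p : T * T => (\1_(A `*` S) p)%:E : \bar R).
    exact/measurable_EFinP/measurable_indic.
  rewrite -integralZT//; apply: le_integralT.
  - by move=> p; rewrite mule_ge0// lee_fin.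
  - exact: measurable_funeM.
  - apply/measurable_EFinP; apply: measurable_funM; first exact: measurable_indic2.
    exact: measurable_fracQ.
  - move=> p; rewrite -EFinM lee_fin indicE.
    have [/set_mem[[/= a1 a2] [/= s1 s2]]|_] := boolP (p \in A `*` S); last first.
      by rewrite mulr0 mulr_ge0 ?fracQ_ge0//; case/andP: (i1 p).
    rewrite !indicE (mem_set a2) (mem_set s2) mulr1 !mul1r /fracQ mulrC.
    have fs : f p.2 = 0.
      by rewrite /f max_l// oppr_le0 ln_ge0// /W; have := lam0; lra.
    have fa : L <= f p.1.
      rewrite /f /L le_max; apply/orP; right; rewrite lerN2 ler_ln ?posrE//; last by rewrite mulr_gt0.
      by rewrite /W; lra.
    rewrite fs subr0; apply: ler_pM; rewrite ?sqr_ge0 ?powR_ge0//.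
      by rewrite ler_sqr ?nnegrE//; lra.
    (* At distance 0 the power takes the default value 0, so the lower bound needs distinct points;
       they are distinct since [f] is 0 at one and at least L >= 1 at the other. *)
    have e0 : 0 < eucl p.2 p.1.
      rewrite lt_neqAle eucl_ge0 andbT eq_sym; apply/eqP => e00.
      have hi i : tnth p.2 i = tnth p.1 i.
        by have := coord_le_eucl p.2 p.1 i; rewrite e00 normr_le0 subr_eq0 => /eqP.
      have pp : p.2 = p.1 by apply: eq_from_tnth.
      by move: fa; rewrite -pp fs; lra.
    have er : eucl p.2 p.1 <= 2 * r.
      have := eucl_triangle x0 p.2 p.1; rewrite [eucl p.2 x0]eucl_sym.
      by move: a2 s2; rewrite /oball/=; lra.
    rewrite !powRN lef_pV2 ?posrE ?powR_gt0//.
    by rewrite ge0_ler_powR ?nnegrE ?(ltW e0) ?(ltW r20)// addr_ge0// (le_trans (ltW alpha00)).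
move=> h1.
have cE0' : (0 <= cE%:E)%E by rewrite lee_fin ltW.
have h2 := le_trans (lee_wpmul2l cE0' hlow) h1.
move: h2 hS; rewrite -(fineK (_ : mu A \is a fin_num)) ?ge0_fin_numE//.
rewrite -(fineK (_ : mu S \is a fin_num)) ?ge0_fin_numE//.
rewrite -!EFinM !lee_fin.
set a := fine (mu A); set s := fine (mu S) => h2 hS.
have a0 : 0 <= a by exact: fine_ge0.
have ra : 0 < r `^ (- alpha) by exact: powR_gt0.
have rd : 0 < r ^+ d by exact: exprn_gt0.
have two4 : 2 `^ alpha <= 4 :> R.
  rewrite (_ : 4 = (2 : R) `^ 2%:R); last by rewrite powR_mulrn//; ring.
  by apply: ler_powR; [lra|exact: ltW].
have ta : 0 < 2 `^ alpha :> R by exact: powR_gt0.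
have t2 : 0 < (2 : R) ^+ d by exact: exprn_gt0.
have e1 : (2 * r) `^ (- (d%:R + alpha)) = (2 ^+ d * 2 `^ alpha)^-1 * (r ^+ d)^-1 * r `^ (- alpha).
  rewrite powRM ?(ltW r0)//.
  rewrite opprD !powRD; last 2 first.
  - by apply/implyP => _; rewrite gt_eqF.
  - by apply/implyP => _.
  rewrite !powRN !powR_mulrn ?(ltW r0)// invfM; ring.
rewrite e1 in h2.
have h3 : cE * ((2 ^+ d * 2 `^ alpha)^-1 * (r ^+ d)^-1 * r `^ (- alpha) * L ^+ 2 * (a * (r ^+ d * V / 2))) <=
   log_const * (r ^+ d * V) * r `^ (- alpha).
  apply: le_trans h2; apply: ler_wpM2l; first exact: ltW.
  apply: ler_wpM2l; last exact: ler_wpM2l.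
  by rewrite mulr_ge0 ?sqr_ge0// !mulr_ge0 ?invr_ge0 ?(ltW ra) ?(ltW rd)// mulr_ge0 ?(ltW t2) ?(ltW ta).
have c1 : 0 < r `^ (- alpha) * V by exact: mulr_gt0.
have h4 : cE * ((2 ^+ d * 2 `^ alpha)^-1 * L ^+ 2 * a) <= 2 * log_const * r ^+ d.
  rewrite -(ler_pM2r c1).
  have -> : cE * ((2 ^+ d * 2 `^ alpha)^-1 * L ^+ 2 * a) * (r `^ (- alpha) * V) =
    2 * (cE * ((2 ^+ d * 2 `^ alpha)^-1 * (r ^+ d)^-1 * r `^ (- alpha) * L ^+ 2 * (a * (r ^+ d * V / 2)))).
    by field; rewrite !gt_eqF.
  apply: le_trans (ler_wpM2l (ler0n _ 2) h3) _.
  by rewrite le_eqVlt; apply/orP; left; apply/eqP; ring.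
have h5 : L * a <= L ^+ 2 * a.
  by apply: ler_wpM2r => //; rewrite expr2 ler_peMr//; lra.
apply: (le_trans h5).
have c2 : 0 < cE * (2 ^+ d * 2 `^ alpha)^-1 by rewrite mulr_gt0// invr_gt0 mulr_gt0.
rewrite -(ler_pM2l c2) -[leLHS]mulrA [(2 ^+ d * _)^-1 * (_ * _)]mulrA; apply: (le_trans h4).
have lc0 : 0 <= log_const.
  by rewrite /log_const mulr_ge0 ?(ltW t2)// mulr_ge0// addr_ge0// mulr_ge0// ltW.
have -> : cE * (2 ^+ d * 2 `^ alpha)^-1 * (2 * log_const * 2 ^+ d.+2 / cE * r ^+ d) =
   2 * log_const * r ^+ d * (4 / 2 `^ alpha).
  by rewrite !exprS; field; rewrite !gt_eqF.
rewrite ler_peMr// ?ler_pdivlMr ?mul1r//.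
by rewrite mulr_ge0 ?(ltW rd)// mulr_ge0.
Qed.

End LogEstimate.

(* [log_measure_bound] makes {U < lam} a small part of the ball, uniformly in [r], once
   [ln lam^-1] is large; then [de_giorgi] applies at level [lam]. *)
Lemma growth : exists2 lam : R, 0 < lam & forall (U : T -> R) (x0 : T) (K r : R),
  finE U -> (forall x, 0 <= U x) -> 0 <= K -> 0 < r -> K <= lam * r `^ (- alpha) ->
  supersol k (oball x0 (2 * r)) (- K) U ->
  (mu ([set x | (1 <= U x)%R] `&` oball x0 r) >= (r ^+ d * V / 2)%:E)%E ->
  mu ([set x | (U x < lam / 2)%R] `&` oball x0 (r / 2)) = 0%E.
Proof.
have /andP[m0 m1] := ms01.
have lc0 : 0 < log_const by rewrite /log_const !mulr_gt0 ?exprn_gt0// addr_gt0// mulr_gt0.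
pose C := 2 * log_const * 2 ^+ d.+2 / cE.
have C0 : 0 < C by apply: divr_gt0 => //; apply: mulr_gt0; [exact: mulr_gt0|exact: exprn_gt0].
(* Chosen so that C / L <= v0 ms, the density allowed by [DG]; the summand 1 secures L >= 1. Then
   [lam] solves - ln (2 lam) = L. *)
pose L := 1 + C / (v0 * ms).
have v00 : 0 < v0 by rewrite divr_gt0.
have L1 : 1 <= L by rewrite /L lerDl divr_ge0 ?(ltW C0)// mulr_ge0// ltW.
pose lam := expR (- L) / 2.
have lam0 : 0 < lam by rewrite /lam divr_gt0// expR_gt0.
have lam1 : lam < 1.
  have : expR (- L) <= 1 by rewrite -expR0 ler_expR; lra.
  by rewrite /lam; lra.
have eL : - ln (2 * lam) = L.
  by rewrite /lam (_ : 2 * (expR (- L) / 2) = expR (- L)) ?expRK ?opprK//; field.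
exists lam => // U x0 K r EU U0 K0 r0 hK hU hS.
have mU : measurable_fun setT U by case: EU.
have := log_measure_bound EU U0 K0 r0 lam0 lam1 hK hU hS; rewrite eL => /(_ L1).
set A := [set x | (U x < lam)%R] `&` _ => hA.
apply: (DG (K := K)) => //.
  by apply: (supersol_sub _ hU); apply: oball_subr; lra.
have Af : mu A \is a fin_num.
  rewrite ge0_fin_numE//; apply: le_lt_trans (lebn_ball_lty x0 r); apply: le_measure; rewrite ?inE//.
  - apply: measurableI; last exact: measurable_oball.
    by rewrite -[X in measurable X]setTI; exact: measurable_fun_ltr.
  - exact: measurable_oball.
  - by move=> x [].
rewrite -/A -(fineK Af) lee_fin.
have a0 : 0 <= fine (mu A) by exact: fine_ge0.
have L0 : 0 < L by lra.
rewrite -(ler_pM2l L0); apply: (le_trans hA); rewrite -/C.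
have rd : 0 < r ^+ d by exact: exprn_gt0.
have -> : L * (v0 * (ms * r ^+ d)) = (v0 * ms + C) * r ^+ d.
  by rewrite /L; field; rewrite !gt_eqF.
apply: ler_wpM2r; first exact: ltW.
by rewrite lerDr mulr_ge0// ltW.
Qed.

End LowerBoundGrowth.

(** * Pointwise bounds of potentials *)

Section PotentialUpperBound.
Context {R : realType} {d : nat}.
Local Notation T := (pt R d).
Local Notation mu := (lebn (R := R) d).
Variables (k : T -> T -> R) (alpha alpha0 cF : R).
Hypothesis mk : measurable_fun setT (fun p : T * T => k p.1 p.2).
Hypothesis k0 : forall x y, 0 <= k x y.
Hypothesis d3 : (3 <= d)%N.
Hypotheses (alpha00 : 0 < alpha0) (alpha1 : alpha0 <= alpha) (alpha2 : alpha < 2).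
Hypothesis cF0 : 0 < cF.

Local Notation finE := (finE mu k).
Local Notation B := (B mu k).
Local Notation HO := (HO mu k).
Local Notation V := (vol1 (R := R) (d := d)).
Local Notation v0 := (V / 4).

Hypothesis FK : forall (w : T -> R) (A : set T) (rho : R), 0 < rho ->
    finE w -> rintegrable mu (fun x => w x ^+ 2) -> measurable A ->
    (mu A <= (v0 * rho ^+ d)%:E)%E ->
    (forall x, ~ A x -> w x = 0) ->
    cF * rho `^ (- alpha) * \int[mu]_x (w x ^+ 2) <= B w w.

(** Markov property of the form: (phi a - phi b)^2 <= (a - b) (phi a - phi b) for phi nondecreasing
    and 1-Lipschitz. *)
Lemma B_contraction (phi : R -> R) (u : T -> R) : finE u ->
  measurable_fun setT (fun x => phi (u x)) ->
  (forall a b, b <= a -> 0 <= phi a - phi b <= a - b) ->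
  finE (fun x => phi (u x)) /\ B (fun x => phi (u x)) (fun x => phi (u x)) <= B u (fun x => phi (u x)).
Proof.
move=> Eu mp hp.
have Ep : finE (fun x => phi (u x)).
  apply: (@finE_dom1 _ _ _ _ _ mk k0 1 u) => // x y; rewrite mul1r.
  have [h|/ltW h] := leP (u y) (u x).
    have /andP[h1 h2] := hp _ _ h; rewrite !ger0_norm//; lra.
  have /andP[h1 h2] := hp _ _ h; rewrite distrC [`|u x - _|]distrC !ger0_norm//; lra.
split=> //; apply: Rintegral_le; [exact: rintegrable_Q..|].
move=> p; rewrite /Q; apply: ler_wpM2r => //.
have [h|/ltW h] := leP (u p.2) (u p.1).
  by have /andP[h1 h2] := hp _ _ h; apply: ler_wpM2r.
have /andP[h1 h2] := hp _ _ h.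
rewrite -[phi (u p.1) - _]opprB -[u p.1 - _]opprB !mulrNN.
exact: ler_wpM2r.
Qed.

Variables (O : set T) (x0 : T) (eps : R) (u : T -> R).
Hypotheses (mO : measurable O) (Oy : (mu O < +oo)%E) (eps0 : 0 < eps).
Hypothesis Hu : HO O u.
Hypothesis u_eq : forall v, HO O v -> B u v = \int[mu]_x (\1_(oball x0 eps) x * v x).

Let mu_ : measurable_fun setT u. Proof. exact: HO_measurable Hu. Qed.
Let Eu : finE u. Proof. exact: HO_finE Hu. Qed.
Let mball : measurable (oball x0 eps). Proof. exact: measurable_oball. Qed.

Let V0 : 0 < V. Proof. exact: vol1_gt0. Qed.
Let v00 : 0 < v0. Proof. by rewrite divr_gt0. Qed.

Lemma contraction_HO (phi : R -> R) : measurable_fun setT (fun x => phi (u x)) ->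
  (forall a b, b <= a -> 0 <= phi a - phi b <= a - b) -> phi 0 = 0 ->
  HO O (fun x => phi (u x)) /\
  B (fun x => phi (u x)) (fun x => phi (u x)) <= \int[mu]_x (\1_(oball x0 eps) x * phi (u x)).
Proof.
move=> mp hp p0; have [Ep hB] := B_contraction Eu mp hp.
have Hp : HO O (fun x => phi (u x)).
  have [_ Lu zu] := Hu; split=> //; last by move=> x Ox; rewrite zu.
  apply: (@rintegrable_le _ _ _ _ (fun x => u x ^+ 2)) => //; first exact: measurable_funX.
  move=> x; rewrite normrX real_normK ?num_real//.
  have [h|/ltW h] := leP 0 (u x); have /andP[h1 h2] := hp _ _ h; rewrite p0 in h1 h2.
    by rewrite ler_sqr ?nnegrE//; lra.
  by rewrite -[leLHS]sqrrN -[leRHS]sqrrN ler_sqr ?nnegrE; lra.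
by split=> //; rewrite -u_eq.
Qed.

(** The energy of min(0, u) is at most the integral of a nonpositive function, and Faber-Krahn on {u
    < 0} then forces min(0, u) to vanish. *)
Lemma potential_ge0 : mu [set x | (u x < 0)%R] = 0%E.
Proof.
have hp (a b : R) : b <= a -> 0 <= Num.min 0 a - Num.min 0 b <= a - b.
  by move=> ba; case: (leP 0 a) => ha; case: (leP 0 b) => hb; apply/andP; split; lra.
have mp : measurable_fun setT (fun x => Num.min 0 (u x)) by exact: measurable_minr.
have [Hw hB] := contraction_HO mp hp (minxx _).
set w := (fun x => _) in Hw hB.
have mA : measurable [set x | u x < 0].
  by rewrite -[X in measurable X]setTI; exact: measurable_fun_ltr.
have w0 x : ~ [set x | u x < 0] x -> w x = 0.
  by move=> /= /negP; rewrite -leNgt /w => h; rewrite min_l.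
have AO : [set x | u x < 0] `<=` O.
  move=> x /= ux; apply: contrapT => /(let: And3 _ _ z := Hu in z) ux0.
  by move: ux; rewrite ux0 ltxx.
have Af : (mu [set x | (u x < 0)%R] < +oo)%E.
  by apply: le_lt_trans Oy; apply: le_measure; rewrite ?inE.
pose a := fine (mu [set x | (u x < 0)%R]).
have a0 : 0 <= a by exact: fine_ge0.
(* Any scale with v0 rho^d >= a will do; rho >= 1 gives rho^d >= rho, so a choice linear in [a]
   suffices. *)
pose rho := (a + 1) / v0 + 1.
have rho1 : 1 <= rho by rewrite lerDr divr_ge0 ?(ltW v00)//; lra.
have hA : (mu [set x | (u x < 0)%R] <= (v0 * rho ^+ d)%:E)%E.
  rewrite -(fineK (_ : mu [set x | (u x < 0)%R] \is a fin_num)) ?ge0_fin_numE// lee_fin -/a.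
  apply: (@le_trans _ _ (v0 * rho)).
    rewrite /rho mulrDr mulrCA mulfV ?gt_eqF// mulr1.
    by have := v00; lra.
  rewrite ler_wpM2l ?(ltW v00)// ler_eXnr//.
  by apply: leq_trans d3.
have rho0 : 0 < rho by lra.
have Lw : rintegrable mu (fun x => w x ^+ 2) by case: Hw.
have h1 := FK rho0 (HO_finE Hw) Lw mA hA w0.
have h2 : \int[mu]_x (\1_(oball x0 eps) x * w x) <= 0.
  rewrite -oppr_ge0 -mulN1r -RintegralZl//.
    apply: Rintegral_ge0 => x _; rewrite mulN1r oppr_ge0 mulr_ge0_le0//.
    by rewrite /w ge_min lexx.
  have mI : measurable_fun setT (\1_(oball x0 eps) : T -> R) by exact: measurable_indic.
  by apply: (psi_integrable mO Oy mI _ Hw (M := 1)) => // x; rewrite ger0_norm// indicE lern1 leq_b1.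
have c0 : 0 < cF * rho `^ (- alpha) by rewrite mulr_gt0// powR_gt0.
have h3 : \int[mu]_x (w x ^+ 2) <= 0.
  by rewrite -(ler_pM2l c0) mulr0; lra.
have w20 x : 0 <= w x ^+ 2 by exact: sqr_ge0.
have := Rintegral_eq0 (measurable_funX 2 (HO_measurable Hw)) w20 Lw h3.
move=> h4; apply/negligibleP => //; apply: negligibleS h4 => x /= ux.
rewrite /w min_r ?ltW// => h5; move: ux.
by move/eqP : h5; rewrite sqrf_eq0 => /eqP ->; rewrite ltxx.
Qed.

Let lv (s : R) : set T := [set x | s < u x].

Let mlv s : measurable (lv s).
Proof. by rewrite -[X in measurable X]setTI; exact: measurable_fun_ltr. Qed.

Let lvO s : 0 <= s -> lv s `<=` O.
Proof.
move=> s0 x /= sx; apply: contrapT => /(let: And3 _ _ z := Hu in z) ux0.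
by move: sx; rewrite /lv/= ux0 ltNge s0.
Qed.

Let lvy s : 0 <= s -> (mu (lv s) < +oo)%E.
Proof. by move=> s0; apply: le_lt_trans Oy; apply: le_measure; rewrite ?inE//; exact: lvO. Qed.

Let int_ball : \int[mu]_x (\1_(oball x0 eps) x) = eps ^+ d * V.
Proof. by rewrite Rintegral_indic// [X in fine X](lebn_ball x0 eps0). Qed.

(** Test with the truncation of u between s and t. Its energy is at most t - s times the volume of
    the source ball; Faber-Krahn on {u > s} and the value t - s on {u > t} bound it below. One
    factor t - s cancels. *)
Let weak_step s t rho : 0 < s -> s < t -> 0 < rho -> (mu (lv s) <= (v0 * rho ^+ d)%:E)%E ->
  cF * rho `^ (- alpha) * ((t - s) * fine (mu (lv t))) <= eps ^+ d * V.
Proof.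
move=> s0 st rho0 hs.
pose phi a := Num.min (t - s) (Num.max 0 (a - s)).
have hp (a b : R) : b <= a -> 0 <= phi a - phi b <= a - b.
  rewrite /phi => ba.
  have h1 : 0 <= Num.max 0 (a - s) - Num.max 0 (b - s) <= a - b.
    by case: (leP 0 (a - s)) => ha; case: (leP 0 (b - s)) => hb; apply/andP; split; lra.
  move: h1; set A := Num.max _ _; set C := Num.max _ _ => /andP[h1 h2].
  by case: (leP (t - s) A) => ha; case: (leP (t - s) C) => hb; apply/andP; split; lra.
have mp : measurable_fun setT (fun x => phi (u x)).
  apply: measurable_minr => //; apply: measurable_maxr => //.
  exact: measurable_funB.
have p0 : phi 0 = 0 by rewrite /phi sub0r max_l ?min_r ?oppr_le0 ?subr_ge0 ?(ltW st) ?(ltW s0).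
have [Hw hB] := contraction_HO mp hp p0.
have w0 x : ~ lv s x -> phi (u x) = 0.
  move=> /negP; rewrite -leNgt => h.
  by rewrite /phi max_l ?subr_le0// min_r// subr_ge0 ltW.
have pl a : phi a <= t - s by rewrite ge_min lexx.
have pg a : 0 <= phi a by rewrite le_min subr_ge0 (ltW st) le_max lexx.
have Lw : rintegrable mu (fun x => phi (u x) ^+ 2) by case: Hw.
have h1 := FK rho0 (HO_finE Hw) Lw (mlv s) hs w0.
have t0 : 0 <= t by lra.
have It : rintegrable mu (\1_(lv t) : T -> R) by apply: rintegrable_indic => //; exact: lvy.
have ts : 0 < t - s by lra.
have h2 : (t - s) ^+ 2 * fine (mu (lv t)) <= \int[mu]_x (phi (u x) ^+ 2).
  rewrite -(Rintegral_indic mu (mlv t)) -RintegralZl//; apply: Rintegral_le => //.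
    exact: rintegrableZ.
  move=> x; rewrite indicE; have [/set_mem h|_] := boolP (x \in lv t); last by rewrite mulr0 sqr_ge0.
  have -> : phi (u x) = t - s.
    by rewrite /phi min_l// le_max lerD2r (ltW h) orbT.
  by rewrite mulr1.
have IB : rintegrable mu (\1_(oball x0 eps) : T -> R) by exact: ball_indic_integrable.
have h3 : \int[mu]_x (\1_(oball x0 eps) x * phi (u x)) <= (t - s) * (eps ^+ d * V).
  rewrite -int_ball -RintegralZl//; apply: Rintegral_le.
  - apply: (@bounded_ball_integrable _ _ x0 eps (t - s)).
    + by apply: measurable_funM => //; exact: measurable_indic.
    + by move=> x; rewrite ger0_norm ?mulr_ge0// -[leRHS]mul1r ler_pM// indicE lern1 leq_b1.
    + by move=> x h; rewrite indicE memNset ?mul0r.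
  - exact: rintegrableZ.
  - by move=> x; rewrite mulrC; apply: ler_wpM2r.
have c0 : 0 <= cF * rho `^ (- alpha) by rewrite mulr_ge0 ?powR_ge0// ltW.
have h4 := ler_wpM2l c0 h2.
rewrite -(ler_pM2l ts).
apply: le_trans h3; apply: le_trans hB; apply: le_trans h1; apply: le_trans h4.
by rewrite le_eqVlt; apply/orP; left; apply/eqP; ring.
Qed.

(** The value for which [weak_step] at level [slev rho] returns exactly v0 (rho/2)^d. *)
Definition weak_const : R := 4 * 2 ^+ d / cF.

Let weak_const_gt0 : 0 < weak_const.
Proof. by rewrite divr_gt0// mulr_gt0// exprn_gt0. Qed.

(** The expected size, at distance rho, of the potential of a ball of radius eps. *)
Let slev rho := weak_const * eps ^+ d * rho `^ (alpha - d%:R).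

Let slev_gt0 rho : 0 < rho -> 0 < slev rho.
Proof. by move=> r0; rewrite mulr_gt0 ?powR_gt0// mulr_gt0 ?exprn_gt0. Qed.

Let d3R : 3 <= (d%:R : R). Proof. by rewrite ler_nat. Qed.

(** As d - alpha >= 1, the level at rho/2 is at least twice the level at rho, so the gap between
    them is at least the latter. *)
Let weak_half rho : 0 < rho -> (mu (lv (slev rho)) <= (v0 * rho ^+ d)%:E)%E ->
  (mu (lv (slev (rho / 2))) <= (v0 * (rho / 2) ^+ d)%:E)%E.
Proof.
move=> r0 h; have s0 := slev_gt0 r0.
have r20 : 0 < rho / 2 by rewrite divr_gt0.
have e2 : 2 * slev rho <= slev (rho / 2).
  rewrite /slev [leLHS]mulrCA; apply: ler_wpM2l.
    by rewrite mulr_ge0 ?exprn_ge0 ?(ltW eps0) ?(ltW weak_const_gt0).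
  rewrite powRM ?(ltW r0)// mulrC; apply: ler_wpM2l; first exact: powR_ge0.
  rewrite -powR_inv1// -powRrM mulN1r opprB.
  rewrite -[leLHS](powRr1 (ler0n R 2)); apply: ler_powR; first by rewrite ler1n.
  by have := d3R; have := alpha2; lra.
have st : slev rho < slev (rho / 2) by lra.
have := weak_step s0 st r0 h; set t := slev (rho / 2) in e2 st *; set X := fine _ => h1.
have Xf : mu (lv t) \is a fin_num by rewrite ge0_fin_numE//; apply: lvy; lra.
rewrite -(fineK Xf) lee_fin -/X.
have X0 : 0 <= X by exact: fine_ge0.
have c0 : 0 < cF * rho `^ (- alpha) by rewrite mulr_gt0// powR_gt0.
have h2 : cF * rho `^ (- alpha) * (slev rho * X) <= eps ^+ d * V.
  apply: le_trans h1; apply: ler_wpM2l; first exact: ltW.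
  by apply: ler_wpM2r => //; lra.
have rd : 0 < rho ^+ d by exact: exprn_gt0.
have ed : 0 < eps ^+ d by exact: exprn_gt0.
have c1 : 0 < 4 * 2 ^+ d * eps ^+ d / rho ^+ d by rewrite divr_gt0// mulr_gt0// mulr_gt0// exprn_gt0.
have e3 : cF * rho `^ (- alpha) * (slev rho * X) = 4 * 2 ^+ d * eps ^+ d / rho ^+ d * X.
  rewrite /slev /weak_const powRD; last by apply/implyP => _; rewrite gt_eqF.
  rewrite !powRN powR_mulrn ?(ltW r0)//; field.
  by rewrite !gt_eqF ?powR_gt0.
rewrite e3 in h2; rewrite -(ler_pM2l c1); apply: (le_trans h2).
rewrite expr_div_n le_eqVlt; apply/orP; left; apply/eqP; field.
by rewrite !gt_eqF ?exprn_gt0.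
Qed.

(* The level attached to [rho] at least doubles when [rho] is halved, so a bound at
   scale [rho] passes to [rho / 2]; it holds trivially for [rho] large. *)
Lemma potential_weak_type rho : 0 < rho ->
  (mu [set x | (weak_const * eps ^+ d * rho `^ (alpha - d%:R) < u x)%R] <= (v0 * rho ^+ d)%:E)%E.
Proof.
move=> r0; rewrite -/(slev rho) -/(lv _).
have key N : forall rho', 0 < rho' -> (mu O <= (v0 * (2 ^+ N * rho') ^+ d)%:E)%E ->
   (mu (lv (slev rho')) <= (v0 * rho' ^+ d)%:E)%E.
  elim: N => [|N IH] rho' r0' hO.
    rewrite expr0 mul1r in hO; apply: le_trans hO; apply: le_measure; rewrite ?inE//.
    by apply: lvO; exact/ltW/slev_gt0.
  have -> : rho' = (2 * rho') / 2 by field.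
  apply: weak_half; first by rewrite mulr_gt0.
  apply: IH; first by rewrite mulr_gt0.
  by rewrite mulrA -exprSr.
pose o := fine (mu O).
have o0 : 0 <= o by exact: fine_ge0.
pose N := Num.Def.trunc (o / v0 / rho + rho^-1).
apply: (key N.+1) => //.
rewrite -(fineK (_ : mu O \is a fin_num)) ?ge0_fin_numE// lee_fin -/o.
have hN : o / v0 / rho + rho^-1 <= 2 ^+ N.+1.
  apply: (le_trans (ltW (truncnS_gt _))); rewrite -natrX ler_nat; exact/ltnW/ltn_expl.
have h1 : o / v0 + 1 <= 2 ^+ N.+1 * rho.
  rewrite -ler_pdivrMr//; apply: le_trans hN.
  by rewrite mulrDl mul1r.
have ov : 0 <= o / v0 by rewrite divr_ge0 ?(ltW v00).
apply: (@le_trans _ _ (v0 * (2 ^+ N.+1 * rho))).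
  rewrite [leRHS]mulrC -ler_pdivrMr//; apply: le_trans h1.
  by rewrite lerDl.
apply: ler_wpM2l; first exact: ltW.
apply: ler_eXnr; first exact: leq_trans d3.
by apply: le_trans h1; rewrite lerDr.
Qed.

Let beta : R := alpha0 / d%:R.

Variables ms q : R.
Hypotheses (ms01 : 0 < ms <= 1) (q01 : 0 < q < 1) (qb : q `^ beta = 16^-1).
Hypothesis Cms : 4 / (weak_const * cF) ^+ 2 * ms `^ beta <= q.

(** The weak-type bound at scale ms eps makes {u > S} of measure at most v0 ms eps^d, with S of
    order eps^alpha; this starts a De Giorgi iteration on the levels S (2 - 2^-j), which ends at 2
    S. Positive parts of u - s belong to H_Omega, so truncation alone provides the test functions
    and the radii stay fixed. *)
Lemma potential_upper_bound :
  mu [set x | (2 * weak_const * ms ^- d * eps `^ alpha < u x)%R] = 0%E.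
Proof.
have /andP[ms0 ms1] := ms01; have /andP[q0 q1] := q01.
have d0 : (0 < d)%N by exact: leq_trans d3.
have b0 : 0 < beta by rewrite divr_gt0// ltr0n.
pose S := slev (ms * eps).
have me0 : 0 < ms * eps by rewrite mulr_gt0.
have S0 : 0 < S by exact: slev_gt0.
have ea0 : 0 < eps `^ alpha by exact: powR_gt0.
have eS : S = weak_const * ms `^ (alpha - d%:R) * eps `^ alpha.
  rewrite /S /slev powRM ?(ltW ms0) ?(ltW eps0)//.
  rewrite [eps `^ (alpha - _)]powRD; last by apply/implyP => _; rewrite gt_eqF.
  rewrite powRN powR_mulrn ?(ltW eps0)//; field.
  by rewrite expf_neq0// gt_eqF.
have Sge : weak_const * eps `^ alpha <= S.
  rewrite eS; apply: ler_wpM2r; first exact: ltW.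
  rewrite ler_peMr ?(ltW weak_const_gt0)// -[leLHS](powRr0 ms); apply: ger_powR; first by rewrite ms0.
  by have := d3R; have := alpha2; lra.
have Sle : 2 * S <= 2 * weak_const * ms ^- d * eps `^ alpha.
  rewrite (_ : 2 * S = 2 * weak_const * ms `^ (alpha - d%:R) * eps `^ alpha); last by rewrite eS; ring.
  apply: ler_wpM2r; first exact: ltW.
  apply: ler_wpM2l; first by rewrite mulr_ge0// ltW.
  rewrite -powR_invn ?(ltW ms0)//; apply: ger_powR; first by rewrite ms0.
  by have := alpha00; have := alpha1; lra.
pose h : R := 2^-1; have h0 : 0 < h by rewrite /h.
have h1 : h < 1 by rewrite /h; lra.
have hj0 j : 0 < h ^+ j by exact: exprn_gt0.
have hj1 j : h ^+ j <= 1 by rewrite exprn_ile1// ltW.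
pose sj (j : nat) : R := S * (2 - h ^+ j).
have sj0 j : 0 < sj j by rewrite mulr_gt0//; have := hj1 j; lra.
have key j : (mu (lv (sj j)) <= (v0 * ((ms * q ^+ j) * eps ^+ d))%:E)%E.
  elim: j => [|j IH].
    have -> : sj 0%N = S by rewrite /sj expr0; ring.
    apply: (le_trans (potential_weak_type me0)).
    rewrite lee_fin expr0 mulr1 exprMn; apply: ler_wpM2l; first exact: ltW.
    apply: ler_wpM2r; first by rewrite exprn_ge0 ?(ltW eps0).
    by rewrite ler_iXnr ?(ltW ms0).
  pose m := ms * q ^+ j.
  have m0 : 0 < m by rewrite mulr_gt0// exprn_gt0.
  have m1 : m <= 1 by rewrite mulr_ile1 ?(ltW ms0) ?exprn_ge0 ?exprn_ile1 ?(ltW q0) ?(ltW q1).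
  pose s := sj j; have s0 : 0 < s by exact: sj0.
  pose phi a := Num.max 0 (a - s).
  have hp (a b : R) : b <= a -> 0 <= phi a - phi b <= a - b.
    rewrite /phi => ba.
    by case: (leP 0 (a - s)) => ha; case: (leP 0 (b - s)) => hb; apply/andP; split; lra.
  have mp : measurable_fun setT (fun x => phi (u x)).
    by apply: measurable_maxr => //; exact: measurable_funB.
  have p0 : phi 0 = 0 by rewrite /phi sub0r max_l ?oppr_le0 ?(ltW s0).
  have [Hw hB] := contraction_HO mp hp p0.
  have w0 x : ~ lv s x -> phi (u x) = 0.
    by move=> /negP; rewrite -leNgt => hx; rewrite /phi max_l ?subr_le0.
  have pg a : 0 <= phi a by rewrite le_max lexx.
  have Lw : rintegrable mu (fun x => phi (u x) ^+ 2) by case: Hw.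
  have hf := faber_krahn_relative d0 alpha1 cF0 FK eps0 m0 m1 (HO_finE Hw) Lw (mlv s) IH w0.
  have Is : rintegrable mu (\1_(lv s) : T -> R) by apply: rintegrable_indic => //; apply: lvy; exact: ltW.
  have It : rintegrable mu (\1_(lv (sj j.+1)) : T -> R) by apply: rintegrable_indic => //; apply: lvy; exact: ltW.
  pose eta := cF * eps `^ (- alpha) * m `^ (- beta).
  have eta0 : 0 < eta.
    by rewrite /eta mulr_gt0 ?powR_gt0// mulr_gt0 ?powR_gt0.
  rewrite -/beta -/eta in hf.
  pose Z := v0 * (m * eps ^+ d).
  have Z0 : 0 < Z by rewrite /Z mulr_gt0// mulr_gt0// exprn_gt0.
  (* Young's inequality weighted by [eta], the Faber-Krahn constant of this level set: half of the
     L^2 term is then absorbed on the left. *)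
  have hb : \int[mu]_x (\1_(oball x0 eps) x * phi (u x)) <= eta / 2 * \int[mu]_x (phi (u x) ^+ 2) + (2 * eta)^-1 * Z.
    have Z1 : \int[mu]_x (\1_(lv s) x) <= Z by rewrite -lee_fin EFin_Rintegral// integral_indic// setIT.
    apply: (@le_trans _ _ (eta / 2 * \int[mu]_x (phi (u x) ^+ 2) + (2 * eta)^-1 * \int[mu]_x (\1_(lv s) x))).
      rewrite -Rintegral_lin//; apply: Rintegral_le.
      - have mI : measurable_fun setT (\1_(oball x0 eps) : T -> R) by exact: measurable_indic.
        by apply: (psi_integrable mO Oy mI _ Hw (M := 1)) => // x; rewrite ger0_norm// indicE lern1 leq_b1.
      - by apply: rintegrableD; exact: rintegrableZ.
      - move=> x; have [hx|hx] := pselect (lv s x); last first.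
          by rewrite w0// mulr0 expr0n/= mulr0 add0r mulr_ge0// invr_ge0 mulr_ge0// ltW.
        rewrite [X in _ <= _ + _ * X]indicE mem_set// mulr1.
        apply: (@le_trans _ _ (phi (u x))); first by rewrite ler_piMl// indicE lern1 leq_b1.
        set y := phi (u x); have e2 : 0 < 2 * eta by rewrite mulr_gt0.
        rewrite -(ler_pM2l e2) mulrDr mulfV ?gt_eqF//.
        by have := sqr_ge0 (eta * y - 1); lra.
    by rewrite lerD2l ler_wpM2l// invr_ge0 mulr_ge0// ltW.
  set I := \int[mu]_x (phi (u x) ^+ 2) in hf hb *.
  have hI : eta ^+ 2 * I <= Z.
    have h2 : eta * I <= eta / 2 * I + (2 * eta)^-1 * Z by lra.
    have e2 : 0 < 2 * eta by rewrite mulr_gt0.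
    have := ler_wpM2l (ltW e2) h2; rewrite [leRHS]mulrDr [2 * eta * (_^-1 * _)]mulrA mulfV ?gt_eqF// mul1r; lra.
  have ds : sj j.+1 - s = S * (h ^+ j / 2) by rewrite /s /sj exprS /h; field.
  have dsp : 0 < S * (h ^+ j / 2) by rewrite mulr_gt0// divr_gt0.
  have h2 : (S * (h ^+ j / 2)) ^+ 2 * fine (mu (lv (sj j.+1))) <= I.
    rewrite -(Rintegral_indic mu (mlv (sj j.+1))) -RintegralZl//; apply: Rintegral_le => //.
      exact: rintegrableZ.
    move=> x; rewrite indicE; have [/set_mem hx|_] := boolP (x \in lv _); last by rewrite mulr0 sqr_ge0.
    rewrite mulr1 ler_sqr ?nnegrE ?(ltW dsp)//.
    rewrite -ds /phi le_max; apply/orP; right; rewrite lerD2r; exact: ltW.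
  have Xf : mu (lv (sj j.+1)) \is a fin_num by rewrite ge0_fin_numE//; apply: lvy; exact: ltW.
  rewrite -(fineK Xf) lee_fin; set X := fine _ in h2 *.
  suff hX : X <= q * Z.
    apply: (le_trans hX); rewrite /Z /m exprS le_eqVlt; apply/orP; left; apply/eqP; ring.
  have X0 : 0 <= X by exact: fine_ge0.
  pose g := h ^+ j; have gp : 0 < g by exact: hj0.
  have g1 : g <= 1 by exact: hj1.
  have h3 : eta ^+ 2 * ((S * (g / 2)) ^+ 2 * X) <= Z.
    by apply: le_trans hI; rewrite ler_wpM2l// sqr_ge0.
  have mb : m `^ (- beta) = (ms `^ beta)^-1 * g ^- 4.
    rewrite /m powRM ?(ltW ms0) ?exprn_ge0 ?(ltW q0)// !powRN; congr (_ * _).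
    rewrite -(powR_mulrn _ (ltW q0)) -powRrM mulrC powRrM powR_mulrn ?powR_ge0// qb.
    by rewrite /g -exprM mulnC exprM; congr ((_ ^+ j)^-1); rewrite /h; field.
  have msb : 0 < ms `^ beta by exact: powR_gt0.
  have msb1 : ms `^ beta <= 1.
    by rewrite -[leRHS](powRr0 ms); apply: ger_powR; [rewrite ms0|exact: ltW].
  have le1 : (weak_const * cF * ((ms `^ beta)^-1 * g ^- 4) * (g / 2)) ^+ 2 * X <= Z.
    apply: le_trans h3; rewrite [leRHS]mulrA -exprMn; apply: ler_wpM2r => //.
    have e4 : weak_const * cF * ((ms `^ beta)^-1 * g ^- 4) * (g / 2) <= eta * (S * (g / 2)).
      have -> : weak_const * cF * ((ms `^ beta)^-1 * g ^- 4) * (g / 2) = eta * (weak_const * eps `^ alpha * (g / 2)).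
        rewrite /eta mb powRN; field.
        by rewrite !gt_eqF.
      apply: ler_wpM2l; first exact: ltW.
      by apply: ler_wpM2r => //; rewrite divr_ge0// ltW.
    rewrite ler_sqr ?nnegrE//.
      apply/ltW; apply: mulr_gt0; last by rewrite divr_gt0.
      by apply: mulr_gt0; apply: mulr_gt0 => //; rewrite invr_gt0// exprn_gt0.
    by rewrite mulr_ge0 ?(ltW eta0) ?(ltW dsp).
  pose D := weak_const * cF.
  have D0 : 0 < D by rewrite mulr_gt0.
  have hq : 4 / D ^+ 2 <= q / ms `^ beta by rewrite ler_pdivlMr.
  have c0 : 0 < (D * ((ms `^ beta)^-1 * g ^- 4) * (g / 2)) ^+ 2.
    by rewrite exprn_gt0// mulr_gt0 ?divr_gt0// mulr_gt0// mulr_gt0 ?invr_gt0// exprn_gt0.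
  rewrite -(ler_pM2l c0); apply: (le_trans le1).
  rewrite -[leLHS]mul1r [leRHS]mulrA; apply: ler_wpM2r; first exact: ltW.
  (* The gain exceeds the loss: the surplus g^-6 / ms^beta is at least 1 and is dropped. *)
  have -> : (D * ((ms `^ beta)^-1 * g ^- 4) * (g / 2)) ^+ 2 * q =
     (D ^+ 2 / 4 * (q / ms `^ beta)) * ((ms `^ beta)^-1 * (g ^- 6)).
    by field; rewrite !gt_eqF.
  apply: (@le_trans _ _ (1 * 1)); first by rewrite mulr1.
  apply: ler_pM => //.
    have D4 : 0 <= D ^+ 2 / 4 by rewrite divr_ge0// sqr_ge0.
    apply: le_trans (ler_wpM2l D4 hq); rewrite le_eqVlt; apply/orP; left; apply/eqP; field.
    by rewrite gt_eqF.
  rewrite -[leLHS]mulr1; apply: ler_pM => //; first by rewrite invf_ge1.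
  by rewrite -exprVn exprn_ege1// invf_ge1.
set C := 2 * _ * _ * _ in Sle *.
have C0 : 0 <= C by lra.
rewrite -/(lv C).
have Yf : mu (lv C) \is a fin_num by rewrite ge0_fin_numE//; exact: lvy.
have : fine (mu (lv C)) <= 0.
  apply: (@geometric_bound_le0 _ _ (v0 * (ms * eps ^+ d)) q q01) => n.
  rewrite -lee_fin fineK//.
  apply: (@le_trans _ _ (mu (lv (sj n)))).
    apply: le_measure; rewrite ?inE//.
    move=> x; rewrite /lv/=; apply: le_lt_trans; apply: le_trans Sle.
    rewrite [leRHS]mulrC; apply: ler_wpM2l; first exact: ltW.
    by have := hj0 n; lra.
  apply: le_trans (key n) _; rewrite lee_fin le_eqVlt; apply/orP; left; apply/eqP; ring.
move=> Y0; apply/eqP; rewrite eq_le measure_ge0 andbT.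
by rewrite -(fineK Yf) lee_fin.
Qed.

End PotentialUpperBound.

(** * Continuity of weak solutions *)

Section EssentialLimsup.
Context {R : realType} {d : nat}.
Local Notation T := (pt R d).
Local Notation mu := (lebn (R := R) d).
Implicit Types (u : T -> R) (x z : T).

Definition local_ae_bounds u x : set R :=
  [set c | exists2 r : R, 0 < r & mu ([set y | c < u y] `&` oball x r) = 0%E].

(** The essential lower limit is encoded as the opposite of [esslimsup] of - u, so that each fact is
    proved once and used on both sides. *)
Definition esslimsup u x : R := inf (local_ae_bounds u x).

Let mgt u c : measurable_fun setT u -> measurable [set y | c < u y].
Proof. by move=> mu_; rewrite -[X in measurable X]setTI; exact: measurable_fun_ltr. Qed.

Let mgtI u c x r : measurable_fun setT u -> measurable ([set y | c < u y] `&` oball x r).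
Proof. by move=> mu_; apply: measurableI; [exact: mgt|exact: measurable_oball]. Qed.

Lemma local_ae_bound_le u x c c' : measurable_fun setT u -> c <= c' ->
  local_ae_bounds u x c -> local_ae_bounds u x c'.
Proof.
move=> mu_ cc [r r0 h]; exists r => //; apply: (@subset_measure0 _ _ _ _ _ _ _ _ _ h).
- exact: mgtI.
- exact: mgtI.
- by move=> y [/= h1 h2]; split => //=; apply: le_lt_trans h1.
Qed.

Lemma ball_not_sub_null (A : set T) x r : 0 < r -> mu (A `&` oball x r) = 0%E ->
  exists2 y, oball x r y & ~ A y.
Proof.
move=> r0 h; apply: contrapT => hn.
have e : A `&` oball x r = oball x r.
  apply/setIidPr => y hy; apply: contrapT => hA; apply: hn; by exists y.
move: h; rewrite e (lebn_ball x r0) => -[] /eqP.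
by rewrite gt_eqF// mulr_gt0 ?exprn_gt0 ?vol1_gt0.
Qed.

Lemma local_ae_bounds_opp u x c c' : measurable_fun setT u ->
  local_ae_bounds u x c -> local_ae_bounds (fun y => - u y) x c' -> 0 <= c + c'.
Proof.
move=> mu_ [r r0 h] [r' r0' h'].
have mn : measurable_fun setT (fun y => - u y) by exact: measurableT_comp.
pose s := Num.min r r'; have s0 : 0 < s by rewrite lt_min r0.
pose A := [set y | c < u y] `|` [set y | c' < - u y].
have [||y hy hA] := @ball_not_sub_null A x s => //.
  have sr : s <= r by rewrite ge_min lexx.
  have sr' : s <= r' by rewrite ge_min lexx orbT.
  have m1 t : measurable ([set y | c < u y] `&` oball x t) by exact: mgtI.
  have m2 t : measurable ([set y | c' < - u y] `&` oball x t) by exact: mgtI.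
  rewrite /A setIUl measureU0 //.
    by apply: subset_measure0 h => // y [h1 h2]; split => //; exact: oball_subr h2.
  by apply: subset_measure0 h' => // y [h1 h2]; split => //; exact: oball_subr h2.
move: hA; rewrite /A/= => /not_orP[/negP]; rewrite -leNgt => h1 /negP; rewrite -leNgt => h2.
lra.
Qed.

Variables (u : T -> R) (M : R).
Hypotheses (mu_ : measurable_fun setT u) (uM : forall x, `|u x| <= M).

Let mnu : measurable_fun setT (fun y => - u y). Proof. exact: measurableT_comp. Qed.

Lemma local_ae_boundsM x : local_ae_bounds u x M.
Proof.
exists 1 => //; rewrite (_ : _ `&` _ = set0) ?measure0//.
apply/seteqP; split => y //= [h _]; have := uM y; rewrite ler_norml => /andP[_ h2]; lra.
Qed.

Lemma local_ae_boundsN x : local_ae_bounds (fun y => - u y) x M.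
Proof.
exists 1 => //; rewrite (_ : _ `&` _ = set0) ?measure0//.
apply/seteqP; split => y //= [h _]; have := uM y; rewrite ler_norml => /andP[h2 _]; lra.
Qed.

Lemma has_inf_local x : has_inf (local_ae_bounds u x).
Proof.
split; first by exists M; exact: local_ae_boundsM.
by exists (- M) => c /local_ae_bounds_opp /(_ (local_ae_boundsN x)) => /(_ mu_); lra.
Qed.

Lemma esslimsup_le x c : local_ae_bounds u x c -> esslimsup u x <= c.
Proof. by apply: ge_inf; case: (has_inf_local x). Qed.

Lemma esslimsup_lt x c : esslimsup u x < c -> local_ae_bounds u x c.
Proof.
move=> h; have [c' hc'] := inf_lt (has_inf_local x).1 h.
by move=> cc; apply: local_ae_bound_le hc' => //; exact: ltW.
Qed.

Lemma esslimsup_ball_le x r z c : oball x r z ->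
  mu ([set y | c < u y] `&` oball x r) = 0%E -> esslimsup u z <= c.
Proof.
move=> xz h; apply: esslimsup_le; exists (r - eucl x z); first by rewrite subr_gt0.
apply: subset_measure0 h.
- exact: mgtI.
- exact: mgtI.
- by move=> y [h1 h2]; split => //; apply: (@oball_sub _ _ x z r (r - eucl x z)) => //; lra.
Qed.

Lemma esslimsup_usc x c : esslimsup u x < c ->
  exists2 r, 0 < r & forall z, oball x r z -> esslimsup u z < c.
Proof.
move=> h; have h1 : esslimsup u x < (esslimsup u x + c) / 2 by lra.
have [r r0 hr] := esslimsup_lt h1; exists r => // z xz.
by have := esslimsup_ball_le xz hr; lra.
Qed.

Lemma measurable_esslimsup : measurable_fun setT (esslimsup u).
Proof.
apply: (measurability _ (RGenInftyO.measurableE R)) => _ [_ [c ->] <-].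
rewrite setTI; apply: is_open_measurable => x /=; rewrite in_itv/= => h.
have [r r0 hr] := esslimsup_usc h; by exists r => // z /hr.
Qed.

(** If [u x] exceeds the essential upper limit, a rational c lies between them and some rational
    ball around x meets {u > c} in a null set. The exceptional points are thus covered by the null
    sets among countably many candidates; [F] is empty for the others. *)
Lemma esslimsup_ae : mu.-negligible [set x | esslimsup u x < u x].
Proof.
pose F (p : rat * d.-tuple rat * nat) : set T :=
  [set y | mu ([set y | ratr p.1.1 < u y] `&` oball (rat_pt p.1.2) p.2.+1%:R^-1) = 0%E /\
     ([set y | ratr p.1.1 < u y] `&` oball (rat_pt p.1.2) p.2.+1%:R^-1) y].
pose G n := if unpickle n is Some p then F p else set0.
apply: (@negligibleS _ _ _ _ (\bigcup_n G n)); last first.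
  apply: negligible_bigcup => n; rewrite /G; case: unpickle => [p|]; last exact: negligible_set0.
  have [h|h] := pselect (mu ([set y | ratr p.1.1 < u y] `&` oball (rat_pt p.1.2) p.2.+1%:R^-1) = 0%E).
    by exists ([set y | ratr p.1.1 < u y] `&` oball (rat_pt p.1.2) p.2.+1%:R^-1); split=> [|//|y []//]; exact: mgtI.
  have -> : F p = set0 by apply/seteqP; split => // y [].
  exact: negligible_set0.
move=> x /= sx.
have [c] := rat_in_itvoo sx; rewrite in_itv => /andP[c1 c2].
have [r r0 hr] := esslimsup_lt c1.
have [q [n [h1 h2]]] := open_set_cover (@is_open_oball _ _ x r) (oball_center x r0).
move: (pickle (c, q, n)) (pickleK (c, q, n)) => i hi.
exists i; first exact: I.
rewrite /G hi; split; last by split.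
apply: subset_measure0 hr.
- exact: mgtI.
- exact: mgtI.
- by move=> y [h3 h4]; split => //; exact: h2.
Qed.

End EssentialLimsup.

(** * Oscillation of a solution at a point *)

Section Oscillation.
Context {R : realType} {d : nat}.
Local Notation T := (pt R d).
Local Notation mu := (lebn (R := R) d).
Local Notation P := (mu \x mu)%E.
Variables (k : T -> T -> R) (alpha cU : R).
Hypothesis mk : measurable_fun setT (fun p : T * T => k p.1 p.2).
Hypothesis k0 : forall x y, 0 <= k x y.
Hypothesis ksym : forall x y, k x y = k y x.
Hypothesis cU0 : 0 < cU.
Hypothesis hU1 : U1 alpha k cU.
Hypothesis alpha0 : 0 < alpha.

Local Notation finE := (finE mu k).
Local Notation B := (B mu k).
Local Notation HO := (HO mu k).
Local Notation V := (vol1 (R := R) (d := d)).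

(** 2 M times the bound from [U1] for the mass of [k] at distance at least rho, which is of order
    rho^(-alpha). *)
Definition tail_const (rho M : R) : R := 2 * M * (rho ^- 2 * (cU * rho `^ (2 - alpha))).

(** Since z vanishes near the support of v, the only contributing pairs join the ball of radius rho
    to the outside of the ball of radius 2 rho, and each contributes with a negative sign. On them
    the weight [g] equals 1; elsewhere it only lowers the bound, and [U1] integrates it. *)
Lemma tail_form_ge (z v : T -> R) (x0 : T) (rho M : R) : 0 < rho ->
  finE z -> (forall x, 0 <= z x <= M) -> (forall x, oball x0 (2 * rho) x -> z x = 0) ->
  HO (oball x0 rho) v -> (forall x, 0 <= v x) ->
  - tail_const rho M * \int[mu]_x v x <= B z v.
Proof.
move=> r0 Ez zM z0 Hv v0.
pose g (x y : T) := rho ^- 2 * Num.min (rho ^+ 2) (eucl y x ^+ 2).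
have M0 : 0 <= M by have /andP[h1 h2] := zM x0; lra.
have i0 : 0 <= rho ^- 2 by rewrite invr_ge0 exprn_ge0// ltW.
have mg : measurable_fun setT (fun p : T * T => g p.1 p.2).
  apply: measurable_funM => //; apply: measurable_minr => //.
  by apply: measurable_funX; apply: measurable_eucl.
have g0 x y : 0 <= g x y by rewrite mulr_ge0// le_min !sqr_ge0.
have gs x y : g x y = g y x by rewrite /g eucl_sym.
have Iv : rintegrable mu v.
  have := HO_abs_integrable (measurable_oball x0 rho) (lebn_ball_lty x0 rho) Hv.
  by congr (rintegrable mu _); apply/funext => x; rewrite ger0_norm.
have hk := kernel_section_le mk k0 hU1 r0 i0 mg g0 (fun x y => lexx _).
have [I1 h1] := weighted_kernel_le mk k0 mg g0 hk v0 Iv.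
have [I2 h2] := swap_kernel mk k0 ksym gs mg g0 (rintegrable_measurable Iv) v0 I1.
set C := rho ^- 2 * _ in h1.
have e : - tail_const rho M * \int[mu]_x v x = - (2 * M) * (C * \int[mu]_x v x).
  by rewrite /tail_const -/C; ring.
apply: (@le_trans _ _ (- M * \int[P]_p (v p.1 * (g p.1 p.2 * k p.1 p.2)) +
                       - M * \int[P]_p (v p.2 * (g p.1 p.2 * k p.1 p.2)))).
  rewrite e h2 -mulrDl.
  have := ler_wpM2l M0 h1; lra.
rewrite -Rintegral_lin//; apply: Rintegral_le.
- by apply: rintegrableD; exact: rintegrableZ.
- by apply: rintegrable_Q => //; exact: HO_finE Hv.
have [_ _ vz] := Hv.
have far (x y : T) : oball x0 rho x -> ~ oball x0 (2 * rho) y -> g x y = 1.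
  move=> hx /negP; rewrite -leNgt => hy.
  have h : rho <= eucl y x.
    by have := eucl_triangle x x0 y; rewrite [eucl x y]eucl_sym; move: hx hy; rewrite /oball/=; lra.
  rewrite /g min_l ?mulVf ?gt_eqF ?exprn_gt0//.
  by rewrite ler_sqr ?nnegrE ?eucl_ge0// ltW.
move=> -[x y]; rewrite /Q/=.
have -> : - M * (v x * (g x y * k x y)) + - M * (v y * (g x y * k x y)) =
  (- M * ((v x + v y) * g x y)) * k x y by ring.
apply: ler_wpM2r => //.
have vg0 : - M * ((v x + v y) * g x y) <= 0.
  by rewrite mulNr oppr_le0 mulr_ge0// mulr_ge0// addr_ge0.
have in2 (w : T) : oball x0 rho w -> oball x0 (2 * rho) w by apply: oball_subr; lra.
have [hx|hx] := pselect (oball x0 rho x); have [hy|hy] := pselect (oball x0 rho y).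
- by rewrite !z0 ?subrr ?mul0r//; exact: in2.
- rewrite (z0 x (in2 _ hx)) (vz y hy) subr0 sub0r addr0 in vg0 *.
  have [hy2|hy2] := pselect (oball x0 (2 * rho) y); first by rewrite (z0 y hy2) oppr0 mul0r.
  rewrite (far x y)// mulr1 !mulNr lerN2; apply: ler_wpM2r => //.
  by have /andP[] := zM y.
- rewrite (z0 y (in2 _ hy)) (vz x hx) subr0 sub0r add0r in vg0 *.
  have [hx2|hx2] := pselect (oball x0 (2 * rho) x); first by rewrite (z0 x hx2) mul0r.
  rewrite gs (far y x)// mulr1 mulNr mulrN lerN2; apply: ler_wpM2r => //.
  by have /andP[] := zM x.
- by rewrite (vz x hx) (vz y hy) subrr mulr0 addr0 mul0r mulr0.
Qed.

Variable lam : R.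
Hypothesis lam0 : 0 < lam.
Hypothesis growth_lemma : forall (U : T -> R) (x0 : T) (K r : R),
  finE U -> (forall x, 0 <= U x) -> 0 <= K -> 0 < r -> K <= lam * r `^ (- alpha) ->
  supersol k (oball x0 (2 * r)) (- K) U ->
  (mu ([set x | (1 <= U x)%R] `&` oball x0 r) >= (r ^+ d * V / 2)%:E)%E ->
  mu ([set x | (U x < lam / 2)%R] `&` oball x0 (r / 2)) = 0%E.

(** [growth_lemma] asks for nonnegativity everywhere, while u + h is nonnegative only almost
    everywhere near x0. Its positive part [W] is used instead. The negative part, cleared of the
    null set [N], vanishes on the ball and adds a source [KT] independent of r, so K + KT <= lam
    r^(-alpha) for small r. The shift h gives W >= 1 where u >= 0, and u >= - (1 - lam/4) where W >=
    lam/2. *)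
Lemma lower_oscillation (u : T -> R) (x0 : T) (r0 K M : R) :
  finE u -> (forall x, `|u x| <= M) -> 0 < r0 -> 0 <= K ->
  supersol k (oball x0 r0) (- K) u ->
  mu ([set x | (u x < - (1 + lam / 4))%R] `&` oball x0 r0) = 0%E ->
  exists2 r1, 0 < r1 & forall r, 0 < r -> r <= r1 ->
    (mu ([set x | (0 <= u x)%R] `&` oball x0 r) >= (r ^+ d * V / 2)%:E)%E ->
    mu ([set x | (u x < - (1 - lam / 4))%R] `&` oball x0 (r / 2)) = 0%E.
Proof.
move=> Eu uM r00 K0 su hN.
set h := 1 + lam / 4 in hN.
have h0 : 0 < h by rewrite /h; have := lam0; lra.
pose rho := r0 / 2; have rho0 : 0 < rho by rewrite divr_gt0.
have M0 : 0 <= M by apply: le_trans (uM x0).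
have [mu_ _] := Eu.
pose W x := Num.max 0 (u x + h).
pose z x := Num.max 0 (- (u x + h)).
pose N := [set x | u x < - h] `&` oball x0 r0.
have mN : measurable N.
  apply: measurableI; last exact: measurable_oball.
  by rewrite -[X in measurable X]setTI; exact: measurable_fun_ltr.
pose z' x := z x * (1 - \1_(oball x0 r0) x).
have muh : measurable_fun setT (fun x => u x + h) by exact: measurable_funD.
have EW : finE W.
  apply: (@finE_dom1 _ _ _ _ _ mk k0 1 u) => //; first exact: measurable_maxr.
  by move=> x y; rewrite mul1r; apply: le_trans (max_lip _ _ _) _; rewrite opprD addrACA subrr addr0.
have Ez : finE z.
  apply: (@finE_dom1 _ _ _ _ _ mk k0 1 u) => //.
    by apply: measurable_maxr => //; exact: measurableT_comp.
  move=> x y; rewrite mul1r; apply: le_trans (max_lip _ _ _) _.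
  by rewrite -opprD normrN opprD addrACA subrr addr0.
have mz' : measurable_fun setT z'.
  by apply: measurable_funM; [case: Ez|apply: measurable_funB => //; apply: measurable_indic; exact: measurable_oball].
have zz' x : ~ N x -> z x = z' x.
  move=> hx; rewrite /z' indicE; have [/set_mem xb|_] := boolP (x \in _); last by rewrite /= mulr0n subr0 mulr1.
  rewrite subrr mulr0 /z max_l// oppr_le0; have [//|hu] := leP 0 (u x + h).
  by case: hx; split => //=; lra.
have zN : exists2 A, measurable A & mu A = 0%E /\ forall x, ~ A x -> z x = z' x by exists N.
have Ez' := finE_ae mk k0 Ez mz' zN.
have z'M x : 0 <= z' x <= M.
  have z0 : 0 <= z x by rewrite le_max lexx.
  have zM : z x <= M.
    by rewrite ge_max M0/=; have := uM x; rewrite ler_norml => /andP[h1 _]; lra.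
  rewrite /z' indicE; case: (x \in _); first by rewrite subrr mulr0 lexx.
  by rewrite subr0 mulr1 z0.
have z'0 x : oball x0 (2 * rho) x -> z' x = 0.
  rewrite /rho mulrCA mulfV// mulr1 => hx.
  by rewrite /z' indicE mem_set// subrr mulr0.
pose KT := tail_const rho M.
have KT0 : 0 <= KT.
  rewrite /KT /tail_const mulr_ge0// ?mulr_ge0// ?invr_ge0 ?exprn_ge0 ?powR_ge0 ?(ltW rho0)//.
  exact: ltW.
have sW s : s <= rho -> supersol k (oball x0 s) (- (K + KT)) W.
  move=> sr v Hv v0.
  have Hsub t : s <= t -> HO (oball x0 t) v.
    by move=> st; case: Hv => h1 h2 h3; split => // x hx; apply: h3 => hx'; apply: hx; exact: oball_subr hx'.
  have h1 := tail_form_ge rho0 Ez' z'M z'0 (Hsub rho sr) v0.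
  have h2 : - K * \int[mu]_x v x <= B u v.
    by apply: su => //; apply: Hsub; rewrite /rho in sr; lra.
  have e1 : B u v = B W v - B z' v.
    rewrite -(B_ae mk _ mz' _ zN); [|by case: Ez|by case: (HO_finE Hv)].
    rewrite -[B W v]mul1r -[- _]mulN1r -B_linl//; last exact: HO_finE Hv.
    rewrite -[RHS](B_shiftl mu k (- h)); congr (B _ v); apply/funext => x.
    rewrite /W /z; case: (leP 0 (u x + h)) => hx.
      by rewrite max_l ?oppr_le0//; ring.
    by rewrite max_r ?oppr_ge0 ?(ltW hx)//; ring.
  rewrite -/KT in h1; lra.
have C0 : 0 < lam / (K + KT + 1) by rewrite divr_gt0//; lra.
exists (Num.min (rho / 2) ((lam / (K + KT + 1)) `^ alpha^-1)).
  by rewrite lt_min divr_gt0//= powR_gt0.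
move=> r rp; rewrite le_min => /andP[r1 r2] hr.
have W0 x : 0 <= W x by rewrite le_max lexx.
have KK : 0 <= K + KT by rewrite addr_ge0.
have Kr : K + KT <= lam * r `^ (- alpha).
  have h1 : r `^ alpha <= lam / (K + KT + 1).
    have -> : lam / (K + KT + 1) = ((lam / (K + KT + 1)) `^ alpha^-1) `^ alpha.
      by rewrite -powRrM mulVf ?gt_eqF// powRr1// ltW.
    by apply: ge0_ler_powR; rewrite ?nnegrE ?powR_ge0 ?(ltW rp) ?(ltW alpha0).
  have ra : 0 < r `^ alpha by exact: powR_gt0.
  rewrite powRN ler_pdivlMr//; move: h1; rewrite ler_pdivlMr; first lra.
  lra.
have hm : ((r ^+ d * V / 2)%:E <= mu ([set x | (1 <= W x)%R] `&` oball x0 r))%E.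
  apply: le_trans hr _; apply: le_measure; rewrite ?inE.
  - apply: measurableI; last exact: measurable_oball.
    by rewrite -[X in measurable X]setTI; exact: measurable_fun_ler.
  - apply: measurableI; last exact: measurable_oball.
    rewrite -[X in measurable X]setTI; apply: measurable_fun_ler => //.
    exact: measurable_maxr.
  - move=> x [/= h1 h2]; split => //=; rewrite le_max; apply/orP; right.
    by rewrite /h; have := lam0; lra.
have h2r : 2 * r <= rho by lra.
have := growth_lemma EW W0 KK rp Kr (sW _ h2r) hm.
apply: subset_measure0.
- apply: measurableI; last exact: measurable_oball.
  by rewrite -[X in measurable X]setTI; exact: measurable_fun_ltr.
- apply: measurableI; last exact: measurable_oball.
  rewrite -[X in measurable X]setTI; apply: measurable_fun_ltr => //.
  exact: measurable_maxr.
move=> x [/= h1 h2]; split => //=; rewrite gt_max; apply/andP; split; first by have := lam0; lra.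
by rewrite /h; lra.
Qed.

(* Affine image of [lower_oscillation]: [s] plays the role of the essential upper limit
   of [- u], and [D] that of the oscillation of [u]. *)
Lemma oscillation_step (u : T -> R) (x0 : T) (r0 K M s D : R) :
  finE u -> (forall x, `|u x| <= M) -> 0 < r0 -> 0 <= K -> 0 < D ->
  supersol k (oball x0 r0) (- K) u ->
  mu ([set x | (s + D * lam / 8 < - u x)%R] `&` oball x0 r0) = 0%E ->
  exists2 r1, 0 < r1 & forall r, 0 < r -> r <= r1 ->
    (mu ([set x | (D / 2 - s <= u x)%R] `&` oball x0 r) >= (r ^+ d * V / 2)%:E)%E ->
    mu ([set x | (s - D * lam / 8 < - u x)%R] `&` oball x0 (r / 2)) = 0%E.
Proof.
move=> Eu uM r00 K0 D0 su hN.
(* The affine map sends - s, the essential lower limit of u, to -1 and the midpoint D/2 - s to 0. *)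
pose a := 2 / D; have a0 : 0 < a by rewrite divr_gt0.
have aD : a * D = 2 by rewrite /a divfK ?gt_eqF.
pose w x := a * u x + (a * s - 1).
have Ew : finE w.
  have -> : w = fun x => a * u x + (a * s - 1) * 1 by apply/funext => x; rewrite /w mulr1.
  by apply: finE_lin => //; exact: finE_cst.
have wM x : `|w x| <= a * M + `|a * s - 1|.
  apply: le_trans (ler_normD _ _) _; rewrite lerD2r normrM (gtr0_norm a0).
  by rewrite ler_wpM2l// ltW.
have sw : supersol k (oball x0 r0) (- (a * K)) w.
  move=> v Hv v0; have h := ler_wpM2l (ltW a0) (su v Hv v0).
  have -> : B w v = a * B u v.
    rewrite B_shiftl -[RHS]addr0 -[X in _ = _ + X](mul0r (B u v)) -B_linl//; last exact: HO_finE Hv.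
    by congr (B _ v); apply/funext => x; rewrite mul0r addr0.
  by apply: le_trans h; rewrite mulrA mulrN.
have we x : w x = a * (u x + (s - D / 2)) by rewrite /w; lra.
have ce c : c = a * (D / 2 * c) by rewrite mulrA [a * (D / 2)]mulrA aD mulfV// mul1r.
have e1 : [set x | w x < - (1 + lam / 4)] = [set x | s + D * lam / 8 < - u x].
  by apply/seteqP; split => x /=; rewrite we [- (1 + lam / 4)]ce ltr_pM2l//; lra.
have e2 : [set x | w x < - (1 - lam / 4)] = [set x | s - D * lam / 8 < - u x].
  by apply/seteqP; split => x /=; rewrite we [- (1 - lam / 4)]ce ltr_pM2l//; lra.
have e3 : [set x | 0 <= w x] = [set x | D / 2 - s <= u x].
  by apply/seteqP; split => x /=; rewrite we pmulr_rge0//; lra.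
rewrite -e1 in hN.
have := lower_oscillation Ew wM r00 (mulr_ge0 (ltW a0) K0) sw hN.
by rewrite e2 e3.
Qed.

(* If the oscillation [D] at [x0] were positive, on every small ball one of [u], [- u]
   would be above its midpoint on half of the ball, and its essential lower limit would
   be larger than it is. *)
Lemma esslimsup_opp (u : T -> R) (x0 : T) (r0 K M : R) :
  finE u -> (forall x, `|u x| <= M) -> 0 < r0 -> 0 <= K ->
  supersol k (oball x0 r0) (- K) u -> supersol k (oball x0 r0) (- K) (fun x => - u x) ->
  esslimsup (fun x => - u x) x0 = - esslimsup u x0.
Proof.
move=> Eu uM r00 K0 su snu.
have [mu_ _] := Eu.
have mnu : measurable_fun setT (fun x => - u x) by exact: measurableT_comp.
have nuM x : `|- u x| <= M by rewrite normrN.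
have Enu : finE (fun x => - u x).
  by apply: (@finE_dom1 _ _ _ _ _ mk k0 1 u) => // x y; rewrite mul1r -opprD normrN.
set s := esslimsup u x0; set t := esslimsup _ x0.
have st : 0 <= s + t.
  rewrite leNgt; apply/negP => h.
  have h1 : s < s - (s + t) / 4 by lra.
  have h2 : t < t - (s + t) / 4 by lra.
  by have := local_ae_bounds_opp mu_ (esslimsup_lt mu_ uM h1) (esslimsup_lt mnu nuM h2); lra.
apply/eqP; rewrite -addr_eq0 addrC; apply/negP => /negP hst.
pose D := s + t; have D0 : 0 < D by rewrite lt_neqAle eq_sym hst.
have Dl : 0 < D * lam / 8 by rewrite divr_gt0// mulr_gt0.
have s1 : s < s + D * lam / 8 by lra.
have t1 : t < t + D * lam / 8 by lra.
have [ra ra0 ha] := esslimsup_lt mu_ uM s1.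
have [rb rb0 hb] := esslimsup_lt mnu nuM t1.
pose R0 := Num.min r0 (Num.min ra rb).
have R00 : 0 < R0 by rewrite !lt_min r00 ra0.
have hR0 : R0 <= r0 by rewrite ge_min lexx.
have hRa : R0 <= ra by rewrite !ge_min lexx orbT.
have hRb : R0 <= rb by rewrite !ge_min lexx !orbT.
have mlt (f : T -> R) c r : measurable_fun setT f -> measurable ([set x | c < f x] `&` oball x0 r).
  move=> mf; apply: measurableI; last exact: measurable_oball.
  by rewrite -[X in measurable X]setTI; exact: measurable_fun_ltr.
have mle (f : T -> R) c r : measurable_fun setT f -> measurable ([set x | c <= f x] `&` oball x0 r).
  move=> mf; apply: measurableI; last exact: measurable_oball.
  by rewrite -[X in measurable X]setTI; exact: measurable_fun_ler.
have sub f : supersol k (oball x0 r0) (- K) f -> supersol k (oball x0 R0) (- K) f.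
  by move=> h; apply: supersol_sub h; exact: oball_subr.
have hb' : mu ([set x | (t + D * lam / 8 < - u x)%R] `&` oball x0 R0) = 0%E.
  by apply: subset_measure0 hb => //; [exact: mlt..|move=> x [? h]; split => //; exact: oball_subr h].
have ha' : mu ([set x | (s + D * lam / 8 < - - u x)%R] `&` oball x0 R0) = 0%E.
  under eq_set do rewrite opprK.
  by apply: subset_measure0 ha => //; [exact: mlt..|move=> x [? h]; split => //; exact: oball_subr h].
have [r1 r10 h1] := oscillation_step Eu uM R00 K0 D0 (sub _ su) hb'.
have [r2 r20 h2] := oscillation_step Enu nuM R00 K0 D0 (sub _ snu) ha'.
pose r := Num.min r1 r2; have r_0 : 0 < r by rewrite lt_min r10.
have rr1 : r <= r1 by rewrite ge_min lexx.
have rr2 : r <= r2 by rewrite ge_min lexx orbT.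
have {}h1 := h1 r r_0 rr1; have {}h2 := h2 r r_0 rr2.
have c0 : oball x0 (r / 2) x0 by apply: oball_center; rewrite divr_gt0.
pose A1 := [set x | D / 2 - t <= u x] `&` oball x0 r.
pose A2 := [set x | D / 2 - s <= - u x] `&` oball x0 r.
have mA1 : measurable A1 by exact: mle.
have mA2 : measurable A2 by exact: mle.
have [hA1|hA1] := leP (r ^+ d * V / 2)%:E (mu A1).
  by have := esslimsup_ball_le mnu nuM c0 (h1 hA1); rewrite -/t; lra.
have [hA2|hA2] := leP (r ^+ d * V / 2)%:E (mu A2).
  have := h2 hA2; under eq_set do rewrite opprK.
  by move=> h; have := esslimsup_ball_le mu_ uM c0 h; rewrite -/s; lra.
(* Both D/2 - t and - (D/2 - s) equal (s - t)/2, so [A1] and [A2] cover the ball. *)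
have : (mu (oball x0 r) <= mu A1 + mu A2)%E.
  apply: (@le_trans _ _ (mu (A1 `|` A2))); last exact: measureU2.
  apply: le_measure; rewrite ?inE; [exact: measurable_oball|exact: measurableU|].
  move=> x hx; have [h|h] := leP (D / 2 - t) (u x); [left|right]; split => //=.
  by rewrite /D in h *; lra.
apply/negP; rewrite -ltNge (lebn_ball x0 r_0).
apply: lt_le_trans (lteD hA1 hA2) _.
by rewrite -EFinD lee_fin; lra.
Qed.

End Oscillation.

(** * Continuous representative of a bounded weak solution *)

Section ContinuousSolution.
Context {R : realType} {d : nat}.
Local Notation T := (pt R d).
Local Notation mu := (lebn (R := R) d).
Variables (k : T -> T -> R) (alpha cU : R).
Hypothesis mk : measurable_fun setT (fun p : T * T => k p.1 p.2).
Hypothesis k0 : forall x y, 0 <= k x y.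
Hypothesis ksym : forall x y, k x y = k y x.
Hypothesis cU0 : 0 < cU.
Hypothesis hU1 : U1 alpha k cU.
Hypothesis alpha0 : 0 < alpha.

Local Notation finE := (finE mu k).
Local Notation B := (B mu k).
Local Notation HO := (HO mu k).
Local Notation V := (vol1 (R := R) (d := d)).

Variable lam : R.
Hypothesis lam0 : 0 < lam.
Hypothesis growth_lemma : forall (U : T -> R) (x0 : T) (K r : R),
  finE U -> (forall x, 0 <= U x) -> 0 <= K -> 0 < r -> K <= lam * r `^ (- alpha) ->
  supersol k (oball x0 (2 * r)) (- K) U ->
  (mu ([set x | (1 <= U x)%R] `&` oball x0 r) >= (r ^+ d * V / 2)%:E)%E ->
  mu ([set x | (U x < lam / 2)%R] `&` oball x0 (r / 2)) = 0%E.

Variables (O : set T) (psi u : T -> R) (M K : R).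
Hypotheses (oO : is_open O) (Oy : (mu O < +oo)%E).
Hypotheses (mpsi : measurable_fun setT psi) (psiK : forall x, `|psi x| <= K).
Hypotheses (Hu : HO O u) (uM : forall x, `|u x| <= M).
Hypothesis u_eq : forall v, HO O v -> B u v = \int[mu]_x (psi x * v x).

Let mO : measurable O. Proof. exact: is_open_measurable. Qed.
Let Eu : finE u. Proof. exact: HO_finE Hu. Qed.
Let mu_ : measurable_fun setT u. Proof. exact: HO_measurable Hu. Qed.
Let mnu : measurable_fun setT (fun x => - u x). Proof. exact: measurableT_comp. Qed.
Let nuM x : `|- u x| <= M. Proof. by rewrite normrN. Qed.
Let Enu : finE (fun x => - u x).
Proof. by apply: (@finE_dom1 _ _ _ _ _ mk k0 1 u) => // x y; rewrite mul1r -opprD normrN. Qed.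
Let K0 (x : T) : 0 <= K. Proof. exact: le_trans (psiK x). Qed.

Let supersol_pm x e : oball x e `<=` O ->
  supersol k (oball x e) (- K) u /\ supersol k (oball x e) (- K) (fun x => - u x).
Proof.
move=> xO; have K_0 := K0 x.
have key v : HO (oball x e) v -> (forall x, 0 <= v x) ->
    `|\int[mu]_x (psi x * v x)| <= K * \int[mu]_x v x /\ B u v = \int[mu]_x (psi x * v x).
  move=> Hv v0.
  have HvO : HO O v by case: Hv => h1 h2 h3; split => // z hz; apply: h3 => /xO.
  split; last exact: u_eq.
  have Iv : rintegrable mu v.
    have := HO_abs_integrable mO Oy HvO.
    by congr (rintegrable mu _); apply/funext => z; rewrite ger0_norm.
  have Ipv := psi_integrable mO Oy mpsi psiK HvO.
  rewrite ler_norml -RintegralZl//; apply/andP; split.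
    rewrite -mulN1r -RintegralZl//; last exact: rintegrableZ.
    apply: Rintegral_le => //; first by do 2 apply: rintegrableZ.
    move=> z; rewrite mulN1r -mulNr; apply: ler_wpM2r => //.
    by have := psiK z; rewrite ler_norml => /andP[].
  apply: Rintegral_le => //; first exact: rintegrableZ.
  by move=> z; apply: ler_wpM2r => //; apply: le_trans (ler_norm _) (psiK z).
split=> v Hv v0; have [h1 h2] := key v Hv v0; move: h1; rewrite -h2 ler_norml => /andP[h3 h4].
  by rewrite mulNr.
have -> : B (fun x => - u x) v = - B u v.
  rewrite -mulN1r -[RHS]addr0 -[X in _ = _ + X](mul0r (B u v)) -B_linl//; last exact: HO_finE Hv.
  by congr (B _ v); apply/funext => z; rewrite mul0r addr0 mulN1r.
by rewrite mulNr lerN2.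
Qed.

Let opp x : O x -> esslimsup (fun y => - u y) x = - esslimsup u x.
Proof.
move=> Ox; have [e e0 he] := oO Ox; have [h1 h2] := supersol_pm he.
exact: (esslimsup_opp mk k0 ksym cU0 hU1 alpha0 lam0 growth_lemma Eu uM e0 (K0 x) h1 h2).
Qed.

Let phi x := \1_O x * esslimsup u x.

Let phiE x : O x -> phi x = esslimsup u x.
Proof. by move=> Ox; rewrite /phi indicE mem_set// mul1r. Qed.

Let phi0 x : ~ O x -> phi x = 0.
Proof. by move=> Ox; rewrite /phi indicE memNset// mul0r. Qed.

Let mphi : measurable_fun setT phi.
Proof. by apply: measurable_funM; [exact: measurable_indic|exact: measurable_esslimsup mu_ uM]. Qed.

(** Upper semicontinuity of [esslimsup u] and of [esslimsup] of - u, which are opposite on [O]. *)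
Let phi_continuous : continuous_on O phi.
Proof.
move=> x Ox e e0.
have h1 : esslimsup u x < esslimsup u x + e by lra.
have h2 : esslimsup (fun y => - u y) x < esslimsup (fun y => - u y) x + e by lra.
have [r r0 hr] := esslimsup_usc mu_ uM h1.
have [s s0 hs] := esslimsup_usc mnu nuM h2.
exists (Num.min r s); first by rewrite lt_min r0.
move=> z Oz; rewrite lt_min eucl_sym => /andP[zr zs].
have := hr z zr; have := hs z zs; rewrite !opp// !phiE// ltr_norml; lra.
Qed.

(** Almost everywhere u and - u are at most their essential upper limits; on [O] these are opposite,
    so both inequalities are equalities. *)
Let phi_ae : exists2 A, measurable A & mu A = 0%E /\ forall x, ~ A x -> u x = phi x.
Proof.
have [A1 [mA1 A10 h1]] := esslimsup_ae mu_ uM.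
have [A2 [mA2 A20 h2]] := esslimsup_ae mnu nuM.
exists (A1 `|` A2); first exact: measurableU.
split; first by rewrite measureU0.
move=> x /not_orP[hx1 hx2]; have [Ox|Ox] := pselect (O x); last first.
  by rewrite phi0//; case: Hu => _ _ ->.
rewrite phiE//; apply/eqP; rewrite eq_le; apply/andP; split; rewrite leNgt; apply/negP => h.
  by apply: hx1; exact: h1.
by apply: hx2; apply: h2 => /=; rewrite opp// ltrN2.
Qed.

Let Ephi : finE phi. Proof. exact: (finE_ae mk k0 Eu mphi phi_ae). Qed.

Let phi2 : rintegrable mu (fun x => phi x ^+ 2).
Proof.
have [_ I2 _] := Hu; have [A mA [A0 h]] := phi_ae.
apply/rintegrable_ge0P; [exact: measurable_funX|by move=> x; exact: sqr_ge0|].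
move/rintegrable_ge0P : I2 => /(_ (measurable_funX 2 mu_) (fun x => sqr_ge0 _)).
apply: le_lt_trans; rewrite le_eqVlt; apply/orP; left; apply/eqP.
apply: ge0_ae_eq_integral => //.
- by apply/measurable_EFinP; exact: measurable_funX.
- by apply/measurable_EFinP; exact: measurable_funX.
- by move=> p _; rewrite lee_fin sqr_ge0.
- by move=> p _; rewrite lee_fin sqr_ge0.
- exists A; split => // x /= hx; apply: contrapT => hA; apply: hx => _.
  by rewrite (h x hA).
Qed.

(** Functions of [HkOmega] may be nonzero on a null set outside [O]; the indicator brings them to
    the normalized space [HO]. *)
Let HkOmega_HO v : HkOmega k O v -> HO O (fun x => \1_O x * v x) /\
  exists2 A, measurable A & mu A = 0%E /\ forall x, ~ A x -> v x = \1_O x * v x.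
Proof.
move=> [[[mv Lv] Ev] nv].
have mI : measurable_fun setT (\1_O : T -> R) by exact: measurable_indic.
have mIv : measurable_fun setT (fun x => \1_O x * v x) by exact: measurable_funM.
pose A := [set x | ~ O x /\ v x <> 0].
have mA : measurable A.
  rewrite (_ : A = ~` O `&` ~` [set x | v x = 0]); last first.
    by apply/seteqP; split => x [].
  apply: measurableI; apply: measurableC => //.
  rewrite (_ : [set x | v x = 0] = v @^-1` [set 0]); last by [].
  by rewrite -[X in measurable X]setTI; exact: mv.
have A0 : mu A = 0%E by rewrite lebn_iint.
have vI x : ~ A x -> v x = \1_O x * v x.
  move=> hA; rewrite indicE; have [_|/negP hO] := boolP (x \in O); first by rewrite mul1r.
  rewrite mul0r; apply: contrapT => hv; apply: hA; split => // Ox; apply: hO; exact: mem_set.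
have Fv : finE v.
  split => //; apply/rintegrable_ge0P; [exact: measurable_Q|exact: Quu_ge0|].
  move: Ev; rewrite Eform_integral//.
  by congr (_ < _)%E; apply: eq_integral => p _; rewrite !indicE !in_setT !mul1r.
split; last by exists A.
split; first by apply: finE_ae Fv _ _ => //; exists A.
  have v2 : rintegrable mu (fun x => v x ^+ 2).
    apply/rintegrable_ge0P; [exact: measurable_funX|by move=> x; exact: sqr_ge0|].
    move: Lv; rewrite iintE.
    - by congr (_ < _)%E; apply: eq_integral => x _; rewrite indicE in_setT mul1r.
    - apply/measurable_EFinP; apply: measurable_funM; last exact: measurable_funX.
      exact: measurable_indic.
    - by move=> x; rewrite lee_fin mulr_ge0// sqr_ge0.
  apply: (@rintegrable_le _ _ _ _ (fun x => v x ^+ 2)) => //; first exact: measurable_funX.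
  move=> x; rewrite normrX normrM exprMn real_normK ?num_real//.
  rewrite real_normK ?num_real// ler_piMl ?sqr_ge0// expr_le1// indicE lern1 leq_b1//.
by move=> x Ox; rewrite indicE memNset// mul0r.
Qed.

(** The last two clauses turn almost-everywhere bounds of [u] near a point into bounds of [f] at
    that point, the value which the Green function represents. *)
Lemma continuous_weak_solution : exists f : T -> R,
  [/\ HkOmega k O f, continuous_on O f,
    forall v, HkOmega k O v -> Eform k setT f v = pairing (fun x => \1_O x * psi x) v,
    forall y r c, O y -> 0 < r -> mu ([set x | (u x < c)%R] `&` oball y r) = 0%E -> c <= f y &
    forall y r c, O y -> 0 < r -> mu ([set x | (c < u x)%R] `&` oball y r) = 0%E -> f y <= c].
Proof.
exists phi; split => //.
- split; last first.
    rewrite /null (_ : [set x | _] = set0).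
      by rewrite -lebn_iint// measure0.
    by apply/seteqP; split => x //= [/phi0].
  split; last by rewrite (Eform_B mk k0 Ephi Ephi) ltry.
  split => //; rewrite iintE.
  + move/rintegrable_ge0P : phi2 => /(_ (measurable_funX 2 mphi) (fun x => sqr_ge0 _)).
    by congr (_ < _)%E; apply: eq_integral => x _; rewrite indicE in_setT mul1r.
  + apply/measurable_EFinP; apply: measurable_funM; last exact: measurable_funX.
    exact: measurable_indic.
  + by move=> x; rewrite lee_fin mulr_ge0// sqr_ge0.
- move=> v Hv; have [Hv' vA] := HkOmega_HO Hv.
  have [[[mv _] _] _] := Hv.
  have [A mA [A0 vI]] := vA.
  have Fv : finE v.
    by apply: finE_ae (HO_finE Hv') mv _ => //; exists A => //; split => // x /vI.
  rewrite (Eform_B mk k0 Ephi Fv).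
  have -> : B phi v = B u (fun x => \1_O x * v x).
    rewrite -(B_ae mk mu_ mphi mv phi_ae) Bsym [RHS]Bsym.
    by apply: B_ae => //; exact: HO_measurable Hv'.
  rewrite u_eq// /pairing sintE.
    rewrite EFin_Rintegral; last exact: (psi_integrable mO Oy mpsi psiK Hv').
    by apply: eq_integral => x _; rewrite mulrCA mulrA.
  apply/measurable_EFinP; apply: measurable_funM => //; apply: measurable_funM => //.
- move=> y r c Oy' r0 h; rewrite phiE//.
  have := @esslimsup_ball_le _ _ _ M mnu nuM y r y (- c) (oball_center y r0).
  rewrite opp// lerN2; apply; rewrite -h; congr (mu (_ `&` _)).
  by apply/seteqP; split => x /=; rewrite ltrN2.
- move=> y r c Oy' r0 h; rewrite phiE//.
  exact: (esslimsup_ball_le mu_ uM (oball_center y r0) h).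
Qed.

End ContinuousSolution.

(** * Green function *)

Section Geometry.
Context {R : realType} {d : nat}.
Local Notation T := (pt R d).
Local Notation mu := (lebn (R := R) d).
Implicit Types (x y z : T).

Definition segment y z (t : R) : T := [tuple tnth y i + t * (tnth z i - tnth y i) | i < d].

Lemma segment0 y z : segment y z 0 = y.
Proof. by apply: eq_from_tnth => i; rewrite tnth_mktuple mul0r addr0. Qed.

Lemma segment1 y z : segment y z 1 = z.
Proof. by apply: eq_from_tnth => i; rewrite tnth_mktuple mul1r addrC subrK. Qed.

Lemma eucl_segment y z s t : eucl (segment y z s) (segment y z t) = `|s - t| * eucl y z.
Proof.
rewrite /eucl -sqrtr_sqr -sqrtrM ?sqr_ge0// mulr_sumr; congr (Num.sqrt _).
by apply: eq_bigr => i _; rewrite !tnth_mktuple; ring.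
Qed.

Lemma eucl_segmentl y z t : 0 <= t -> eucl y (segment y z t) = t * eucl y z.
Proof. by move=> t0; rewrite -{1}(segment0 y z) eucl_segment sub0r normrN ger0_norm. Qed.

(* The first point outside [O] on the segment from [y] is a boundary point. *)
Lemma oball_dist_bdry (O : set T) y : is_open O -> O y -> oball y (dist_bdry O y) `<=` O.
Proof.
move=> oO Oy z yz; apply: contrapT => Oz.
pose S := [set t : R | 0 <= t <= 1 /\ ~ O (segment y z t)].
have S1 : S 1 by split; rewrite ?segment1// ler01 lexx.
have hS : has_inf S by split; [exists 1|exists 0 => t [/andP[]]].
pose t := inf S.
have t1 : t <= 1 by apply: ge_inf => //; case: hS.
have t0 : 0 <= t by apply: lb_le_inf; [case: hS|move=> s [/andP[]]].
have Ot : ~ O (segment y z t).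
  move=> /oO[e e0 he].
  have L0 : 0 < eucl y z + 1 by have := eucl_ge0 y z; lra.
  have h : t < t + e / (eucl y z + 1) by rewrite ltrDl divr_gt0.
  have [s [s01 Os] st] := inf_lt hS.1 h.
  have ts : t <= s by apply: ge_inf => //; case: hS.
  apply: Os; apply: he; rewrite /oball/= eucl_segment distrC ger0_norm ?subr_ge0//.
  have h2 : (s - t) * (eucl y z + 1) < e by rewrite -ltr_pdivlMr//; lra.
  by apply: le_lt_trans h2; rewrite ler_wpM2l ?subr_ge0// lerDl.
have t_0 : 0 < t.
  rewrite lt_neqAle t0 andbT; apply/eqP => h; apply: Ot; by rewrite -h segment0.
have bt : boundary O (segment y z t).
  split => // e e0.
  have L0 : 0 < eucl y z + 1 by have := eucl_ge0 y z; lra.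
  pose s := Num.max 0 (t - e / (eucl y z + 1) / 2).
  have e1 : 0 < e / (eucl y z + 1) / 2 by rewrite divr_gt0// divr_gt0.
  have s0 : 0 <= s by rewrite le_max lexx.
  have st : s < t by rewrite gt_max t_0/=; lra.
  have s2 : t - e / (eucl y z + 1) / 2 <= s by rewrite le_max lexx orbT.
  exists (segment y z s).
    apply: contrapT => hs; have : t <= s by apply: ge_inf; [case: hS|split => //; lra].
    lra.
  rewrite eucl_segment ger0_norm ?subr_ge0 ?(ltW st)//.
  have h2 : (t - s) * (eucl y z + 1) < e by rewrite -ltr_pdivlMr//; lra.
  by apply: le_lt_trans h2; rewrite ler_wpM2l ?subr_ge0 ?(ltW st)// lerDl.
have : dist_bdry O y <= eucl y (segment y z t).
  apply: ge_inf; last by exists (segment y z t).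
  by exists 0 => _ [w _ <-]; exact: eucl_ge0.
rewrite eucl_segmentl//; move: yz; rewrite /oball/= => h1 h2.
have h3 : t * eucl y z <= 1 * eucl y z by rewrite ler_wpM2r// eucl_ge0.
lra.
Qed.

Lemma is_bounded_lty (O : set T) : measurable O -> is_bounded O -> (mu O < +oo)%E.
Proof.
move=> mO [M hM]; apply: le_lt_trans (lebn_ball_lty origin (M + 1)).
apply: le_measure; rewrite ?inE//; first exact: measurable_oball.
by move=> x /hM; rewrite eucl_sym /oball/= /origin; lra.
Qed.

End Geometry.

(** * Two-sided bounds for potentials of balls *)

Section Potentials.
Context {R : realType} {d : nat}.
Hypothesis d3 : (3 <= d)%N.
Variables (alpha0 c_l c_U : R).
Hypotheses (alpha00 : 0 < alpha0) (cl0 : 0 < c_l) (cU0 : 0 < c_U).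
Local Notation T := (pt R d).
Local Notation mu := (lebn (R := R) d).

(** Both constants come from Faber-Krahn and iteration constants fixed before alpha, [O] and [k].
    The constant of [growth] is obtained after them and serves continuity only. *)
Lemma ball_potential_bounds : exists c1 C2 : R, [/\ 0 < c1, 0 < C2 &
  forall (alpha : R), alpha0 <= alpha -> alpha < 2 ->
  forall (O : set T), is_open O -> is_bounded O ->
  forall (k : T -> T -> R), admissible_kernel k -> E_ge alpha k c_l -> U1 alpha k c_U ->
  forall (x0 : T) (r : R), 0 < r -> oball x0 r `<=` O ->
  exists f : T -> R, [/\ HkOmega k O f, continuous_on O f,
    forall v, HkOmega k O v ->
      Eform k setT f v = pairing (fun x => \1_O x * \1_(oball x0 r) x) v,
    c1 * r `^ alpha <= f x0 & f x0 <= C2 * r `^ alpha]].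
Proof.
have d0 : (0 < d)%N by exact: leq_trans d3.
have beta0 : 0 < alpha0 / d%:R by rewrite divr_gt0// ltr0n.
have [cF cF0 hFK] := @faber_krahn R d d0 c_l alpha0 cl0 alpha00.
have [cE cE0 hE] := @E_ge_fractional R d c_l alpha0 cl0 alpha00.
have C10 : 0 < 16 * (1 + 32 * c_U) / cF.
  by rewrite divr_gt0// mulr_gt0//; have := cU0; lra.
have [ms [q [ms01 q01 qb Cms]]] := de_giorgi_constants beta0 C10.
have wc0 : 0 < weak_const (d := d) cF by rewrite /weak_const divr_gt0// mulr_gt0// exprn_gt0.
have C20 : 0 < 4 / (weak_const (d := d) cF * cF) ^+ 2.
  by rewrite divr_gt0// exprn_gt0// mulr_gt0.
have [ms2 [q2 [ms201 q201 q2b Cms2]]] := de_giorgi_constants beta0 C20.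
have /andP[ms0 _] := ms01; have /andP[ms20 _] := ms201.
have dl0 := @lower_delta_gt0 R d c_U ms cU0 ms01.
exists (lower_delta (d := d) c_U ms / 4), (2 * weak_const (d := d) cF / ms2 ^+ d).
have C0 : 0 < 2 * weak_const (d := d) cF / ms2 ^+ d by rewrite divr_gt0 ?exprn_gt0// mulr_gt0.
split; [by rewrite divr_gt0|exact: C0|].
move=> alpha a1 a2 O oO bO k [mk k0 ksym _] hEge hU1 x0 r r0 xO.
have alpha_0 : 0 < alpha by exact: lt_le_trans a1.
have FK := hFK alpha k a1 a2 mk k0 hEge.
have hEk := hE alpha k a1 a2 mk k0 hEge.
have mO := is_open_measurable oO.
have Oy := is_bounded_lty mO bO.
have DG := de_giorgi mk k0 ksym cU0 hU1 d0 a1 a2 cF0 FK ms01 q01 qb Cms.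
have cE20 : 0 < cE * (2 - alpha) by rewrite mulr_gt0// subr_gt0.
have [lam lam0 hlam] := growth mk k0 ksym cU0 hU1 alpha00 a1 a2 ms01 DG cE20 hEk.
have V0 : 0 < vol1 (R := R) (d := d) by exact: vol1_gt0.
pose psi : T -> R := \1_(oball x0 r).
have mpsi : measurable_fun setT psi by apply: measurable_indic; exact: measurable_oball.
have psi1 x : `|psi x| <= 1 by rewrite ger0_norm// /psi indicE lern1 leq_b1.
(* At this scale Faber-Krahn applies with [O] itself as the set and becomes the Poincare
   inequality. *)
pose rho := fine (mu O) / (vol1 (R := R) (d := d) / 4) + 1.
have o0 : 0 <= fine (mu O) by exact: fine_ge0.
have rho1 : 1 <= rho by rewrite lerDr divr_ge0// divr_ge0// ltW.
have rho0 : 0 < rho by lra.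
have hrho : (mu O <= (vol1 (R := R) (d := d) / 4 * rho ^+ d)%:E)%E.
  rewrite -(fineK (_ : mu O \is a fin_num)) ?ge0_fin_numE// lee_fin.
  apply: (@le_trans _ _ (vol1 (R := R) (d := d) / 4 * rho)).
    by rewrite mulrC -ler_pdivrMr ?divr_gt0// lerDl.
  by rewrite ler_wpM2l ?divr_ge0 ?(ltW V0)// ler_eXnr.
have cP0 : 0 < cF * rho `^ (- alpha) by rewrite mulr_gt0// powR_gt0.
have poincare v : HO mu k O v -> cF * rho `^ (- alpha) * \int[mu]_x (v x ^+ 2) <= B mu k v v.
  by move=> [Ev v2 vz]; exact: FK vz.
have [u Hu u_eq] := exists_weak_solution mk k0 mO Oy cP0 poincare mpsi psi1.
have hup := potential_upper_bound mk k0 d3 alpha00 a1 a2 cF0 FK mO Oy r0 Hu u_eq ms201 q201 q2b Cms2.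
have hlo := potential_ge0 mk k0 d3 cF0 FK mO Oy Hu u_eq.
set M := _ * r `^ alpha in hup.
have M0 : 0 < M by rewrite mulr_gt0// powR_gt0.
(* The bounds 0 <= u <= M hold almost everywhere; truncation makes them hold everywhere and alters u
   on a null set only. *)
pose w x := Num.max 0 (Num.min M (u x)).
have mu_ : measurable_fun setT u := HO_measurable Hu.
have mw : measurable_fun setT w.
  by apply: measurable_maxr => //; exact: measurable_minr.
have w01 x : 0 <= w x <= M by rewrite le_max lexx ge_max (ltW M0) ge_min lexx.
have uw : exists2 A, measurable A & mu A = 0%E /\ forall x, ~ A x -> u x = w x.
  exists ([set x | M < u x] `|` [set x | u x < 0]).
    by apply: measurableU; rewrite -[X in measurable X]setTI; exact: measurable_fun_ltr.
  split.
    rewrite measureU0//; rewrite -[X in measurable X]setTI; exact: measurable_fun_ltr.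
  move=> x /not_orP[/negP h1 /negP h2]; rewrite -leNgt in h1; rewrite -leNgt in h2.
  by rewrite /w min_r// max_r.
have Hw : HO mu k O w.
  have [Eu u2 uz] := Hu.
  have wu x : `|w x| <= `|u x|.
    rewrite /w; case: (leP M (u x)) => h1.
      by rewrite max_r ?(ltW M0)// !ger0_norm//; lra.
    by case: (leP 0 (u x)) => h2 //; rewrite normr0.
  split; [exact: (finE_ae mk k0 Eu mw uw)| |by move=> x /uz h; have := wu x; rewrite h normr0 normr_le0 => /eqP].
  apply: (@rintegrable_le _ _ _ _ (fun x => u x ^+ 2)) => //; first exact: measurable_funX.
  move=> x; rewrite normrX -[leRHS]real_normK ?num_real// ler_sqr ?nnegrE//.
have w_eq v : HO mu k O v -> B mu k w v = \int[mu]_x (psi x * v x).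
  by move=> Hv; rewrite -u_eq// (B_ae mk mu_ mw _ uw)//; exact: HO_measurable Hv.
have wM x : `|w x| <= M by have /andP[h1 h2] := w01 x; rewrite ger0_norm.
have w0 x : 0 <= w x by have /andP[] := w01 x.
have sw : supersol k (oball x0 r) 1 w.
  move=> v Hv v0; rewrite w_eq; last first.
    by case: Hv => h1 h2 h3; split => // x hx; apply: h3 => /xO.
  rewrite mul1r le_eqVlt; apply/orP; left; apply/eqP; apply: eq_Rintegral => x _.
  rewrite /psi indicE; have [_|/negP h] := boolP (x \in _); first by rewrite mul1r.
  by rewrite mul0r; case: Hv => _ _ -> // hx; apply: h; exact: mem_set.
have htl := torsion_lower_bound mk k0 ksym cU0 hU1 a2 ms01 DG (HO_finE Hw) w0 r0 sw.
have [f [h1 h2 h3 h4 h5]] := continuous_weak_solution mk k0 ksym cU0 hU1 alpha_0 lam0 hlam oO Oy mpsi psi1 Hw wM w_eq.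
have Ox0 : O x0 by apply: xO; exact: oball_center.
exists f; split => //.
  have r4 : 0 < r / 4 by rewrite divr_gt0.
  by apply: h4 Ox0 r4 _; rewrite mulrAC.
apply: h5 Ox0 r0 _; rewrite (_ : _ `&` _ = set0) ?measure0//.
apply/seteqP; split => x //= [hx _]; have /andP[_ h] := w01 x.
by have := lt_le_trans hx h; rewrite ltxx.
Qed.

End Potentials.

(** * Harnack chain and integrals of the Green function *)

Section GreenFunction.
Context {R : realType} {d : nat}.
Local Notation T := (pt R d).
Local Notation mu := (lebn (R := R) d).
Variables (O : set T) (G : T -> T -> \bar R).

(** [harnack_H] wants the closed ball of radius 2 s in [O], and only the open ball of radius 2 r is
    given, hence s <= 3/4 r. The annulus from 3/4 r to 3/2 r contains x. Further in, with t =
    (3/4)^(j+1), the annulus starting at 3/4 t r contains the point at distance t r on the segment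
    from y to x, which the previous step has reached. The maximum with 1 makes the powers
    nondecreasing in j. *)
Lemma harnack_chain (c_H : R) (y x : T) (r : R) : 0 < c_H -> (forall z, (0 <= G z y)%E) ->
  harnack_H O G c_H -> O y -> 0 < r -> eucl y x = r -> oball y (2 * r) `<=` O ->
  forall j z, (3 / 4) ^+ j.+1 * r <= eucl y z -> eucl y z < 3 / 2 * r ->
    (G z y <= (Num.max c_H 1 ^+ j.+1)%:E * G x y)%E.
Proof.
move=> cH0 G0 hG Oy r0 xr hO; set CH := Num.max _ _.
have CH1 : 1 <= CH by rewrite le_max lexx orbT.
have CH0 : 0 <= CH by lra.
have cHC : c_H <= CH by rewrite le_max lexx.
have step s w z : 0 < s -> s <= 3 / 4 * r -> s <= eucl y z < 2 * s -> s <= eucl y w < 2 * s ->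
    (G z y <= CH%:E * G w y)%E.
  move=> s0 sr /andP[z1 z2] /andP[w1 w2].
  have hs : cball y (2 * s) `<=` O.
    by move=> p hp; apply: hO; move: hp; rewrite /cball/oball/=; lra.
  have := hG y s Oy s0 hs; set S := [set _ | _ in _] => h.
  have h1 : (G z y <= ereal_sup S)%E.
    by apply: ereal_sup_ubound; exists z => //; split => //=; apply/negP; rewrite -leNgt.
  have h2 : (ereal_inf S <= G w y)%E.
    by apply: ereal_inf_lbound; exists w => //; split => //=; apply/negP; rewrite -leNgt.
  apply: le_trans h1 _; apply: le_trans h _.
  apply: (@le_trans _ _ (c_H%:E * G w y)%E).
    by apply: lee_wpmul2l => //; rewrite lee_fin ltW.
  by apply: lee_wpmul2r.
have p0 j : 0 < (3 / 4 : R) ^+ j by rewrite exprn_gt0.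
have p1 j : (3 / 4 : R) ^+ j <= 1 by rewrite exprn_ile1//; lra.
elim=> [|j IH] z z1 z2.
  rewrite !expr1 in z1 *; apply: (step (3 / 4 * r)) => //; lra.
have [h|h] := leP ((3 / 4) ^+ j.+1 * r) (eucl y z).
  apply: le_trans (IH z h z2) _; apply: lee_wpmul2r => //.
  by rewrite lee_fin [leRHS]exprS ler_peMl// exprn_ge0.
pose t : R := (3 / 4) ^+ j.+1.
have t0 : 0 < t by exact: p0.
have wE : eucl y (segment y x t) = t * r by rewrite eucl_segmentl ?xr// ltW.
have tr : 0 < t * r by rewrite mulr_gt0.
have tr1 : t * r <= 3 / 4 * r.
  by rewrite ler_wpM2r ?(ltW r0)// /t exprS ler_piMr//; lra.
have e1 : (3 / 4) ^+ j.+2 * r = 3 / 4 * (t * r) by rewrite exprS mulrA.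
rewrite e1 in z1; rewrite -/t in h.
apply: (@le_trans _ _ (CH%:E * G (segment y x t) y)%E).
  by apply: (step (3 / 4 * (t * r))); rewrite ?wE; lra.
rewrite exprS EFinM -muleA; apply: lee_wpmul2l => //.
by apply: IH; rewrite wE -/t; lra.
Qed.

Lemma green_ball_integral (k : T -> T -> R) (y : T) (r : R) (f : T -> R) :
  green_function k O G -> O y -> oball y r `<=` O ->
  HkOmega k O f -> continuous_on O f ->
  (forall v, HkOmega k O v ->
     Eform k setT f v = pairing (fun x => \1_O x * \1_(oball y r) x) v) ->
  (\int[mu]_x (G x y * (\1_(oball y r) x)%:E) = (f y)%:E)%E.
Proof.
move=> [mG G0 _ _ hG] Oy yO Hf cf f_eq.
have mb : measurable (oball y r : set T) by exact: measurable_oball.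
have mI : measurable_fun setT (\1_(oball y r) : T -> R) by exact: measurable_indic.
have mGy : measurable_fun setT (fun x => G x y) := measurableT_comp mG (pair2_measurable y).
have LI : Linfty_on O (\1_(oball y r) : T -> R).
  split=> //; exists 1; rewrite /null (_ : [set x | _] = set0).
    by rewrite -lebn_iint// measure0.
  apply/seteqP; split => x //= -[_]; rewrite ger0_norm// indicE.
  by rewrite ltNge lern1 leq_b1.
rewrite -(hG y Oy f _ Hf cf LI f_eq).
have e x : (\1_O x * \1_(oball y r) x)%:E = (\1_(oball y r) x)%:E :> \bar R.
  rewrite !indicE; have [/set_mem h|_] := boolP (x \in oball y r); last by rewrite mulr0.
  by rewrite (mem_set (yO _ h)) mulr1.
rewrite sintE; first by apply: eq_integral => x _; rewrite e.
under eq_fun do rewrite e.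
by apply: emeasurable_funM => //; exact/measurable_EFinP.
Qed.

Lemma green_annulus_le (y : T) (s r L : R) : measurable_fun setT (fun p : T * T => G p.1 p.2) ->
  (forall x z, (0 <= G x z)%E) -> 0 < r -> 0 <= L ->
  (forall z, s <= eucl y z -> eucl y z < r -> (G z y <= L%:E)%E) ->
  (\int[mu]_x (G x y * (\1_(oball y r) x)%:E) <=
   \int[mu]_x (G x y * (\1_(oball y s) x)%:E) + (L * (r ^+ d * vol1 (R := R) (d := d)))%:E)%E.
Proof.
move=> mG G0 r0 L0 hL.
have mGy : measurable_fun setT (fun x => G x y) := measurableT_comp mG (pair2_measurable y).
have mI t : measurable_fun setT (fun x : T => (\1_(oball y t) x)%:E : \bar R).
  by apply/measurable_EFinP; apply: measurable_indic; exact: measurable_oball.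
have mGI t : measurable_fun setT (fun x : T => (G x y * (\1_(oball y t) x)%:E)%E).
  by apply: emeasurable_funM.
have GI0 t x : (0 <= G x y * (\1_(oball y t) x)%:E)%E by rewrite mule_ge0.
have mLI : measurable_fun setT (fun x : T => (L%:E * (\1_(oball y r) x)%:E)%E).
  by apply: emeasurable_funM.
have LI0 x : (0 <= L%:E * (\1_(oball y r) x)%:E)%E by rewrite mule_ge0.
have -> : ((L * (r ^+ d * vol1 (R := R) (d := d)))%:E = \int[mu]_x (L%:E * (\1_(oball y r) x)%:E))%E.
  rewrite integralZT//.
  rewrite integral_indic//; last exact: measurable_oball.
  by rewrite setIT EFinM; congr (_ * _)%E; rewrite -(lebn_ball y r0).
rewrite -integralDT//; apply: le_integralT => //.
  exact: emeasurable_funD.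
move=> x; rewrite !indicE; have [/set_mem hr|_] := boolP (x \in oball y r); last first.
  by rewrite mule0 adde_ge0// mule_ge0.
rewrite !mule1; have [_|/negP hs] := boolP (x \in oball y s).
  by rewrite mule1 leeDl.
rewrite mule0 add0e; apply: hL => //; rewrite leNgt; apply/negP => h.
by apply: hs; exact: mem_set.
Qed.

End GreenFunction.

Theorem mainTheorem3 (R : realType) (d : nat) (d_ge3 : (3 <= d)%N)
    (alpha0 c_l c_U c_H : R) :
  0 < alpha0 -> alpha0 < 2 -> 0 < c_l -> 0 < c_U -> 0 < c_H ->
  exists2 C : R, 0 < C &
    forall (alpha : R), alpha0 <= alpha -> alpha < 2 ->
    forall (O : set (pt R d)), is_open O -> is_bounded O ->
    forall (k : pt R d -> pt R d -> R), admissible_kernel k ->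
      E_ge alpha k c_l -> U1 alpha k c_U ->
    forall (G : pt R d -> pt R d -> \bar R), green_function k O G ->
      harnack_H O G c_H ->
    forall x y : pt R d, O x -> O y ->
      0 < eucl x y -> eucl x y <= dist_bdry O y / 2 ->
      ((C * eucl x y `^ (alpha - d%:R))%:E <= G x y)%E.
Proof.
move=> alpha00 alpha02 cl0 cU0 cH0.
have [c1 [C2 [c10 C20 potentials]]] := ball_potential_bounds d_ge3 alpha00 cl0 cU0.
have V0 : 0 < vol1 (R := R) (d := d) by exact: vol1_gt0.
set V := vol1 in V0 *.
(* Makes C2 (eps r)^alpha at most half of c1 r^alpha. Solving with the exponent alpha0 keeps eps
   free of alpha, and eps <= 1 gives eps^alpha <= eps^alpha0. *)
pose eps := Num.min 1 ((c1 / (2 * C2)) `^ alpha0^-1).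
have e10 : 0 < c1 / (2 * C2) by rewrite divr_gt0// mulr_gt0.
have eps0 : 0 < eps by rewrite lt_min ltr01 powR_gt0.
have eps1 : eps <= 1 by rewrite ge_min lexx.
have epsC : C2 * eps `^ alpha0 <= c1 / 2.
  have h : eps `^ alpha0 <= c1 / (2 * C2).
    have -> : c1 / (2 * C2) = ((c1 / (2 * C2)) `^ alpha0^-1) `^ alpha0.
      by rewrite -powRrM mulVf ?gt_eqF// powRr1// ltW.
    apply: ge0_ler_powR; rewrite ?nnegrE ?powR_ge0 ?(ltW eps0) ?(ltW alpha00)//.
    by rewrite ge_min lexx orbT.
  apply: le_trans (ler_wpM2l (ltW C20) h) _.
  by rewrite le_eqVlt; apply/orP; left; apply/eqP; field; rewrite gt_eqF.
(* The number of annuli down to distance eps r depends on eps alone. *)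
have [N hN] : exists N, (3 / 4 : R) ^+ N.+1 <= eps.
  apply: contrapT => hn; have : eps <= 0; last by rewrite leNgt eps0.
  apply: (@geometric_bound_le0 _ _ 1 (3 / 4)) => [|n]; first by apply/andP; split; lra.
  rewrite mul1r leNgt; apply/negP => h; apply: hn; exists n.
  rewrite exprS; apply: le_trans (ltW h); rewrite ler_piMl ?exprn_ge0//; lra.
pose CN := Num.max c_H 1 ^+ N.+1.
have CN0 : 0 < CN by rewrite exprn_gt0// lt_max cH0.
(* Read off from c1/2 r^alpha <= CN G(x, y) r^d V. *)
exists (c1 / (2 * V * CN)); first by rewrite divr_gt0// mulr_gt0// mulr_gt0.
move=> alpha a1 a2 O oO bO k adm hE hU G hG hH x y Ox Oy xy0 xyd.
have [mG G0 _ _ _] := hG.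
pose r := eucl x y; have r0 : 0 < r by [].
have yr : eucl y x = r by rewrite eucl_sym.
have hO : oball y (2 * r) `<=` O.
  move=> z hz; apply: (oball_dist_bdry oO Oy); apply: lt_le_trans hz _.
  by rewrite -/r in xyd; lra.
have hOs s : s <= r -> oball y s `<=` O.
  by move=> sr z hz; apply: hO; apply: oball_subr hz; lra.
(* An infinite value satisfies the bound trivially; a finite one gives a real upper bound for G(.,
   y) on the annulus. *)
rewrite -/r; case E : (G x y) => [g||]; last 2 first.
- by rewrite leey.
- by have := G0 x y; rewrite E.
have g0 : 0 <= g by have := G0 x y; rewrite E lee_fin.
have er0 : 0 < eps * r by rewrite mulr_gt0.
have er1 : eps * r <= r by rewrite ler_piMl// ltW.
have [f1 [Hf1 cf1 ef1 lf1 _]] := potentials alpha a1 a2 O oO bO k adm hE hU y r r0 (hOs r (lexx _)).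
have [f2 [Hf2 cf2 ef2 _ uf2]] := potentials alpha a1 a2 O oO bO k adm hE hU y _ er0 (hOs _ er1).
have I1 := green_ball_integral hG Oy (hOs r (lexx _)) Hf1 cf1 ef1.
have I2 := green_ball_integral hG Oy (hOs _ er1) Hf2 cf2 ef2.
have hL z : eps * r <= eucl y z -> eucl y z < r -> (G z y <= (CN * g)%:E)%E.
  move=> h1 h2; rewrite EFinM -E.
  apply: (harnack_chain cH0 (fun z => G0 z y) hH Oy r0 yr hO); last by lra.
  by apply: le_trans h1; rewrite ler_wpM2r// ltW.
have := green_annulus_le mG G0 r0 (mulr_ge0 (ltW CN0) g0) hL.
rewrite I1 I2 -EFinD lee_fin -/V => hf.
have ra0 : 0 < r `^ alpha by exact: powR_gt0.
have rd0 : 0 < r ^+ d by exact: exprn_gt0.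
have h2 : f2 y <= c1 / 2 * r `^ alpha.
  apply: (le_trans uf2); rewrite powRM ?(ltW eps0) ?(ltW r0)// mulrA.
  apply: ler_wpM2r; first exact: ltW.
  apply: le_trans epsC; apply: ler_wpM2l; first exact: ltW.
  by apply: ger_powR => //; rewrite eps0.
have h3 : c1 / 2 * r `^ alpha <= CN * g * (r ^+ d * V) by lra.
rewrite lee_fin powRD; last by apply/implyP => _; rewrite gt_eqF.
rewrite powRN powR_mulrn ?(ltW r0)//.
have D0 : 0 < CN * (r ^+ d * V) by rewrite mulr_gt0// mulr_gt0.
rewrite -(ler_pM2r D0).
have -> : g * (CN * (r ^+ d * V)) = CN * g * (r ^+ d * V) by ring.
apply: le_trans h3; rewrite le_eqVlt; apply/orP; left; apply/eqP; field.
by rewrite !gt_eqF.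
Qed.
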